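(* Assume that there exist three positive constants $K_3$, $R$ and $\kappa>2$ such that $$\langle b(t,x),x\rangle\le-K_3|x|^\kappa,\qquad t\in I,\ x\in\mathbb R^d\setminus B(0,R).$$ Then the evolution operator $G(t,s)$ is ultracontractive.
   Context: Setting. $I$ is an open right halfline, and for $t\in I$, $(\mathcal A(t)\zeta)(x)=\mathrm{Tr}(Q(t)D^2\zeta(x))+\langle b(t,x),\nabla\zeta(x)\rangle$, $x\in\mathbb R^d$, where $Q=[q_{ij}]$ and $b=(b_1,\dots,b_d)$. Standing assumptions: (i) for some $\theta\in(0,1)$, $q_{ij}\in C^{\theta/2}_{\rm loc}(I)$ and $b_i\in C^{\theta/2,\theta}_{\rm loc}(I\times\mathbb R^d)$ (locally parabolic H\''older); (ii) $Q(t)$ is symmetric and there are $0<\eta_0<\Lambda$ with $\eta_0|\xi|^2\le\langle Q(t)\xi,\xi\rangle\le\Lambda|\xi|^2$ for all $t\in I$, $\xi\in\mathbb R^d$; (iii) there are a positive $\varphi\in C^2(\mathbb R^d)$ with $\varphi(x)\to+\infty$ as $|x|\to+\infty$ and constants $a,\gamma>0$ with $(\mathcal A(t)\varphi)(x)\le a-\gamma\varphi(x)$ for all $(t,x)\in I\times\mathbb R^d$; (iv) the first order spatial derivatives of $b_i$ exist and belong to $C^{\theta/2,\theta}_{\rm loc}(I\times\mathbb R^d)$, and there is $r_0<0$ with $\langle\nabla_xb(t,x)\xi,\xi\rangle\le r_0|\xi|^2$ for all $(t,x)\in I\times\mathbb R^d$, $\xi\in\mathbb R^d$. For $s\in I$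 and $f\in C_b(\mathbb R^d)$, $G(\cdot,s)f\in C_b([s,+\infty)\times\mathbb R^d)\cap C^{1+\theta/2,2+\theta}_{\rm loc}((s,+\infty)\times\mathbb R^d)$ denotes the unique bounded classical solution of $D_tu=\mathcal A(t)u$ in $(s,+\infty)\times\mathbb R^d$, $u(s,\cdot)=f$. Under these assumptions there is a unique family $\{\mu_t:t\in I\}$ of Borel probability measures which is tight (for every $\varepsilon>0$ there is $R>0$ with $\mu_t(B(0,R))\ge1-\varepsilon$ for all $t\in I$) and satisfies $\int G(t,s)f\,d\mu_t=\int f\,d\mu_s$ for all $t>s$ in $I$, $f\in C_b(\mathbb R^d)$ (the tight evolution system of measures). $G(t,s)$ extends to a contraction from $L^p(\mathbb R^d,\mu_s)$ to $L^p(\mathbb R^d,\mu_t)$ for every $p\in[1,+\infty)$, still denoted $G(t,s)$. $\|G(t,s)\|_{p\to\infty}$ is the operator norm from $L^p(\mathbb R^d,\mu_s)$ to $L^\infty(\mathbb R^d)$. $B(0,R)$ is the ball centered at $0$ with radius $R$. $G(t,s)$ is called ultracontractive if it maps $L^p(\mathbb R^d,\mu_s)$ into $L^\infty(\mathbb R^d)$ for every $p\ge1$ and $t>s$ in $I$, and (for each such $p$) there is a decreasing function $C_{p,\infty}:(0,+\infty)\to(0,+\infty)$ with $\lim_{r\to0^+}C_{p,\infty}(r)=+\infty$ and $\|G(t,s)\|_{p\to\infty}\le C_{p,\infty}(t-s)$ for all $s<t$ in $I$. *)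

(* Defs.v *)
From HB Require Import structures.
From mathcomp Require Import all_boot all_order all_algebra.
From mathcomp Require Import all_classical all_reals all_analysis.

Set Implicit Arguments.
Unset Strict Implicit.
Unset Printing Implicit Defensive.

Import Order.TTheory GRing.Theory Num.Theory.
Import numFieldNormedType.Exports.

Local Open Scope classical_set_scope.
Local Open Scope ring_scope.

(* The library norm on 'rV[R]_n is the max norm, whence the explicit Euclidean
   norm below; both induce the same topology. *)
Section euclidean.
Context {R : realType} {n : nat}.
Implicit Types (x y xi : 'rV[R]_n) (M : 'M[R]_n).

Definition inner x y : R := \sum_i x 0 i * y 0 i.

Definition enorm x : R := Num.sqrt (inner x x).

Definition eball (rho : R) : set 'rV[R]_n := [set x | enorm x < rho].

(* <M xi, xi>; vectors are rows, so M xi is xi *m M^T. *)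
Definition qform M xi : R := inner (xi *m M^T) xi.

End euclidean.

Section differential_operators.
Context {R : realType} {n : nat}.
Implicit Types (f : 'rV[R]_n -> R) (x : 'rV[R]_n) (i j : 'I_n).

Definition pder i f x : R := 'D_(delta_mx 0 i) f x.

Definition pderivable i f x : Prop := derivable f x (delta_mx 0 i).

Definition grad f x : 'rV[R]_n := \row_i pder i f x.

Definition hessian f x : 'M[R]_n := \matrix_(i, j) pder i (pder j f) x.

Definition Dmx (v : 'rV[R]_n -> 'rV[R]_n) x : 'M[R]_n :=
  \matrix_(i, j) pder j (fun y => v y 0 i) x.

Definition opA (Q : R -> 'M[R]_n) (b : R -> 'rV[R]_n -> 'rV[R]_n)
    (t : R) f x : R :=
  \tr (Q t *m hessian f x) + inner (b t x) (grad f x).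

Definition C2 f : Prop :=
  [/\ continuous f,
      forall i x, pderivable i f x,
      forall i, continuous (pder i f),
      forall i j x, pderivable i (pder j f) x
    & forall i j, continuous (pder i (pder j f))].

Definition Cb f : Prop :=
  continuous f /\ exists M : R, forall x, `|f x| <= M.

End differential_operators.

Section hoelder_spaces.
Context {R : realType} {n : nat}.

(* q \in C^alpha_loc(J) *)
Definition hoelder_loc (J : set R) (alpha : R) (q : R -> R) : Prop :=
  forall t1 t2 : R, `[t1, t2] `<=` J ->
  exists C : R, forall t s, t \in `[t1, t2] -> s \in `[t1, t2] ->
    `|q t - q s| <= C * `|t - s| `^ alpha.

(* w \in C^{theta/2, theta}_loc(J x R^n) *)
Definition par_hoelder_loc (J : set R) (theta : R)
    (w : R -> 'rV[R]_n -> R) : Prop :=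
  forall t1 t2 rho : R, `[t1, t2] `<=` J ->
  exists C : R, forall t s x y, t \in `[t1, t2] -> s \in `[t1, t2] ->
    enorm x <= rho -> enorm y <= rho ->
    `|w t x - w s y| <= C * (`|t - s| `^ (theta / 2) + enorm (x - y) `^ theta).

(* u \in C^{1 + theta/2, 2 + theta}_loc(J x R^n) *)
Definition par_hoelder2_loc (J : set R) (theta : R)
    (u : R -> 'rV[R]_n -> R) : Prop :=
  [/\ forall t x, J t -> derivable (u ^~ x) t 1,
      forall t x i, J t -> pderivable i (u t) x,
      forall t x i j, J t -> pderivable i (pder j (u t)) x
    & [/\ par_hoelder_loc J theta u,
          par_hoelder_loc J theta (fun t x => derive1 (u ^~ x) t),
          forall i, par_hoelder_loc J theta (fun t => pder i (u t))
        & forall i j,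
            par_hoelder_loc J theta (fun t => pder i (pder j (u t)))]].

End hoelder_spaces.

Section assumptions.
Context {R : realType} {n : nat}.
Variables (J : set R) (Q : R -> 'M[R]_n) (b : R -> 'rV[R]_n -> 'rV[R]_n).

Record standing_assumptions (theta eta0 Lambda a gamma r0 : R)
    (phi : 'rV[R]_n -> R) : Prop := StandingAssumptions {
  theta_gt0 : 0 < theta ;
  theta_lt1 : theta < 1 ;
  Q_hoelder : forall i j, hoelder_loc J (theta / 2) (fun t => Q t i j) ;
  b_hoelder : forall i, par_hoelder_loc J theta (fun t x => b t x 0 i) ;
  Q_sym : forall t, J t -> (Q t)^T = Q t ;
  eta0_gt0 : 0 < eta0 ;
  eta0_lt_Lambda : eta0 < Lambda ;
  Q_elliptic : forall t xi, J t -> eta0 * enorm xi ^+ 2 <= qform (Q t) xi ;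
  Q_bounded : forall t xi, J t -> qform (Q t) xi <= Lambda * enorm xi ^+ 2 ;
  phi_C2 : C2 phi ;
  phi_gt0 : forall x, 0 < phi x ;
  phi_infty : forall M : R, exists rho : R,
    forall x, rho <= enorm x -> M <= phi x ;
  a_gt0 : 0 < a ;
  gamma_gt0 : 0 < gamma ;
  phi_lyapunov : forall t x, J t -> opA Q b t phi x <= a - gamma * phi x ;
  b_derivable : forall t x i j, J t -> pderivable j (fun y => b t y 0 i) x ;
  Db_hoelder : forall i j, par_hoelder_loc J theta (fun t x => Dmx (b t) x i j) ;
  r0_lt0 : r0 < 0 ;
  b_dissipative : forall t x xi, J t ->
    qform (Dmx (b t) x) xi <= r0 * enorm xi ^+ 2
}.

(* u \in C_b([s, +oo[ x R^n) \cap C^{1 + theta/2, 2 + theta}_loc(]s, +oo[ x R^n)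
   solves D_t u = A(t) u in ]s, +oo[ x R^n with u(s, .) = f. *)
Definition bounded_classical_solution (theta s : R) (f : 'rV[R]_n -> R)
    (u : R -> 'rV[R]_n -> R) : Prop :=
  [/\ {within [set z : R * 'rV[R]_n | s <= z.1],
        continuous (fun z : R * 'rV[R]_n => u z.1 z.2)},
      exists M : R, forall t x, s <= t -> `|u t x| <= M,
      par_hoelder2_loc `]s, +oo[ theta u,
      forall t x, s < t -> derive1 (u ^~ x) t = opA Q b t (u t) x
    & forall x, u s x = f x].

Definition evolution_operator (theta : R)
    (G : R -> R -> ('rV[R]_n -> R) -> 'rV[R]_n -> R) : Prop :=
  forall s f, J s -> Cb f ->
    bounded_classical_solution theta s f (fun t => G t s f).

End assumptions.

HB.instance Definition _ (R : realType) (m n : nat) :=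
  @isMeasurable.Build (sigma_display (@open 'M[R]_(m, n))) 'M[R]_(m, n)
    <<s open >> (@sigma_algebra0 _ setT open) (@sigma_algebraC _ open)
    (@sigma_algebra_bigcup _ setT open).

(* Lebesgue measure on R^n, n >= 1: the Caratheodory restriction of the outer
   measure given by countable covers by boxes. A box c has lower corner c.1 and
   upper corner c.2; it is empty, with volume 0, unless c.1 <= c.2. *)
Section lebesgue.
Context {R : realType} {n : nat}.
Local Notation V := 'rV[R]_n.+1.

Definition box (c : V * V) : set V :=
  [set x | forall i, c.1 0 i <= x 0 i <= c.2 0 i].

Definition box_volume (c : V * V) : R :=
  \prod_i Num.max 0 (c.2 0 i - c.1 0 i).

Local Open Scope ereal_scope.

Definition lebesgue_outer (A : set V) : \bar R :=
  ereal_inf [set \sum_(k <oo) (box_volume (c k))%:E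
            | c in [set c : nat -> V * V | A `<=` \bigcup_k box (c k)]].

Let vol_ge0 c : 0 <= (box_volume c)%:E.
Proof. by rewrite lee_fin; apply: prodr_ge0 => i _; rewrite le_max lexx. Qed.

Let lebesgue_outer_ge0 A : 0 <= lebesgue_outer A.
Proof. by apply: le_ereal_inf_tmp => _ [c _ <-]; exact: nneseries_ge0. Qed.

Let lebesgue_outer0 : lebesgue_outer set0 = 0.
Proof.
apply/eqP; rewrite eq_le lebesgue_outer_ge0 andbT.
apply: ereal_inf_lbound; exists (fun=> (0%R, 0%R)) => //.
rewrite eseries0// => k _ _; congr EFin.
by rewrite /box_volume big_ord_recl/= mxE subr0 maxxx mul0r.
Qed.

Let le_lebesgue_outer : {homo lebesgue_outer : A B / A `<=` B >-> A <= B}.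
Proof.
move=> A B AB; apply/ereal_inf_le_tmp => _ [c Bc <-].
by exists c => //; exact: subset_trans Bc.
Qed.

Let lebesgue_outer_sigma_subadditive : sigma_subadditive lebesgue_outer.
Proof.
move=> A; have [[i ioo]|] := pselect (exists i, lebesgue_outer (A i) = +oo).
  rewrite (eseries_pinfty _ _ ioo) ?leey// => k _.
  by rewrite -ltNye (lt_le_trans _ (lebesgue_outer_ge0 _)).
rewrite -forallNE => Aoo.
suff add2e (e : {posnum R}) : lebesgue_outer (\bigcup_k A k) <=
    \sum_(i <oo) lebesgue_outer (A i) + e%:num%:E.
  by apply/lee_addgt0Pr => _/posnumP[].
rewrite (le_trans _ (epsilon_trick _ _ _))//.
pose P k (c : nat -> V * V) := A k `<=` \bigcup_j box (c j) /\
  \sum_(j <oo) (box_volume (c j))%:E <=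
  lebesgue_outer (A k) + (e%:num / (2 ^ k.+1)%:R)%:E.
have [G PG] : {G : nat -> nat -> V * V & forall k, P k (G k)}.
  apply: (@choice _ _ P) => k; rewrite /P.
  have en1 : (0 < e%:num / (2 ^ k.+1)%:R :> R)%R by [].
  have fin : lebesgue_outer (A k) \is a fin_num.
    by rewrite ge0_fin_numE// ltey; exact/eqP/Aoo.
  have [_ [c Ac <-] cle] := lb_ereal_inf_adherent en1 fin.
  by exists c; split => //; exact: ltW.
pose v (p : nat * nat) := (box_volume (G p.1 p.2))%:E.
have v_ge0 p : 0 <= v p by exact: vol_ge0.
apply: (@le_trans _ _ (\esum_(p in setT) v p)).
  apply: ereal_inf_lbound => /=.
  have /card_esym/ppcard_eqP[f] := card_nat2.
  exists (fun k => G (f k).1 (f k).2).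
    move=> x [i _ /(PG i).1[j _ xij]]; exists (f^-1%FUN (i, j)) => //=.
    by rewrite invK ?inE.
  rewrite -(esum_pred_image v f xpredT) ?[fun=> _]set_true//.
  by rewrite image_eq.
rewrite (_ : esum _ _ = \sum_(i <oo) \sum_(j <oo) v (i, j)); last first.
  pose J : nat -> set (nat * nat) := fun i => [set (i, j) | j in setT].
  rewrite (_ : setT = \bigcup_k J k); last first.
    by rewrite predeqE => -[i j]; split => // _; exists i => //; exists j.
  rewrite esum_bigcupT /=; last 2 first.
  - apply/trivIsetP => i j _ _ ij.
    rewrite predeqE => -[k m] /=; split => //= -[] [_] _ [<-{k} _].
    by move=> [m' _] [] /esym/eqP; rewrite (negbTE ij).
  - by move=> p; exact: v_ge0.
  rewrite -(image_id [set: nat]) -fun_true esum_pred_image//; last first.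
    by move=> k _; exact: esum_ge0.
  apply: eq_eseriesr => /= j _.
  rewrite -(esum_pred_image v (pair j) predT)//=; last first.
    by move=> ? ? _ _; exact: (@can_inj _ _ _ snd).
  by congr esum; rewrite predeqE => -[? ?]; split; move=> [i _ <-]; exists i.
apply: lee_lim.
- by apply: is_cvg_nneseries => k *; exact: nneseries_ge0.
- by apply: is_cvg_nneseries => k *; exact: adde_ge0.
- by near=> k; apply: lee_sum => i _; exact: (PG i).2.
Unshelve. all: by end_near. Qed.

HB.instance Definition _ := isOuterMeasure.Build R V lebesgue_outer
  lebesgue_outer0 lebesgue_outer_ge0 le_lebesgue_outer
  lebesgue_outer_sigma_subadditive.

Let outer : {outer_measure set V -> \bar R} := lebesgue_outer.

Definition lebesgue_measure_rV :
    {measure set (caratheodory_type outer) -> \bar R} :=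
  outer : set (caratheodory_type outer) -> \bar R.

Definition Linfty_norm (f : V -> R) : \bar R :=
  'N[lebesgue_measure_rV]_+oo[EFin \o f].

End lebesgue.

Section evolution_measures.
Context {R : realType} {n : nat}.
Local Notation V := 'rV[R]_n.+1.
Variables (J : set R) (G : R -> R -> (V -> R) -> V -> R).
Variable mu : R -> probability V R.

Definition tight : Prop :=
  forall e : R, 0 < e -> exists2 rho : R, 0 < rho &
    forall t, J t -> ((1 - e)%:E <= mu t (eball rho))%E.

Definition evolution_system_of_measures : Prop :=
  forall s t f, J s -> J t -> s < t -> Cb f ->
    (\int[mu t]_x (G t s f x)%:E = \int[mu s]_x (f x)%:E)%E.

(* G t s, which is determined on Cb by the Cauchy problem, also denotes the
   extension to L^p(mu_s) as a linear contraction into L^p(mu_t). Elements of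
   L^p are represented by functions, so that for f in L^p the function G t s f
   is only one representative of its class. As Cb is dense in L^p(mu_s), this
   class is determined by the values of G t s on Cb. *)
Definition Lp_contraction_extension : Prop :=
  forall p s t, 1 <= p -> J s -> J t -> s < t ->
  [/\ forall f, f \in Lfun (mu s) p%:E -> G t s f \in Lfun (mu t) p%:E,
      forall f, f \in Lfun (mu s) p%:E ->
        ('N[mu t]_p%:E[EFin \o G t s f] <= 'N[mu s]_p%:E[EFin \o f])%E
    & forall (c : R) f g, f \in Lfun (mu s) p%:E -> g \in Lfun (mu s) p%:E ->
        {ae mu t, forall x,
           G t s (fun y => c * f y + g y) x = c * G t s f x + G t s g x}].

Definition opnorm_p_infty (p s t : R) : \bar R :=
  ereal_sup [set Linfty_norm (G t s f) | f in
    [set f | f \in Lfun (mu s) p%:E /\ ('N[mu s]_p%:E[EFin \o f] <= 1)%E]].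

Definition ultracontractive : Prop :=
  forall p : R, 1 <= p ->
  (forall s t, J s -> J t -> s < t ->
     forall f, f \in Lfun (mu s) p%:E -> (Linfty_norm (G t s f) < +oo)%E) /\
  exists C : R -> R,
    [/\ forall r, 0 < r -> 0 < C r,
        forall r1 r2, 0 < r1 -> r1 < r2 -> C r2 < C r1,
        C r @[r --> 0^'+] --> +oo
      & forall s t, J s -> J t -> s < t ->
          (opnorm_p_infty p s t <= (C (t - s))%:E)%E].

End evolution_measures.

(* Main.v *)
Require Import Defs.
From mathcomp Require Import all_boot all_order all_algebra.
From mathcomp Require Import all_classical all_reals all_analysis.
From mathcomp Require Import measurable_realfun ess_sup_inf.
From mathcomp Require Import ring lra.

Set Implicit Arguments.
Unset Strict Implicit.
Unset Printing Implicit Defensive.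

Import Order.TTheory GRing.Theory Num.Theory.
Import numFieldNormedType.Exports.

Local Open Scope classical_set_scope.
Local Open Scope ring_scope.

(** The drift grows like [|x|^(kappa - 1)] with [kappa > 2], so that it comes in
    from infinity in finite time and the growth of a datum is forgotten at once.
    To make this quantitative, the heart of the proof is the bound
    [|G(t,s) f| <= exp (C (1 + 1/(t - s))^N) * int |f| dmu_s], valid at every
    point for bounded continuous [f] ([one_to_infty]). It rests on the maximum
    principle alone.

    - A Harnack inequality without dimension, [harnack]:
      [G(t,s)f(x)^2 <= G(t,s)(f^2)(y) * exp (|x - y|^2 / (eta0 (t - s)))] for
      positive [f], by doubling the variables. It is here that the dissipativity
      of the drift is used, through [<b(x) - b(y), x - y> <= 0]. Averaging over [y]
      in a ball that carries half of the mass of each [mu_t], which exists by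
      tightness, and using the invariance of the measures gives a Gaussian bound
      in [x], with the norm of [f] in [L^2(mu_s)].
    - The supersolution [exp (m(t) + a(t) |x|^2)], in which [a] decreases to zero
      at the final time, turns the Gaussian bound into a constant ([smoothing]).
      The superlinear drift pays for the decrease of [a] at large [x].
    - This bounds [G(t,s)] from [L^2] to [L^infty] ([two_to_infty]). For positive
      [f] the square of the [L^2] norm is at most the product of the supremum and
      of the mean, which is invariant, and iterating over a shrinking sequence of
      times brings [L^2] down to [L^1] ([one_to_infty_positive]).

    Since each [mu_s] is a probability, [L^p] embeds in [L^1]. Bounded continuous
    functions are dense there ([Cb_dense_L1]), and [G(t,s)] contracts [L^1(mu_s)]
    into [L^1(mu_t)], so that the bound extends to all classes, almost everywhere
    for [mu_t] ([bound_extends]).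

    The norm of [L^infty] refers to Lebesgue measure, and the last step is that
    null sets of [mu_t] are Lebesgue null ([lebesgue_absolutely_continuous]). A
    subsolution built on the heat kernel with coefficients frozen at time [s]
    ([gaussian_lower_bound]), in which Hoelder continuity of [Q] makes the errors
    integrable in time, shows that the mean of a Gaussian of width [h] under
    [mu_s] is at least [c h^d] ([gaussian_mass]). Adding Gaussians over a fine grid
    bounds the mass of a dyadic cell below by its volume ([cell_mass]); maximal
    cells and regularity of the measure do the rest. *)

(** * Calculus on the line *)

Section line_calculus.
Context {R : realType}.
Implicit Types (f g : R -> R) (c t h : R).

Lemma derive_add f g t (a b : R) :
  is_derive t 1 f a -> is_derive t 1 g b -> is_derive t 1 (fun h => f h + g h) (a + b).
Proof. by move=> fa gb; exact: (is_deriveD fa gb). Qed.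

Lemma derive_scale f t (c a : R) :
  is_derive t 1 f a -> is_derive t 1 (fun h => c * f h) (c * a).
Proof. by move=> fa; exact: (is_deriveZ c fa). Qed.

Lemma derive_mul f g t (a b : R) :
  is_derive t 1 f a -> is_derive t 1 g b ->
  is_derive t 1 (fun h => f h * g h) (a * g t + f t * b).
Proof.
move=> fa gb; have := is_deriveM fa gb.
by rewrite /GRing.scale /= => /is_derive_eq; apply; ring.
Qed.

Lemma derive_eq f g t (a b : R) :
  is_derive t 1 f a -> f =1 g -> a = b -> is_derive t 1 g b.
Proof. by move=> fa /funext <- <-. Qed.

Lemma derive_const c t : is_derive t 1 (fun _ : R => c) 0.
Proof. exact: is_derive_cst. Qed.

Lemma derive_id1 t : is_derive t 1 (fun h : R => h) 1.
Proof. exact: is_derive_id. Qed.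

Lemma derive_expR f t (a : R) :
  is_derive t 1 f a -> is_derive t 1 (fun h => expR (f h)) (expR (f t) * a).
Proof. by move=> fa; exact: (is_derive1_comp (is_derive_expR (f t)) fa). Qed.

Lemma derive_ln f t (a : R) : 0 < f t ->
  is_derive t 1 f a -> is_derive t 1 (fun h => ln (f h)) (a / f t).
Proof.
move=> ft fa; have := is_derive1_comp (is_derive1_ln ft) fa.
by rewrite mulrC.
Qed.

Lemma derive_inv f t (a : R) : f t != 0 ->
  is_derive t 1 f a -> is_derive t 1 (fun h => (f h)^-1) (- a / f t ^+ 2).
Proof.
move=> ft fa; have := is_deriveV ft fa => /is_derive_eq; apply.
by rewrite /GRing.scale /= mulrC mulrN mulNr.
Qed.

Lemma derive_affine t (a c : R) : is_derive t 1 (fun h => a + c * h) c.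
Proof.
apply: derive_eq (derive_add (derive_const a t) (derive_scale c (derive_id1 t))) _ _ => //.
by rewrite add0r mulr1.
Qed.

Lemma derive_continuous f t (a : R) : is_derive t 1 f a -> {for t, continuous f}.
Proof. by move=> [df _]; apply: differentiable_continuous; exact/derivable1_diffP. Qed.

(** Only the values before [t] are compared, because a maximum over a time
    interval may sit at the end of it. *)
Lemma derive_ge0_at_left_max f s t (a : R) : s < t -> is_derive t 1 f a ->
  (forall r, s <= r <= t -> f r <= f t) -> 0 <= a.
Proof.
move=> st [df <-] fmax.
rewrite ['D_1 f t]cvg_at_leftE; last exact: df.
apply: limr_ge.
  rewrite -(cvg_at_leftE (fun h => h^-1 *: ((f \o shift t) _ - f t))) //.
  apply: cvg_trans df; apply: cvg_app.
  move=> A [e egt0 Ae]; exists e => // x xe xgt0; apply: Ae => //.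
  exact/ltr0_neq0.
near=> h; apply: mulr_le0.
  by rewrite invr_le0; apply: ltW; near: h; exists 1 => /=.
rewrite subr_le0 [_%:A]mulr1; apply: fmax; near: h.
exists (t - s); first by rewrite /= subr_gt0.
move=> h; rewrite /= distrC subr0 => /ltr_normlP [h1 h2] h0.
by apply/andP; split; lra.
Unshelve. all: by end_near. Qed.

(** A second order expansion at [0]: the second derivative is required at that
    point only, as is enough for the second derivative test. *)
Definition jet2 g (a1 a2 : R) := exists g' : R -> R,
  [/\ forall h, is_derive h 1 g (g' h), g' 0 = a1 & is_derive (0 : R) 1 g' a2].

Lemma jet2_eq f g (a1 a2 b1 b2 : R) : jet2 f a1 a2 -> f =1 g -> a1 = b1 -> a2 = b2 ->
  jet2 g b1 b2.
Proof. by move=> fa /funext <- <- <-. Qed.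

Lemma jet2_add f g (a1 a2 b1 b2 : R) : jet2 f a1 a2 -> jet2 g b1 b2 ->
  jet2 (fun h => f h + g h) (a1 + b1) (a2 + b2).
Proof.
move=> [f' [df f1 f2]] [g' [dg g1 g2]]; exists (fun h => f' h + g' h).
by split=> [h||]; [exact: derive_add|rewrite f1 g1|exact: derive_add].
Qed.

Lemma jet2_scale f (c a1 a2 : R) : jet2 f a1 a2 ->
  jet2 (fun h => c * f h) (c * a1) (c * a2).
Proof.
move=> [f' [df f1 f2]]; exists (fun h => c * f' h).
by split=> [h||]; [exact: derive_scale|rewrite f1|exact: derive_scale].
Qed.

Lemma jet2_opp f (a1 a2 : R) : jet2 f a1 a2 -> jet2 (fun h => - f h) (- a1) (- a2).
Proof. by move=> /(jet2_scale (-1)) /jet2_eq; apply => [h||]; rewrite mulN1r. Qed.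

Lemma jet2_const c : jet2 (fun=> c) 0 0.
Proof.
by exists (fun=> 0); split=> [h|//|]; exact: derive_const.
Qed.

Lemma jet2_quadratic (a0 a1 a2 : R) :
  jet2 (fun h => a0 + a1 * h + a2 * h ^+ 2) a1 (2 * a2).
Proof.
exists (fun h => a1 + (2 * a2) * h); split=> [h||].
- apply: derive_eq (derive_add (derive_affine h a0 a1)
    (derive_scale a2 (derive_mul (derive_id1 h) (derive_id1 h)))) _ _ => [x|] /=.
    by rewrite expr2.
  ring.
- by rewrite mulr0 addr0.
- exact: derive_affine.
Qed.

Lemma jet2_expR f (a1 a2 : R) : jet2 f a1 a2 ->
  jet2 (fun h => expR (f h)) (expR (f 0) * a1) (expR (f 0) * (a2 + a1 ^+ 2)).
Proof.
move=> [f' [df f1 f2]]; exists (fun h => expR (f h) * f' h); split=> [h||].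
- exact: derive_expR.
- by rewrite f1.
- apply: derive_eq (derive_mul (derive_expR (df 0)) f2) _ _ => //.
  by rewrite f1; ring.
Qed.

Lemma jet2_ln f (a1 a2 : R) : (forall h, 0 < f h) -> jet2 f a1 a2 ->
  jet2 (fun h => ln (f h)) (a1 / f 0) (a2 / f 0 - (a1 / f 0) ^+ 2).
Proof.
move=> f0 [f' [df f1 f2]]; exists (fun h => f' h * (f h)^-1); split=> [h||].
- exact: derive_ln.
- by rewrite f1.
- have fn0 := lt0r_neq0 (f0 0).
  apply: derive_eq (derive_mul f2 (derive_inv fn0 (df 0))) _ _ => //.
  by rewrite f1; field.
Qed.

Lemma jet2_continuous f (a1 a2 : R) : jet2 f a1 a2 -> continuous f.
Proof. by move=> [f' [df _ _]] h; exact: derive_continuous (df h). Qed.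

(** The second derivative test; a positive second derivative at a critical point
    would make [f'] positive just after it, against the mean value theorem. *)
Lemma jet2_at_max f (a1 a2 : R) : jet2 f a1 a2 ->
  (\forall h \near 0, f h <= f 0) -> a1 = 0 /\ a2 <= 0.
Proof.
move=> [f' [df f1 f2]] /nbhs_ballP [e /= e0 fmax].
have fmax' h : `|h| < e -> f h <= f 0.
  by move=> he; apply: fmax; rewrite /ball /= sub0r normrN.
have f10 : f' 0 = 0.
  have [] : is_derive (0 : R) 1 f 0.
    apply: (@derive1_at_max _ f (- e) e 0).
    - by lra.
    - by move=> t _; have [] := df t.
    - by rewrite in_itv /= oppr_lt0 e0.
    - by move=> t; rewrite in_itv /= => te; apply: fmax'; rewrite ltr_norml.
  by have [_ ->] := df 0.
split; first by rewrite -f1.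
rewrite leNgt; apply/negP => a20.
have [d d0 f'pos] : exists2 d, 0 < d & forall h, 0 < h < d -> 0 < f' h.
  have [dv f2E] := f2.
  rewrite -f2E in a20; have [d /= d0 fd] := cvgr_gt _ dv _ a20.
  exists d => // h /andP[h0 hd].
  have := fd h; rewrite /= sub0r normrN gtr0_norm// => /(_ hd (lt0r_neq0 h0)).
  by rewrite f10 subr0 addr0 [_%:A]mulr1 /GRing.scale /= pmulr_rgt0// invr_gt0.
pose k := Num.min e d / 2.
have k0 : 0 < k by rewrite divr_gt0// lt_min e0.
have [ke kd] : k < e /\ k < d.
  have m0 : 0 < Num.min e d by rewrite lt_min e0.
  have me : Num.min e d <= e by rewrite ge_min lexx.
  have md : Num.min e d <= d by rewrite ge_min lexx orbT.
  by rewrite /k; split; lra.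
have [z /[!in_itv] /= /andP[z0 zk]] := MVT k0 (fun x _ => df x)
  (continuous_subspaceT (fun x => derive_continuous (df x))).
rewrite subr0 => fE.
have : f k <= f 0 by apply: fmax'; rewrite gtr0_norm.
rewrite leNgt -subr_gt0 fE mulr_gt0//.
by apply: f'pos; rewrite z0/= (lt_trans zk).
Qed.

End line_calculus.

(** * Quadratic forms and directional derivatives *)

Section euclidean_algebra.
Context {R : realType} {n : nat}.
Implicit Types (x y z e xi : 'rV[R]_n) (M Q : 'M[R]_n).

Lemma innerC x y : inner x y = inner y x.
Proof. by apply: eq_bigr => i _; rewrite mulrC. Qed.

Lemma innerDl x y z : inner (x + y) z = inner x z + inner y z.
Proof. by rewrite -big_split; apply: eq_bigr => i _; rewrite !mxE mulrDl. Qed.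

Lemma innerZl (c : R) x y : inner (c *: x) y = c * inner x y.
Proof. by rewrite big_distrr; apply: eq_bigr => i _; rewrite !mxE /= mulrA. Qed.

Lemma innerDr x y z : inner x (y + z) = inner x y + inner x z.
Proof. by rewrite innerC innerDl !(innerC x). Qed.

Lemma innerZr (c : R) x y : inner x (c *: y) = c * inner x y.
Proof. by rewrite innerC innerZl (innerC x). Qed.

Lemma innerNl x y : inner (- x) y = - inner x y.
Proof. by rewrite -scaleN1r innerZl mulN1r. Qed.

Lemma innerNr x y : inner x (- y) = - inner x y.
Proof. by rewrite innerC innerNl innerC. Qed.

Definition innerE := (innerDl, innerDr, innerZl, innerZr, innerNl, innerNr).

Lemma inner0l y : inner 0 y = 0.
Proof. by rewrite -(scale0r 0) innerZl mul0r. Qed.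

Lemma inner_ge0 x : 0 <= inner x x.
Proof. by apply: sumr_ge0 => i _; rewrite -expr2 sqr_ge0. Qed.

Lemma enorm_ge0 x : 0 <= enorm x.
Proof. exact: sqrtr_ge0. Qed.

Lemma enorm_sqr x : enorm x ^+ 2 = inner x x.
Proof. by rewrite sqr_sqrtr// inner_ge0. Qed.

Lemma inner_sub_le x y : inner (x - y) (x - y) <= 2 * inner x x + 2 * inner y y.
Proof.
have := inner_ge0 (x + y); rewrite !innerE (innerC y x).
by rewrite mulrC; lra.
Qed.

Lemma coord_le_enorm x i : `|x 0 i| <= enorm x.
Proof.
rewrite -(@ler_pXn2r _ 2)// ?nnegrE ?enorm_ge0// enorm_sqr real_normK ?num_real//.
rewrite /inner (bigD1 i)//= -expr2 lerDl.
by apply: sumr_ge0 => j _; rewrite -expr2 sqr_ge0.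
Qed.

Lemma inner_mxE x y : inner x y = (x *m y^T) 0 0.
Proof. by rewrite mxE; apply: eq_bigr => i _; rewrite mxE. Qed.

Lemma inner_mulmxl x y M : inner (x *m M) y = inner x (y *m M^T).
Proof. by rewrite !inner_mxE trmx_mul trmxK mulmxA. Qed.

Lemma inner_delta x i : inner x (delta_mx 0 i) = x 0 i.
Proof.
rewrite /inner (bigD1 i)//= !mxE !eqxx mulr1 big1 ?addr0// => j ji.
by rewrite mxE eqxx /= (negbTE ji) mulr0.
Qed.

(** A norm on matrices that controls bilinear forms and traces of products by
    entrywise estimates. *)
Definition mxsum M : R := \sum_i \sum_j `|M i j|.

Lemma mxsum_ge0 M : 0 <= mxsum M.
Proof. by apply: sumr_ge0 => i _; apply: sumr_ge0. Qed.

Lemma inner_mx_le M x y : `|inner (x *m M) y| <= mxsum M * (enorm x * enorm y).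
Proof.
have -> : inner (x *m M) y = \sum_i \sum_j M i j * (x 0 i * y 0 j).
  rewrite /inner exchange_big /=; apply: eq_bigr => j _.
  by rewrite mxE mulr_suml; apply: eq_bigr => i _; ring.
apply: le_trans (ler_norm_sum _ _ _) _; rewrite /mxsum mulr_suml ler_sum// => i _.
apply: le_trans (ler_norm_sum _ _ _) _; rewrite mulr_suml ler_sum// => j _.
rewrite normrM ler_wpM2l// normrM ler_pM//; exact: coord_le_enorm.
Qed.

Lemma inner_mx_le_sqr M x : `|inner (x *m M) x| <= mxsum M * inner x x.
Proof. by rewrite -enorm_sqr expr2; exact: inner_mx_le. Qed.

Definition psd Q := forall xi, 0 <= inner (xi *m Q) xi.

(** Lagrange's reduction of a quadratic form: eliminating the pivots one by one
    writes a positive semidefinite matrix as a sum of squares of linear forms. It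
    turns the trace of [Q M] into a sum of second derivatives along lines. *)
Lemma psd_decomp Q : Q^T = Q -> psd Q ->
  exists s : seq 'rV[R]_n, Q = \sum_(v <- s) v^T *m v.
Proof.
move=> Qs Qp.
suff main k : forall Q, Q^T = Q -> psd Q ->
    (forall i j : 'I_n, (k <= i)%N -> Q i j = 0) -> (k <= n)%N ->
    exists s : seq 'rV[R]_n, Q = \sum_(v <- s) v^T *m v.
  by apply: (main n) => // i; rewrite leqNgt ltn_ord.
elim: k {Q Qs Qp} => [|k IH] Q Qs Qp Q0 kn.
  exists [::]; rewrite big_nil; apply/matrixP => i j; rewrite mxE; exact: Q0.
pose i0 := Ordinal kn; pose d : 'rV[R]_n := delta_mx 0 i0.
pose q := row i0 Q; pose a := Q i0 i0.
have dQ : d *m Q = q by rewrite -rowE.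
have qd : inner q d = a by rewrite inner_delta mxE.
have Qd x : inner (x *m Q) d = inner q x.
  by rewrite inner_mulmxl Qs dQ innerC.
have Qij i j : Q i j = Q j i by rewrite -{1}Qs mxE.
have exp_form x c : inner ((x + c *: d) *m Q) (x + c *: d) =
    inner (x *m Q) x + 2 * c * inner q x + c ^+ 2 * a.
  by rewrite mulmxDl -scalemxAl dQ !innerE Qd qd; ring.
have a_ge0 : 0 <= a by rewrite -qd -dQ.
have [a0|an0] := eqVneq a 0.
  apply: IH => // [i j|]; last exact: ltnW.
  rewrite leq_eqVlt => /orP[/eqP ki|]; last exact: Q0.
  have -> : i = i0 by apply: val_inj.
  have -> : Q i0 j = inner q (delta_mx 0 j) by rewrite inner_delta mxE.
  set x := delta_mx 0 j; set A := inner (x *m Q) x; set B := inner q x.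
  have H c : 0 <= A + 2 * c * B.
    by have := Qp (x + c *: d); rewrite exp_form a0 mulr0 addr0.
  apply/eqP/negPn/negP => B0.
  have := H (- (A + 1) / (2 * B)).
  have -> : A + 2 * (- (A + 1) / (2 * B)) * B = -1 by field.
  lra.
have a_gt0 : 0 < a by rewrite lt_neqAle eq_sym an0.
pose Q' := Q - a^-1 *: (q^T *m q).
have Q'E x : inner (x *m Q') x = inner (x *m Q) x - a^-1 * inner q x ^+ 2.
  rewrite mulmxBr innerDl innerNl -scalemxAr innerZl mulmxA; congr (_ - _ * _).
  rewrite innerC inner_mxE trmx_mul mulmxA trmx_mul trmxK.
  by rewrite mxE big_ord1 -!inner_mxE (innerC x).
have [|x||s Hs] := IH Q' _ _ _ (ltnW kn).
- by rewrite /Q' linearB linearZ /= trmx_mul trmxK Qs.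
- rewrite Q'E.
  have := Qp (x + (- (inner q x / a)) *: d); rewrite exp_form.
  suff -> : inner (x *m Q) x + 2 * - (inner q x / a) * inner q x +
    (- (inner q x / a)) ^+ 2 * a = inner (x *m Q) x - a^-1 * inner q x ^+ 2 by [].
  by field.
- move=> i j; rewrite /Q' !mxE big_ord1 !mxE leq_eqVlt => /orP[/eqP ki|ki].
    have -> : i = i0 by apply: val_inj.
    by rewrite -/a mulrA mulVf// mul1r subrr.
  by rewrite (Q0 i j)// (Qij i0 i) (Q0 i i0)// mul0r mulr0 subrr.
exists (Num.sqrt a^-1 *: q :: s); rewrite big_cons -Hs /Q' [(_ *: q)^T]linearZ /= -scalemxAl -scalemxAr.
by rewrite scalerA -expr2 sqr_sqrtr ?invr_ge0// addrC subrK.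
Qed.

Lemma trace_decomp (s : seq 'rV[R]_n) M :
  \tr ((\sum_(v <- s) v^T *m v) *m M) = \sum_(v <- s) inner (v *m M) v.
Proof.
rewrite mulmx_suml raddf_sum /=; apply: eq_bigr => v _.
by rewrite -mulmxA mxtrace_mulC /mxtrace big_ord1 -inner_mxE.
Qed.

Lemma form_decomp (s : seq 'rV[R]_n) x :
  inner (x *m (\sum_(v <- s) v^T *m v)) x = \sum_(v <- s) inner x v ^+ 2.
Proof.
elim: s => [|v s IH]; first by rewrite !big_nil mulmx0 inner0l.
rewrite !big_cons mulmxDr innerDl IH; congr (_ + _).
rewrite mulmxA innerC inner_mxE trmx_mul mulmxA trmx_mul trmxK.
by rewrite mxE big_ord1 -!inner_mxE (innerC v).
Qed.

End euclidean_algebra.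

Section line_derivatives.
Context {R : realType} {n : nat}.
Implicit Types (x y v w : 'rV[R]_n) (f : 'rV[R]_n -> R).

Lemma line_diff f x v (h : R) :
  (fun k : R => k^-1 *: (((fun h => f (x + h *: v)) \o shift h) (k *: (1 : R)) -
     f (x + h *: v))) =
  (fun k : R => k^-1 *: ((f \o shift (x + h *: v)) (k *: v) - f (x + h *: v))).
Proof.
apply/funext => k /=; congr (_ *: (f _ - _)).
by rewrite [_%:A]mulr1 scalerDl addrCA addrC -addrA addrC.
Qed.

Lemma line_derive f x v (h : R) : derivable f (x + h *: v) v ->
  is_derive h 1 (fun h => f (x + h *: v)) ('D_v f (x + h *: v)).
Proof.
by move=> df; split; rewrite /derivable /derive line_diff.
Qed.

Lemma line_MVT f v y (k : R) : (forall x, derivable f x v) ->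
  exists2 xi : R, `|xi| <= `|k| & f (y + k *: v) - f y = k * 'D_v f (y + xi *: v).
Proof.
move=> df; pose g (h : R) := f (y + h *: v).
have dg (h : R) : is_derive h 1 g ('D_v f (y + h *: v)) by exact: line_derive.
have cg A : {within A, continuous g}.
  by apply: continuous_subspaceT => h; exact: derive_continuous (dg h).
have g0 : g 0 = f y by rewrite /g scale0r addr0.
have [k0|k0] := leP 0 k.
  have [z /[!in_itv] /= /andP[z0 zk] E] := MVT_segment k0 (fun r _ => dg r) (cg _).
  exists z; first by rewrite !ger0_norm.
  by rewrite -g0 [LHS]E subr0 mulrC.
have [z /[!in_itv] /= /andP[z0 zk] E] := MVT_segment (ltW k0) (fun r _ => dg r) (cg _).
exists z; first by rewrite !ler0_norm ?lerN2 ?(ltW k0).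
rewrite -g0; have : g k - g 0 = - (g 0 - g k) by ring.
by move=> ->; rewrite [X in - X]E; ring.
Qed.

Lemma cvg_line x v : x + h *: v @[h --> (0 : R)] --> x.
Proof.
have : x + h *: v @[h --> (0 : R)] --> x + 0 *: v.
  by apply: cvgD; [exact: cvg_cst|apply: cvgZr_tmp; exact: cvg_id].
by rewrite scale0r addr0.
Qed.

(** Continuity of one of the two directional derivatives is what makes
    directional differentiation additive. *)
Lemma derive_dirD f v w (c : R) :
  (forall x, derivable f x v) -> (forall x, derivable f x w) ->
  continuous ('D_w f) ->
  forall x, derivable f x (v + c *: w) /\
    'D_(v + c *: w) f x = 'D_v f x + c * 'D_w f x.
Proof.
move=> dv dw cw x.
have /choice[xi Hxi] (h : R) : exists z : R, `|z| <= `|h * c| /\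
    f (x + h *: v + (h * c) *: w) - f (x + h *: v) =
    h * c * 'D_w f (x + h *: v + z *: w).
  by have [z z1 z2] := line_MVT (x + h *: v) (h * c) dw; exists z.
have xi0 : xi h @[h --> (0 : R)] --> (0 : R).
  apply/cvgr0Pnorm_le => e e0.
  have : (fun h : R => h * c) @ (0 : R) --> (0 : R).
    have : (fun h : R => h * c) @ (0 : R) --> 0 * c by apply: cvgMr_tmp; exact: cvg_id.
    by rewrite mul0r.
  move=> /cvgr0Pnorm_le /(_ _ e0); apply: filterS => h.
  by apply: le_trans; have [] := Hxi h.
have cvg1 : x + h *: v + xi h *: w @[h --> (0 : R)] --> x.
  have : x + h *: v + xi h *: w @[h --> (0 : R)] --> x + 0 *: w.
    by apply: cvgD; [exact: cvg_line|exact: cvgZr_tmp].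
  by rewrite scale0r addr0.
have cvg2 : c * 'D_w f (x + h *: v + xi h *: w) @[h --> (0 : R)] --> c * 'D_w f x.
  by apply: cvgMl_tmp; exact: (cvg_comp _ _ cvg1 (cw x)).
have cvg3 : (fun h : R => h^-1 *: ((f \o shift x) (h *: v) - f x)) @ 0^' --> 'D_v f x.
  exact: dv.
have lim : (fun h : R => h^-1 *: ((f \o shift x) (h *: (v + c *: w)) - f x)) @ 0^' -->
    'D_v f x + c * 'D_w f x.
  apply: cvg_trans (cvgD cvg3 (cvg_within_filter _ cvg2)).
  apply: near_eq_cvg; near=> h => /=.
  have h0 : h != 0 by near: h; exact: nbhs_dnbhs_neq.
  have [_ E] := Hxi h.
  rewrite !fctE /= [h *: (v + _) + x]addrC [h *: v + x]addrC.
  rewrite [h *: (v + _)]scalerDr scalerA addrA.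
  have -> : f (x + h *: v + (h * c) *: w) = h * c * 'D_w f (x + h *: v + xi h *: w)
    + f (x + h *: v) by rewrite -E subrK.
  by rewrite /GRing.scale /=; field.
by split; [apply: cvgP lim|apply: cvg_lim lim].
Unshelve. all: by end_near. Qed.

Definition C1 f := (forall i x, pderivable i f x) /\ forall i, continuous (pder i f).

(** The coordinate directions are added one at a time, which gives
    differentiability along every line from the partial derivatives. *)
Lemma C1_line f x v (h : R) : C1 f ->
  is_derive h 1 (fun h => f (x + h *: v)) (inner (grad f (x + h *: v)) v).
Proof.
move=> [df cf].
suff main (s : seq 'I_n) (y : 'rV[R]_n) :
    derivable f y (\sum_(i <- s) v 0 i *: delta_mx 0 i) /\
    'D_(\sum_(i <- s) v 0 i *: delta_mx 0 i) f y = \sum_(i <- s) v 0 i * pder i f y.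
  have := main (index_enum _) (x + h *: v); rewrite -row_sum_delta => -[+ E].
  move=> /line_derive /derive_eq; apply => //.
  rewrite E; apply: eq_bigr => i _.
  by rewrite mxE mulrC.
elim: s y => [|i s IH] y.
  by rewrite !big_nil; have [] := is_derive0 f y.
rewrite !big_cons addrC.
have [] := @derive_dirD f (\sum_(i <- s) v 0 i *: delta_mx 0 i) (delta_mx 0 i) (v 0 i)
  (fun x => (IH x).1) (df i) (cf i) y.
by rewrite (IH y).2 => ? ->; split => //; rewrite addrC.
Qed.

End line_derivatives.

(** * Parabolic maxima and bounded solutions *)

Lemma near_continuous_lt {R : realType} {T : topologicalType} (f : T -> R) x (c : R) :
  continuous f -> f x < c -> \forall y \near x, f y < c.
Proof. by move=> cf fx; apply: (cvgr_lt (f x)) => //; exact: cf. Qed.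

Lemma continuous_add {R : realType} {T : topologicalType} (f g : T -> R) :
  continuous f -> continuous g -> continuous (fun z => f z + g z).
Proof. by move=> cf cg z; apply: continuousD; [exact: cf|exact: cg]. Qed.

Lemma continuous_sub {R : realType} {T : topologicalType} (f g : T -> R) :
  continuous f -> continuous g -> continuous (fun z => f z - g z).
Proof. by move=> cf cg z; apply: continuousB; [exact: cf|exact: cg]. Qed.

Lemma continuous_opp {R : realType} {T : topologicalType} (f : T -> R) :
  continuous f -> continuous (fun z => - f z).
Proof. by move=> cf z; apply: continuousN; exact: cf. Qed.

Lemma continuous_mul {R : realType} {T : topologicalType} (f g : T -> R) :
  continuous f -> continuous g -> continuous (fun z => f z * g z).
Proof. by move=> cf cg z; apply: continuousM; [exact: cf|exact: cg]. Qed.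

Lemma continuous_const {R : realType} {T : topologicalType} (c : R) :
  continuous (fun _ : T => c).
Proof. by move=> z; exact: cst_continuous. Qed.

Lemma continuous_pair {T U V : topologicalType} (f : T -> U) (g : T -> V) :
  continuous f -> continuous g -> continuous (fun z => (f z, g z)).
Proof. by move=> cf cg z; apply: cvg_pair; [exact: cf|exact: cg]. Qed.

Lemma continuous_compose {T U V : topologicalType} (f : T -> U) (g : U -> V) :
  continuous f -> continuous g -> continuous (fun z => g (f z)).
Proof. by move=> cf cg z; apply: continuous_comp; [exact: cf|exact: cg]. Qed.

Lemma continuous_ln_pos {R : realType} {T : topologicalType} (f : T -> R) :
  (forall z, 0 < f z) -> continuous f -> continuous (fun z => ln (f z)).
Proof.
by move=> f0 cf z; apply: continuous_comp; [exact: cf|exact: continuous_ln].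
Qed.

Section euclidean_topology.
Context {R : realType} {n : nat}.
Implicit Types (x y z e : 'rV[R]_n).

Lemma cvg_sumr {T} {F : set_system T} {FF : Filter F} {V : normedModType R}
    {I} (r : seq I) (f : I -> T -> V) (l : I -> V) :
  (forall i, f i t @[t --> F] --> l i) ->
  \sum_(i <- r) f i t @[t --> F] --> \sum_(i <- r) l i.
Proof. by move=> fl; apply: cvg_big => //; exact: add_continuous. Qed.

Lemma cvg_inner {T} {F : set_system T} {FF : Filter F} (f g : T -> 'rV[R]_n) x y :
  f @ F --> x -> g @ F --> y -> inner (f t) (g t) @[t --> F] --> inner x y.
Proof.
move=> fx gy; apply: cvg_sumr => i.
exact: cvgM (cvg_comp _ _ fx (@coord_continuous _ _ _ 0 i x))
  (cvg_comp _ _ gy (@coord_continuous _ _ _ 0 i y)).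
Qed.

Lemma continuous_inner {T : topologicalType} (f g : T -> 'rV[R]_n) :
  continuous f -> continuous g -> continuous (fun t => inner (f t) (g t)).
Proof. by move=> cf cg t; apply: cvg_inner; [exact: cf|exact: cg]. Qed.

Lemma continuous_enorm : continuous (@enorm R n).
Proof.
move=> x; apply: (continuous_comp (f := fun x => inner x x)); last exact: sqrt_continuous.
by apply: continuous_inner => y; exact: cvg_id.
Qed.

Lemma continuous_mulmxr (M : 'M[R]_n) : continuous (fun x : 'rV[R]_n => x *m M).
Proof.
have -> : (fun x : 'rV[R]_n => x *m M) = (fun x => \sum_i x 0 i *: row i M).
  by apply/funext => x; rewrite mulmx_sum_row.
move=> x; apply: (@cvg_sumr _ (nbhs x)) => i; apply: cvgZr_tmp; exact: coord_continuous.
Qed.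

Lemma compact_inner_le (r : R) : compact [set x : 'rV[R]_n | inner x x <= r].
Proof.
apply: (@subclosed_compact _ _
    [set v : 'rV[R]_n | forall i, v ord0 i \in `[(- (r + 1)), (r + 1)]]).
- apply: (@preimage_closed _ _ (fun x : 'rV[R]_n => inner x x) [set t | t <= r]).
    by move=> x _; apply: continuous_inner => y; exact: cvg_id.
  exact: closed_le.
- apply: (@rV_compact _ _ (fun=> `[(- (r + 1)), (r + 1)]%classic)) => _.
  exact: segment_compact.
- move=> x /= xr i; rewrite in_itv /= -ler_norml.
  have r0 : 0 <= r by apply: le_trans xr; exact: inner_ge0.
  apply: le_trans (coord_le_enorm x i) _.
  rewrite -(@ler_pXn2r _ 2)// ?nnegrE ?enorm_ge0//; last by lra.
  by rewrite enorm_sqr; nra.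
Qed.

Lemma open_inner_lt (r : R) : open [set x : 'rV[R]_n | inner x x < r].
Proof.
apply: (@open_comp _ _ (fun x : 'rV[R]_n => inner x x) [set t | t < r]).
  by move=> x _; apply: continuous_inner => y; exact: cvg_id.
exact: open_lt.
Qed.

End euclidean_topology.

(** Compactness enters every comparison below in this form. In time the maximum is
    compared with earlier values only, since it may be attained at [T]. *)
Lemma parabolic_max (R : realType) (X : topologicalType) (K U : set X)
    (F : R -> X -> R) (s T t1 : R) (x1 : X) :
  compact K -> (forall x, K x -> ~ U x -> forall t, s <= t <= T -> F t x <= 0) ->
  continuous (fun z : R * X => F z.1 z.2) ->
  (forall x, K x -> F s x <= 0) ->
  s <= t1 <= T -> K x1 -> 0 < F t1 x1 ->
  exists t x, [/\ s < t <= T, K x, U x, 0 < F t x &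
    (forall r, s <= r <= t -> F r x <= F t x) /\
    (forall y, K y -> F t y <= F t x)].
Proof.
move=> cK FU cF F0 st1 Kx1 F1.
pose A : set (R * X) := `[s, T]%classic `*` K.
have A0 : A !=set0 by exists (t1, x1); split => //=; rewrite in_itv.
have cA : compact A by apply: compact_setX => //; exact: segment_compact.
have [[t x] /set_mem [/= + Kx] Fmax] :=
  compact_EVT_max A0 cA (continuous_subspaceT cF).
rewrite in_itv /= => /andP[st tT].
have {}Fmax r y : s <= r <= T -> K y -> F r y <= F t x.
  by move=> sr Ky; apply: (Fmax (r, y)); apply/mem_set; split => //=; rewrite in_itv.
have Fpos : 0 < F t x by exact: lt_le_trans F1 (Fmax _ _ st1 Kx1).
exists t, x; split => //.
- rewrite tT andbT lt_neqAle st andbT; apply/eqP => E.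
  by move: Fpos; rewrite -E ltNge F0.
- apply: contrapT => nU; move: Fpos; rewrite ltNge FU//; exact/andP.
- split=> [r /andP[sr rt]|y Ky]; apply: Fmax => //; rewrite ?sr ?st//.
  exact: le_trans tT.
Qed.

Section classical_solutions.
Context {R : realType} {n : nat}.
Variables (Q : R -> 'M[R]_n) (b : R -> 'rV[R]_n -> 'rV[R]_n).

(** What the comparison arguments use of a solution: along every line it has a
    second order expansion whose coefficients [p], [M] satisfy the equation. *)
Definition solves (s : R) (u : R -> 'rV[R]_n -> R) := forall t x, s < t ->
  exists p M, (forall e, jet2 (fun h => u t (x + h *: e)) (inner p e) (inner (e *m M) e)) /\
    is_derive t 1 (u ^~ x) (\tr (Q t *m M) + inner (b t x) p).

(** Freezing the time variable before [s] replaces continuity on a closed half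
    space by continuity everywhere. *)
Definition bounded_solution (s : R) (u : R -> 'rV[R]_n -> R) :=
  [/\ continuous (fun z : R * 'rV[R]_n => u (Num.max s z.1) z.2),
      exists B, forall t x, s <= t -> `|u t x| <= B
    & solves s u].

Lemma solves_later s r u : s <= r -> solves s u -> solves r u.
Proof. by move=> sr su t x rt; apply: su; exact: le_lt_trans rt. Qed.

Lemma continuous_clamp (s : R) :
  continuous (fun z : R * 'rV[R]_n => (Num.max s z.1, z.2)).
Proof.
move=> z.
have cm : Num.max s y.1 @[y --> z] --> Num.max s z.1.
  by apply: (@continuous_max _ _ (fun _ => s) (fun z => z.1)); [exact: cvg_cst|exact: cvg_fst].
exact: cvg_pair cm cvg_snd.
Qed.

Lemma continuous_later (s r : R) (u : R -> 'rV[R]_n -> R) : s <= r ->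
  continuous (fun z : R * 'rV[R]_n => u (Num.max s z.1) z.2) ->
  continuous (fun z : R * 'rV[R]_n => u (Num.max r z.1) z.2).
Proof.
move=> sr cu.
have -> : (fun z : R * 'rV[R]_n => u (Num.max r z.1) z.2) =
    (fun z => u (Num.max s z.1) z.2) \o (fun z => (Num.max r z.1, z.2)).
  apply/funext => z /=; congr u; rewrite [in RHS]max_r//.
  by rewrite le_max sr.
by move=> z; apply: continuous_comp; [exact: continuous_clamp|exact: cu].
Qed.

Lemma bounded_solution_later s r u : s <= r ->
  bounded_solution s u -> bounded_solution r u.
Proof.
move=> sr [cu [B Bu] su]; split; [exact: continuous_later cu| |exact: solves_later su].
by exists B => t x rt; apply: Bu; exact: le_trans rt.
Qed.

Lemma solves_opp s u : solves s u -> solves s (fun t x => - u t x).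
Proof.
move=> su t x st; have [p [M [J D]]] := su t x st; exists (- p), (- M); split=> [e|].
  by apply: jet2_eq (jet2_opp (J e)) _ _ _ => //; rewrite ?mulmxN ?innerNl.
apply: derive_eq (derive_scale (-1) D) _ _ => [r|]; first by rewrite mulN1r.
by rewrite mulmxN linearN /= innerNr; ring.
Qed.

Lemma solves_add s u v : solves s u -> solves s v -> solves s (fun t x => u t x + v t x).
Proof.
move=> su sv t x st; have [p [M [Ju Du]]] := su t x st; have [q [N [Jv Dv]]] := sv t x st.
exists (p + q), (M + N); split=> [e|].
  by apply: jet2_eq (jet2_add (Ju e) (Jv e)) _ _ _ => //; rewrite ?mulmxDr ?innerDl.
by apply: derive_eq (derive_add Du Dv) _ _ => //; rewrite mulmxDr linearD /= innerDr; ring.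
Qed.

Lemma bounded_solution_add s u v : bounded_solution s u -> bounded_solution s v ->
  bounded_solution s (fun t x => u t x + v t x).
Proof.
move=> [cu [B HB] su] [cv [B' HB'] sv]; split; [exact: continuous_add| |exact: solves_add].
exists (B + B') => t x st; apply: le_trans (ler_normD _ _) _.
by rewrite lerD// ?HB ?HB'.
Qed.

Lemma bounded_solution_opp s u : bounded_solution s u ->
  bounded_solution s (fun t x => - u t x).
Proof.
move=> [cu [B Bu] su]; split; [|by exists B => t x st; rewrite normrN Bu|exact: solves_opp].
by move=> z; apply: cvgN; exact: cu.
Qed.

Lemma bounded_solution_continuous_slice s u t : bounded_solution s u -> s <= t ->
  continuous (u t).
Proof.
move=> [cu _ _] st x.
have -> : u t = (fun z : R * 'rV[R]_n => u (Num.max s z.1) z.2) \o (fun y => (t, y)).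
  by apply/funext => y /=; rewrite max_r.
apply: continuous_comp; last exact: cu.
have ct : (fun _ : 'rV[R]_n => t) @ x --> t
  by exact: (@cvg_cst _ t _ (nbhs x) _).
have cid : (fun y : 'rV[R]_n => y) @ x --> x by exact: cvg_id.
exact: (cvg_pair ct cid).
Qed.

Lemma hoelder_continuous (J : set R) (theta : R) (w : R -> 'rV[R]_n -> R) t :
  0 < theta -> par_hoelder_loc J theta w -> J t -> continuous (w t).
Proof.
move=> th hw Jt.
suff main (x : 'rV[R]_n) : w t y @[y --> x] --> w t x by exact: main.
have tt : `[t, t] `<=` J.
  by move=> r /=; rewrite in_itv /= => /andP[tr rt]; have -> : r = t by lra.
have [C HC] := hw t t (enorm x + 1) tt.
apply/(@cvgrPdist_le _ _ _ (nbhs x)) => e e0 /=.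
pose d := (e / (`|C| + 1)) `^ theta^-1.
have C1 : 0 < `|C| + 1 by rewrite ltr_wpDl.
have d0 : 0 < d by rewrite powR_gt0// divr_gt0.
have near1 : \forall y \near x, enorm y < enorm x + 1.
  by apply: near_continuous_lt; [exact: continuous_enorm|rewrite ltrDl].
have near2 : \forall y \near x, enorm (x - y) < d.
  apply: (@near_continuous_lt R _ (fun y : 'rV[R]_n => enorm (x - y)) x d); last first.
    by rewrite subrr /enorm inner0l sqrtr0.
  move=> y; apply: continuous_comp; last exact: continuous_enorm.
  by apply: continuousB; [exact: cst_continuous|exact: cvg_id].
near=> y.
have yx : enorm y <= enorm x + 1 by apply: ltW; near: y.
have yd : enorm (x - y) <= d by apply: ltW; near: y.
apply: le_trans (HC t t x y _ _ _ yx) _.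
- by rewrite in_itv /= lexx.
- by rewrite in_itv /= lexx.
- by rewrite lerDl.
rewrite subrr normr0 powR0 ?add0r; last by rewrite mulf_neq0// ?gt_eqF// invr_eq0.
have le1 : enorm (x - y) `^ theta <= e / (`|C| + 1).
  have -> : e / (`|C| + 1) = d `^ theta.
    by rewrite /d -powRrM mulVf ?gt_eqF// powRr1// ltW// divr_gt0.
  by rewrite ge0_ler_powR ?nnegrE ?enorm_ge0 ?(ltW d0)// ltW.
apply: (@le_trans _ _ (`|C| * (e / (`|C| + 1)))).
  apply: le_trans (ler_wpM2r (powR_ge0 _ _) (ler_norm C)) _.
  exact: ler_wpM2l.
rewrite mulrCA ler_piMr ?(ltW e0)// ler_pdivrMr// mul1r; lra.
Unshelve. all: by end_near. Qed.

Lemma bounded_classical_solutionP theta s f u : 0 < theta ->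
  bounded_classical_solution Q b theta s f u ->
  bounded_solution s u /\ u s = f.
Proof.
move=> th [cu [B Bu] [dt dx dxx [_ _ hx hxx]] eqn us]; split; last exact/funext.
split; [|by exists B|].
  suff main (z : R * 'rV[R]_n) :
    u (Num.max s y.1) y.2 @[y --> z] --> u (Num.max s z.1) z.2 by exact: main.
  have le_clamp (y : R * 'rV[R]_n) : s <= Num.max s y.1 by rewrite le_max lexx.
  have cuz := (subspace_continuousP _ _).1 cu (Num.max s z.1, z.2) (le_clamp z).
  move=> A /= /cuz /(@continuous_clamp s z) H.
  have H' : \forall y \near z, s <= Num.max s y.1 -> A (u (Num.max s y.1) y.2) := H.
  change (\forall y \near z, A (u (Num.max s y.1) y.2)).
  near=> y; have : s <= Num.max s y.1 -> A (u (Num.max s y.1) y.2) by near: y.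
  exact.
move=> t x st.
have Jt : `]s, +oo[%classic t by rewrite /= in_itv /= st.
have c1 : C1 (u t).
  by split=> [i y|i]; [exact: dx|exact: hoelder_continuous (hx i) Jt].
have c2 j : C1 (pder j (u t)).
  by split=> [i y|i]; [exact: dxx|exact: (hoelder_continuous th (hxx i j) Jt)].
exists (grad (u t) x), (hessian (u t) x); split=> [e|].
  exists (fun h => inner (grad (u t) (x + h *: e)) e); split=> [h||].
  - exact: C1_line.
  - by rewrite scale0r addr0.
  - have -> : (fun h : R => inner (grad (u t) (x + h *: e)) e) =
        (fun h => \sum_j pder j (u t) (x + h *: e) * e 0 j).
      by apply/funext => h; apply: eq_bigr => j _; rewrite mxE.
    have D j : is_derive (0 : R) 1 (fun h => pder j (u t) (x + h *: e) * e 0 j)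
        (inner (grad (pder j (u t)) x) e * e 0 j).
      have := C1_line x e 0 (c2 j); rewrite scale0r addr0 => /(derive_scale (e 0 j)).
      by move=> /derive_eq; apply => [h|]; rewrite mulrC.
    have DS := is_derive_sum D.
    apply: derive_eq DS _ _; first by move=> h; rewrite fct_sumE.
    rewrite /inner; apply: eq_bigr => j _; congr (_ * _).
    by rewrite mxE; apply: eq_bigr => i _; rewrite !mxE mulrC.
have := eqn t x st; rewrite derive1E /opA => <-.
exact/derivableP/dt.
Unshelve. all: by end_near. Qed.

End classical_solutions.

(** * Comparison *)

Lemma inner_eq0 {R : realType} {n : nat} (x : 'rV[R]_n) : inner x x = 0 -> x = 0.
Proof.
move=> x0; apply/rowP => i; rewrite mxE; apply/eqP.
by rewrite -normr_le0 (le_trans (coord_le_enorm x i))// /enorm x0 sqrtr0.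
Qed.

Lemma inner_line {R : realType} {n : nat} (x e : 'rV[R]_n) (h : R) :
  inner (x + h *: e) (x + h *: e) = inner x x + 2 * inner x e * h + inner e e * h ^+ 2.
Proof. by rewrite !innerE (innerC e x); ring. Qed.

Lemma jet2_inner {R : realType} {n : nat} (x e : 'rV[R]_n) :
  jet2 (fun h : R => inner (x + h *: e) (x + h *: e)) (2 * inner x e) (2 * inner e e).
Proof.
apply: jet2_eq (jet2_quadratic (inner x x) (2 * inner x e) (inner e e)) _ _ _ => // h.
by rewrite inner_line.
Qed.

Lemma near_inner_lt {R : realType} {n : nat} (x e : 'rV[R]_n) (r : R) :
  inner x x < r -> \forall h \near (0 : R), inner (x + h *: e) (x + h *: e) < r.
Proof.
move=> xr; apply: (@near_continuous_lt R _ (fun h : R => inner (x + h *: e) (x + h *: e))).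
  exact: jet2_continuous (jet2_inner x e).
by rewrite scale0r addr0.
Qed.

(** By compactness the squared distance is bounded below where [D >= w], so that a
    large multiple of it dominates the upper bound of [D] there. *)
Lemma diagonal_gap {R : realType} {n : nat} (K : set ('rV[R]_n * 'rV[R]_n))
    (D : 'rV[R]_n * 'rV[R]_n -> R) (B w : R) :
  compact K -> continuous D -> (forall x, D (x, x) = 0) -> (forall z, D z <= B) ->
  0 < w ->
  exists2 d, 0 < d & forall z, K z -> D z <= inner (z.1 - z.2) (z.1 - z.2) / d + w.
Proof.
move=> cK cD D0 DB w0.
pose K2 := K `&` [set z | w <= D z].
have cK2 : compact K2.
  apply: compact_closedI => //; apply: (@preimage_closed _ _ D [set t | w <= t]).
    by move=> z _; exact: cD.
  exact: closed_ge.
have [K20|nK2] := pselect (K2 !=set0); last first.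
  exists 1 => // z Kz; apply: (@le_trans _ _ w); last first.
    by rewrite divr1 lerDr inner_ge0.
  by rewrite leNgt; apply/negP => wD; apply: nK2; exists z; split => //=; exact: ltW.
pose g (z : 'rV[R]_n * 'rV[R]_n) := inner (z.1 - z.2) (z.1 - z.2).
have cg : continuous g.
  by apply: continuous_inner => z; apply: cvgB; [exact: cvg_fst|exact: cvg_snd|
    exact: cvg_fst|exact: cvg_snd].
have [z0 /set_mem [Kz0 /= wz0] zmin] :=
  compact_EVT_min K20 cK2 (continuous_subspaceT cg).
have m0 : 0 < g z0.
  rewrite lt_neqAle inner_ge0 andbT eq_sym; apply/eqP => /inner_eq0 /eqP.
  rewrite subr_eq0 => /eqP E; move: wz0; rewrite (surjective_pairing z0) E D0.
  by rewrite leNgt w0.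
have B0 : 0 < B by apply: lt_le_trans w0 (le_trans wz0 (DB _)).
have d0 : 0 < g z0 / B by rewrite divr_gt0.
exists (g z0 / B) => //.
move=> z Kz; have [wD|Dw] := leP w (D z); last first.
  by apply: le_trans (ltW Dw) _; rewrite lerDr divr_ge0 ?inner_ge0// ltW.
apply: (@le_trans _ _ B); first exact: DB.
apply: (@le_trans _ _ (g z / (g z0 / B))); last by rewrite lerDl ltW.
rewrite invf_div mulrA ler_pdivlMr// mulrC ler_wpM2r ?(ltW B0)//.
by apply: zmin; apply/mem_set.
Qed.

Lemma le_of_small_slope (R : realType) (a c C : R) : 0 <= C ->
  (forall e, 0 < e -> e <= 1 -> a <= c + e * C) -> a <= c.
Proof.
move=> C0 H; apply/ler_addgt0Pr => e e0.
pose e1 := Num.min 1 (e / (C + 1)).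
have C1 : 0 < C + 1 by lra.
have e10 : 0 < e1 by rewrite lt_min ltr01 divr_gt0.
apply: le_trans (H e1 e10 _) _; first by rewrite ge_min lexx.
rewrite lerD2l; apply: (@le_trans _ _ (e / (C + 1) * C)).
  by rewrite ler_wpM2r// ge_min lexx orbT.
by rewrite -mulrA ler_piMr ?(ltW e0)// mulrC ler_pdivrMr// mul1r; lra.
Qed.

(** The consequences of the standing assumptions on which all comparisons rest.
    The last one keeps the penalization [|x|^2] under control; it is only locally
    uniform in time, like the bounds for the drift from which it comes. *)
Record dissipative_operator {R : realType} {n : nat} (t0 : R) (Q : R -> 'M[R]_n)
    (b : R -> 'rV[R]_n -> 'rV[R]_n) (eta0 Lam : R) : Prop := DissipativeOperator {
  dop_eta_gt0 : 0 < eta0 ;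
  dop_Lam_gt0 : 0 < Lam ;
  dop_sym : forall t, t0 < t -> (Q t)^T = Q t ;
  dop_low : forall t xi, t0 < t -> eta0 * inner xi xi <= inner (xi *m Q t) xi ;
  dop_up : forall t xi, t0 < t -> inner (xi *m Q t) xi <= Lam * inner xi xi ;
  dop_monotone : forall t x y, t0 < t -> inner (b t x - b t y) (x - y) <= 0 ;
  dop_drift : forall s T, t0 < s -> exists C, forall t x, s <= t <= T ->
    2 * \tr (Q t) + 2 * inner (b t x) x <= C
}.

Section comparison.
Context {R : realType} {n : nat}.
Variables (t0 : R) (Q : R -> 'M[R]_n) (b : R -> 'rV[R]_n -> 'rV[R]_n).
Variables (eta0 Lam : R).
Hypothesis HA : dissipative_operator t0 Q b eta0 Lam.

Lemma Q_decomp t : t0 < t -> exists sq : seq 'rV[R]_n, Q t = \sum_(v <- sq) v^T *m v.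
Proof.
move=> tt; apply: psd_decomp; first exact: (dop_sym HA).
by move=> xi; apply: le_trans (dop_low HA xi tt); rewrite mulr_ge0 ?inner_ge0// ltW// (dop_eta_gt0 HA).
Qed.

Lemma trace_Q t (sq : seq 'rV[R]_n) : Q t = \sum_(v <- sq) v^T *m v ->
  \tr (Q t) = \sum_(v <- sq) inner v v.
Proof.
move=> E; have := trace_decomp sq 1%:M; rewrite mulmx1 -E => ->.
by apply: eq_bigr => v _; rewrite mulmx1.
Qed.

(** Where [u - P] is maximal, its gradient vanishes, its second derivatives are
    nonpositive and its time derivative is nonnegative; the equation for [u]
    transfers this to the test function [P]. *)
Lemma touching_from_above s u (P : R -> 'rV[R]_n -> R) t x pt a1 a2 sq :
  solves Q b s u -> s < t ->
  Q t = \sum_(v <- sq) v^T *m v ->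
  (forall e, jet2 (fun h : R => P t (x + h *: e)) (a1 e) (a2 e)) ->
  is_derive t 1 (P ^~ x) pt ->
  (forall r, s <= r <= t -> u r x - P r x <= u t x - P t x) ->
  (forall e, \forall h \near (0 : R),
     u t (x + h *: e) - P t (x + h *: e) <= u t x - P t x) ->
  pt <= \sum_(v <- sq) a2 v + a1 (b t x).
Proof.
move=> su st QE JP DP tmax xmax; have [p [M [J D]]] := su t x st.
have step e : inner p e - a1 e = 0 /\ inner (e *m M) e - a2 e <= 0.
  apply: jet2_at_max (jet2_add (J e) (jet2_opp (JP e))) _.
  by rewrite scale0r addr0; exact: xmax.
have : 0 <= \tr (Q t *m M) + inner (b t x) p + -1 * pt.
  apply: (derive_ge0_at_left_max st (derive_add D (derive_scale (-1) DP))) => r rt.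
  by have := tmax r rt; lra.
have -> : \tr (Q t *m M) = \sum_(v <- sq) inner (v *m M) v by rewrite {1}QE trace_decomp.
rewrite innerC (subr0_eq (step (b t x)).1).
have : \sum_(v <- sq) inner (v *m M) v <= \sum_(v <- sq) a2 v.
  by apply: ler_sum => v _; have := (step v).2; rewrite subr_le0.
lra.
Qed.

(** Comparison with a supersolution, which needs to be one only where it lies
    below the solution. The quadratic penalization makes the maximum exist. *)
Lemma comparison s T (u P : R -> 'rV[R]_n -> R) : t0 < s ->
  bounded_solution Q b s u ->
  continuous (fun z : R * 'rV[R]_n => P z.1 z.2) ->
  (exists B, forall t x, s <= t <= T -> B <= P t x) ->
  (forall t x, s < t <= T -> P t x < u t x -> exists pt a1 a2,
     [/\ forall e, jet2 (fun h : R => P t (x + h *: e)) (a1 e) (a2 e),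
         is_derive t 1 (P ^~ x) pt
       & forall sq, Q t = \sum_(v <- sq) v^T *m v ->
           \sum_(v <- sq) a2 v + a1 (b t x) <= pt]) ->
  (forall x, u s x <= P s x) ->
  forall t x, s <= t <= T -> u t x <= P t x.
Proof.
move=> ts [cu [B Bu] su] cP [B' PB'] Psup Pini t1 x1 st1.
have [C HC] := dop_drift HA T ts.
pose C1 := `|C| + 1.
have C1C : C < C1 by rewrite /C1; have := ler_norm C; lra.
have C10 : 0 < C1 by rewrite /C1; have := normr_ge0 C; lra.
have st1' : s <= t1 by case/andP: st1.
apply: (@le_of_small_slope _ _ _ (inner x1 x1 + C1 * (t1 - s))).
  by rewrite addr_ge0 ?inner_ge0// mulr_ge0 ?(ltW C10)// subr_ge0.
move=> e e0 _; rewrite leNgt; apply/negP => contra.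
pose P1 (r : R) (y : 'rV[R]_n) := P r y + e * (inner y y + C1 * (r - s)).
pose F (r : R) (y : 'rV[R]_n) := u (Num.max s r) y - P1 r y.
pose r0 := Num.max (inner x1 x1 + 1) ((B - B') / e).
have [|y /= yr ny r rsT||y _|||| t [x [stT /= xr0 xr0' Fpos [Fr Fx]]]] :=
  @parabolic_max R _ [set y : 'rV[R]_n | inner y y <= r0] [set y | inner y y < r0]
    F s T t1 x1.
- exact: compact_inner_le.
- have st : s <= r by case/andP: rsT.
  have yr0 : inner y y = r0 by apply/eqP; rewrite eq_le yr leNgt; apply/negP.
  have : (B - B') / e <= r0 by rewrite /r0 le_max lexx orbT.
  rewrite ler_pdivrMr// => r0e.
  have := Bu _ y st; rewrite ler_norml => /andP[_ uB].
  have := PB' r y rsT.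
  have : 0 <= e * (C1 * (r - s)).
    by rewrite mulr_ge0 ?mulr_ge0 ?(ltW e0) ?(ltW C10)// subr_ge0.
  by rewrite /F /P1 max_r// yr0; lra.
- rewrite /F /P1; apply: continuous_sub; first exact: cu.
  apply: continuous_add; first exact: cP.
  apply: continuous_mul; first exact: continuous_const.
  apply: continuous_add; first by apply: continuous_inner => w; exact: cvg_snd.
  apply: continuous_mul; first exact: continuous_const.
  by apply: continuous_sub; [move=> z; exact: cvg_fst|exact: continuous_const].
- have := Pini y; have : 0 <= e * inner y y by rewrite mulr_ge0 ?inner_ge0// ltW.
  by rewrite /F /P1 maxxx subrr mulr0 addr0; lra.
- exact: st1.
- by rewrite /= /r0 le_max; apply/orP; left; lra.
- by rewrite /F /P1 max_r//; lra.
have /andP[st tT] := stT.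
have t0t : t0 < t by exact: lt_trans st.
have PP1 : P t x <= P1 t x.
  rewrite /P1 lerDl mulr_ge0 ?(ltW e0)// addr_ge0 ?inner_ge0// mulr_ge0 ?(ltW C10)//.
  by rewrite subr_ge0 ltW.
have uP : P t x < u t x by move: Fpos; rewrite /F max_r ?(ltW st)//; lra.
have [pt [a1 [a2 [JP DP Hsup]]]] := Psup t x stT uP.
have [sq QE] := Q_decomp t0t.
have JP1 v : jet2 (fun h : R => P1 t (x + h *: v)) (a1 v + e * (2 * inner x v + 0))
    (a2 v + e * (2 * inner v v + 0)).
  exact: jet2_add (JP v) (jet2_scale e (jet2_add (jet2_inner x v) (jet2_const _))).
have DP1 : is_derive t 1 (P1 ^~ x) (pt + e * C1).
  apply: derive_add => //; apply: derive_scale.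
  apply: derive_eq (derive_affine t (inner x x - C1 * s) C1) _ _ => // r.
  by rewrite mulrBr; ring.
have : pt + e * C1 <= \sum_(v <- sq) (a2 v + e * (2 * inner v v + 0)) +
    (a1 (b t x) + e * (2 * inner x (b t x) + 0)).
  apply: (touching_from_above su st QE JP1 DP1) => [r /andP[sr rt]|v].
    have := Fr r; rewrite sr rt /F !max_r ?(ltW st)//; exact.
  have := near_inner_lt v xr0'; apply: filterS => h hr.
  by have := Fx (x + h *: v) (ltW hr); rewrite /F !max_r ?(ltW st).
rewrite big_split /= -mulr_sumr.
under [in X in _ <= _ + e * X + _ -> _]eq_bigr do rewrite addr0.
rewrite -mulr_sumr -(trace_Q QE) addr0 (innerC x).
have := HC t x; rewrite (ltW st) tT => /(_ isT) HCt.
have := Hsup sq QE.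
have : e * (2 * \tr (Q t) + 2 * inner (b t x) x) <= e * C by rewrite ler_wpM2l// ltW.
have : e * C < e * C1 by rewrite ltr_pM2l.
lra.
Qed.

Lemma bounded_solution_le s u c : t0 < s -> bounded_solution Q b s u ->
  (forall x, u s x <= c) -> forall t x, s <= t -> u t x <= c.
Proof.
move=> ts su uc t x st.
apply: (@comparison s t u (fun _ _ => c)) => //.
- by move=> z; exact: cvg_cst.
- by exists c.
- move=> r y _ _; exists 0, (fun=> 0), (fun=> 0); split => [e||sq _].
  + exact: jet2_const.
  + exact: derive_const.
  + by rewrite big1 ?addr0.
- by rewrite st lexx.
Qed.

Lemma bounded_solution_ge s u c : t0 < s -> bounded_solution Q b s u ->
  (forall x, c <= u s x) -> forall t x, s <= t -> c <= u t x.
Proof.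
move=> ts su uc t x st; rewrite -lerN2.
apply: (bounded_solution_le ts (bounded_solution_opp su)) => // y.
by rewrite lerN2.
Qed.

End comparison.

(** * A Harnack inequality *)

Section harnack.
Context {R : realType} {n : nat}.
Variables (t0 : R) (Q : R -> 'M[R]_n) (b : R -> 'rV[R]_n -> 'rV[R]_n).
Variables (eta0 Lam : R).
Hypothesis HA : dissipative_operator t0 Q b eta0 Lam.

(** A dimension-free Harnack inequality, obtained by doubling the variables:
    the function [2 ln u(x) - ln v(y)] cannot exceed [|x - y|^2 / (eta0 (t - s))],
    because at a maximum of the difference equal increments of both variables
    leave [x - y] unchanged and cost no second derivative of the right-hand side,
    monotonicity of the drift has a sign, and the quadratic gradient terms
    produced by the logarithms leave at most [- <Q z, z> / (eta0 (t - s))^2] with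
    [z = x - y], which compensates the time derivative of the right-hand side. *)
Lemma harnack s (u v : R -> 'rV[R]_n -> R) cu : t0 < s ->
  bounded_solution Q b s u -> bounded_solution Q b s v ->
  0 < cu -> (forall t x, s <= t -> cu <= u t x) ->
  (forall x, v s x = u s x ^+ 2) ->
  forall t x y, s < t ->
    2 * ln (u t x) - ln (v t y) <= inner (x - y) (x - y) / (eta0 * (t - s)).
Proof.
move=> ts bu bv cu0 ucu vs.
have vcu t x : s <= t -> cu ^+ 2 <= v t x.
  apply: (bounded_solution_ge HA ts bv) => y.
  by rewrite vs lerXn2r// ?nnegrE ?(ltW cu0)// ?(le_trans (ltW cu0))// ucu.
have u0 t x : s <= t -> 0 < u t x by move=> st; exact: lt_le_trans cu0 (ucu _ _ st).
have v0 t x : s <= t -> 0 < v t x.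
  by move=> st; apply: lt_le_trans (vcu _ _ st); rewrite exprn_gt0.
have [cut [Bu Hu] su] := bu; have [cvt _ sv] := bv.
move=> t1 x1 y1 st1.
have eta_gt0 := dop_eta_gt0 HA; have Lam_gt0 := dop_Lam_gt0 HA.
pose Bd := Num.max 0 (2 * ln Bu - ln (cu ^+ 2)).
have Bd0 : 0 <= Bd by rewrite /Bd le_max lexx.
have HBd t x y : s <= t -> 2 * ln (u t x) - ln (v t y) <= Bd.
  move=> st; rewrite /Bd le_max; apply/orP; right.
  have uBu : u t x <= Bu by apply: le_trans (ler_norm _) (Hu _ _ st).
  have : ln (u t x) <= ln Bu.
    by rewrite ler_ln ?posrE// ?u0//; apply: lt_le_trans uBu; exact: u0.
  have : ln (cu ^+ 2) <= ln (v t y) by rewrite ler_ln ?posrE ?exprn_gt0 ?v0// vcu.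
  lra.
have [C HC] := dop_drift HA t1 ts.
pose Mc := 28 * Lam * Bd + 2 * `|C| + 1.
have Mc0 : 0 < Mc.
  by rewrite /Mc ltr_wpDl// addr_ge0// mulr_ge0// mulr_ge0// ltW.
pose E1 := inner x1 x1 + inner y1 y1 + Mc * (t1 - s) + 1.
have E10 : 0 <= E1.
  have := mulr_ge0 (ltW Mc0) (_ : 0 <= t1 - s); rewrite subr_ge0 (ltW st1) => /(_ isT).
  by have := inner_ge0 x1; have := inner_ge0 y1; rewrite /E1; lra.
apply: (le_of_small_slope E10) => e e0 e1.
pose r0 := Num.max (inner x1 x1 + inner y1 y1 + 1) (Bd / e).
pose B1 := [set y : 'rV[R]_n | inner y y <= r0].
pose U1 := [set y : 'rV[R]_n | inner y y < r0].
have cK : compact (B1 `*` B1) by apply: compact_setX; exact: compact_inner_le.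
have cln (w : R -> 'rV[R]_n -> R) (T : topologicalType) (f : T -> 'rV[R]_n) (g : T -> R) :
    continuous (fun z : R * 'rV[R]_n => w (Num.max s z.1) z.2) ->
    (forall t x, s <= t -> 0 < w t x) -> continuous f -> continuous g ->
    continuous (fun z => ln (w (Num.max s (g z)) (f z))).
  move=> cw w0 cf cg; apply: continuous_ln_pos => [z|].
    by apply: w0; rewrite le_max lexx.
  exact: (continuous_compose (continuous_pair cg cf) cw).
(* The shift by [d] makes the bound finite at the initial time. *)
have [d d0 Hd] : exists2 d, 0 < d & forall z, (B1 `*` B1) z ->
    2 * ln (u s z.1) - ln (v s z.2) <= inner (z.1 - z.2) (z.1 - z.2) / (eta0 * d) + e.
  have [|x|z||d d0 Hd] := @diagonal_gap R n (B1 `*` B1)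
      (fun z => 2 * ln (u s z.1) - ln (v s z.2)) Bd e cK.
  - have us : (fun z : 'rV[R]_n * 'rV[R]_n => 2 * ln (u s z.1) - ln (v s z.2)) =
      (fun z => 2 * ln (u (Num.max s s) z.1) - ln (v (Num.max s s) z.2)).
      by apply/funext => z; rewrite maxxx.
    rewrite us; apply: continuous_sub.
      apply: continuous_mul; first exact: continuous_const.
      by apply: (cln u _ _ (fun _ => s)) => // [z|]; [exact: cvg_fst|exact: continuous_const].
    by apply: (cln v _ _ (fun _ => s)) => // [z|]; [exact: cvg_snd|exact: continuous_const].
  - by rewrite /= vs lnXn ?u0// mulr_natl subrr.
  - exact: HBd.
  - exact: e0.
  exists (d / eta0); first by rewrite divr_gt0.
  by move=> z Kz; rewrite [eta0 * _]mulrC divfK ?gt_eqF//; exact: Hd.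
pose c (t : R) := (eta0 * (t - s + d))^-1.
have c0 t : s <= t -> 0 < c t.
  by move=> st; rewrite invr_gt0 mulr_gt0// ltr_wpDl// subr_ge0.
(* Besides the quadratic penalization, the term growing in time makes the
   inequality at the maximum strict. *)
pose F0 (t : R) (z : 'rV[R]_n * 'rV[R]_n) := 2 * ln (u t z.1) - ln (v t z.2)
   - c t * inner (z.1 - z.2) (z.1 - z.2) - e * (inner z.1 z.1 + inner z.2 z.2)
   - e * (Mc * (t - s)) - e.
suff main : F0 t1 (x1, y1) <= 0.
  move: main; rewrite /F0 /= => main.
  have : c t1 * inner (x1 - y1) (x1 - y1) <= inner (x1 - y1) (x1 - y1) / (eta0 * (t1 - s)).
    rewrite mulrC ler_wpM2l ?inner_ge0// /c lef_pV2 ?posrE ?mulr_gt0 ?subr_gt0//; last first.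
      by rewrite ltr_wpDl// subr_ge0 ltW.
    by rewrite ler_pM2l// lerDl ltW.
  by rewrite /E1; lra.
rewrite leNgt; apply/negP => contra.
pose F t := F0 (Num.max s t).
have [||||||| t [[x y] [stT /= Kxy [/= Ux Uy] Fpos [Fr Fx]]]] :=
  @parabolic_max R _ (B1 `*` B1) (U1 `*` U1) F s t1 t1 (x1, y1).
- exact: cK.
- move=> [x y] [/= Bx By] nU t /andP[st tt1].
  have : r0 <= inner x x + inner y y.
    rewrite leNgt; apply/negP => xyr; apply: nU; split; rewrite /U1 /=.
      by have := inner_ge0 y; lra.
    by have := inner_ge0 x; lra.
  have : Bd / e <= r0 by rewrite /r0 le_max lexx orbT.
  rewrite ler_pdivrMr// => r0e.
  rewrite -(ler_pM2r e0) => xye.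
  have := HBd t x y st.
  have : 0 <= c t * inner (x - y) (x - y) by rewrite mulr_ge0 ?inner_ge0// ltW// c0.
  have : 0 <= e * (Mc * (t - s)).
    by rewrite mulr_ge0 ?(ltW e0)// mulr_ge0 ?(ltW Mc0)// subr_ge0.
  by rewrite /F /F0 max_r//=; lra.
- have cm : continuous (fun z : R * ('rV[R]_n * 'rV[R]_n) => Num.max s z.1).
    move=> z; apply: (@continuous_max _ _ (fun _ => s) (fun z => z.1)).
      exact: cvg_cst.
    exact: cvg_fst.
  have cx : continuous (fun z : R * ('rV[R]_n * 'rV[R]_n) => z.2.1).
    by move=> z; apply: continuous_comp; [exact: cvg_snd|exact: cvg_fst].
  have cy : continuous (fun z : R * ('rV[R]_n * 'rV[R]_n) => z.2.2).
    by move=> z; apply: continuous_comp; [exact: cvg_snd|exact: cvg_snd].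
  have cms : continuous (fun z : R * ('rV[R]_n * 'rV[R]_n) => Num.max s z.1 - s).
    by apply: continuous_sub => //; exact: continuous_const.
  rewrite /F /F0; apply: continuous_sub; last exact: continuous_const.
  apply: continuous_sub; last first.
    apply: continuous_mul; first exact: continuous_const.
    by apply: continuous_mul; first exact: continuous_const.
  apply: continuous_sub; last first.
    apply: continuous_mul; first exact: continuous_const.
    by apply: continuous_add; apply: continuous_inner.
  apply: continuous_sub; last first.
    apply: continuous_mul; last first.
      by apply: continuous_inner => z; apply: cvgB; (exact: cx || exact: cy).
    move=> z; apply: (@continuousV _ _ (fun z => eta0 * (Num.max s z.1 - s + d))).
      by rewrite gt_eqF// mulr_gt0// ltr_wpDl// subr_ge0 le_max lexx.
    apply: continuous_mul; first exact: continuous_const.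
    by apply: continuous_add => //; exact: continuous_const.
  apply: continuous_sub.
    apply: continuous_mul; first exact: continuous_const.
    by apply: cln => //; move=> z; exact: cvg_fst.
  by apply: cln => //; move=> z; exact: cvg_fst.
- move=> [x y] Kxy.
  have := Hd (x, y) Kxy; rewrite /F /F0 /= maxxx subrr mulr0 mulr0 subr0 /c subrr add0r.
  have : 0 <= e * (inner x x + inner y y) by rewrite mulr_ge0 ?(ltW e0)// addr_ge0 ?inner_ge0.
  by rewrite [_^-1 * _]mulrC; lra.
- by rewrite (ltW st1) lexx.
- split; rewrite /B1 /= /r0 le_max; apply/orP; left.
    by have := inner_ge0 y1; lra.
  by have := inner_ge0 x1; lra.
- by rewrite /F max_r// ltW.
have /andP[st tt1] := stT.
have {}Fr r : s <= r <= t -> F0 r (x, y) <= F0 t (x, y).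
  by move=> /andP[sr rt]; have := Fr r; rewrite sr rt /F !max_r ?(ltW st)//; exact.
have {}Fx z : (B1 `*` B1) z -> F0 t z <= F0 t (x, y).
  by move=> Kz; have := Fx z Kz; rewrite /F max_r ?(ltW st).
have {}Fpos : 0 < F0 t (x, y) by move: Fpos; rewrite /F max_r ?(ltW st).
have t0t : t0 < t by exact: lt_trans st.
have [sq QE] := Q_decomp HA t0t.
have [p [M [Ju Du]]] := su t x st; have [q [N [Jv Dv]]] := sv t y st.
have U0 := u0 t x (ltW st); have V0 := v0 t y (ltW st).
have Jlu k : jet2 (fun h : R => 2 * ln (u t (x + h *: k))) (2 * (inner p k / u t x))
    (2 * (inner (k *m M) k / u t x - (inner p k / u t x) ^+ 2)).
  have := jet2_scale 2 (jet2_ln (fun h => u0 t (x + h *: k) (ltW st)) (Ju k)).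
  by rewrite scale0r addr0.
have Jlv k : jet2 (fun h : R => - ln (v t (y + h *: k))) (- (inner q k / v t y))
    (- (inner (k *m N) k / v t y - (inner q k / v t y) ^+ 2)).
  have := jet2_opp (jet2_ln (fun h => v0 t (y + h *: k) (ltW st)) (Jv k)).
  by rewrite scale0r addr0.
pose z := x - y.
have gradx k : inner p k / u t x = c t * inner z k + e * inner x k.
  have J : jet2 (fun h => F0 t (x + h *: k, y))
     (2 * (inner p k / u t x) - c t * (2 * inner z k) - e * (2 * inner x k))
     (2 * (inner (k *m M) k / u t x - (inner p k / u t x) ^+ 2)
       - c t * (2 * inner k k) - e * (2 * inner k k)).
    apply: jet2_eq (jet2_add (jet2_add (jet2_add (Jlu k)
      (jet2_scale (- c t) (jet2_inner z k))) (jet2_scale (- e) (jet2_inner x k)))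
      (jet2_const (- ln (v t y) - e * inner y y - e * (Mc * (t - s)) - e))) _ _ _.
    - by move=> h; rewrite /F0 /= /z [x + _ - y]addrAC; ring.
    - by ring.
    - by ring.
  have [|E _] := jet2_at_max J; last by lra.
  rewrite scale0r addr0; have := near_inner_lt k Ux; apply: filterS => h hr.
  by apply: Fx; split => /=; apply: ltW.
have grady k : inner q k / v t y = 2 * (c t * inner z k) - 2 * (e * inner y k).
  have J : jet2 (fun h => F0 t (x, y + h *: k))
     (- (inner q k / v t y) - c t * (2 * inner (y - x) k) - e * (2 * inner y k))
     (- (inner (k *m N) k / v t y - (inner q k / v t y) ^+ 2)
       - c t * (2 * inner k k) - e * (2 * inner k k)).
    apply: jet2_eq (jet2_add (jet2_add (jet2_add (Jlv k)
      (jet2_scale (- c t) (jet2_inner (y - x) k))) (jet2_scale (- e) (jet2_inner y k)))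
      (jet2_const (2 * ln (u t x) - e * inner x x - e * (Mc * (t - s)) - e))) _ _ _.
    - move=> h; rewrite /F0 /=.
      have -> : inner (x - (y + h *: k)) (x - (y + h *: k)) =
          inner (y - x + h *: k) (y - x + h *: k).
        have -> : x - (y + h *: k) = - (y - x + h *: k) by rewrite [RHS]opprD opprB [- (y + _)]opprD addrA.
        by rewrite innerNl innerNr opprK.
      by ring.
    - by ring.
    - by ring.
  have [|E _] := jet2_at_max J; last first.
    have : inner (y - x) k = - inner z k by rewrite -innerNl opprB.
    by move: E => /[swap] ->; lra.
  rewrite scale0r addr0; have := near_inner_lt k Uy; apply: filterS => h hr.
  by apply: Fx; split => /=; apply: ltW.
(* The same increment in both variables leaves [x - y] unchanged. *)
have hess k : 2 * (inner (k *m M) k / u t x) - inner (k *m N) k / v t y <=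
    2 * (inner p k / u t x) ^+ 2 - (inner q k / v t y) ^+ 2 + e * (4 * inner k k).
  have J : jet2 (fun h => F0 t (x + h *: k, y + h *: k))
     (2 * (inner p k / u t x) - (inner q k / v t y) - e * (2 * inner x k)
        - e * (2 * inner y k))
     (2 * (inner (k *m M) k / u t x - (inner p k / u t x) ^+ 2)
       - (inner (k *m N) k / v t y - (inner q k / v t y) ^+ 2)
       - e * (2 * inner k k) - e * (2 * inner k k)).
    apply: jet2_eq (jet2_add (jet2_add (jet2_add (jet2_add (Jlu k) (Jlv k))
      (jet2_scale (- e) (jet2_inner x k))) (jet2_scale (- e) (jet2_inner y k)))
      (jet2_const (- c t * inner z z - e * (Mc * (t - s)) - e))) _ _ _.
    - move=> h; rewrite /F0 /= /z.
      have -> : x + h *: k - (y + h *: k) = x - y by rewrite opprD addrACA subrr addr0.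
      by ring.
    - by ring.
    - by ring.
  have [|_ E] := jet2_at_max J; last by lra.
  rewrite scale0r !addr0; have := near_inner_lt k Ux; have := near_inner_lt k Uy.
  apply: filterS2 => h hr hr'.
  by apply: Fx; split => /=; apply: ltW.
have time : 0 <= 2 * ((\tr (Q t *m M) + inner (b t x) p) / u t x)
    - (\tr (Q t *m N) + inner (b t y) q) / v t y
    + eta0 * c t ^+ 2 * inner z z - e * Mc.
  apply: (derive_ge0_at_left_max st _ Fr).
  have cE r : eta0 * (d - s + 1 * r) = eta0 * (r - s + d) by ring.
  have cn0 : eta0 * (d - s + 1 * t) != 0.
    by rewrite cE; have := c0 t (ltW st); rewrite invr_gt0 => /gt_eqF ->.
  have Dc := @derive_inv _ (fun r => eta0 * (d - s + 1 * r)) _ _ cn0 (derive_scale eta0 (derive_affine t (d - s) 1)).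
  have Dt := derive_add (derive_add (derive_add
    (derive_scale 2 (derive_ln U0 Du)) (derive_scale (-1) (derive_ln V0 Dv)))
    (derive_scale (- inner z z) Dc))
    (derive_affine t (- e * (inner x x + inner y y) - e + e * Mc * s) (- (e * Mc))).
  apply: derive_eq Dt _ _ => [r|].
    by rewrite /F0 /= /c /z -cE; ring.
  by rewrite /c /z -cE -exprVn; ring.
have trM : \tr (Q t *m M) = \sum_(k <- sq) inner (k *m M) k by rewrite {1}QE trace_decomp.
have trN : \tr (Q t *m N) = \sum_(k <- sq) inner (k *m N) k by rewrite {1}QE trace_decomp.
have second : 2 * (\tr (Q t *m M) / u t x) - \tr (Q t *m N) / v t y <=
    - (c t ^+ 2 * inner (z *m Q t) z)
    + 28 * e ^+ 2 * (inner (x *m Q t) x + inner (y *m Q t) y) + 4 * e * \tr (Q t).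
  rewrite trM trN (trace_Q QE) QE !form_decomp !mulr_suml !mulr_sumr -sumrB.
  rewrite -big_split /= mulr_sumr -sumrN -!big_split /=; apply: ler_sum => k _.
  apply: le_trans (hess k) _; rewrite gradx grady.
  set w := c t * inner z k; set al := inner x k; set be := inner y k.
  rewrite -[c t ^+ 2 * _ ^+ 2]exprMn -/w.
  have := sqr_ge0 (w - 2 * e * (al + 2 * be)); have := sqr_ge0 (e * (al - 2 * be)).
  have := sqr_ge0 (e * al); have := sqr_ge0 (e * be).
  by nra.
have first_order : 2 * (inner (b t x) p / u t x) - inner (b t y) q / v t y <=
    2 * e * (inner (b t x) x + inner (b t y) y).
  rewrite (innerC _ p) (innerC _ q) gradx grady.
  have := dop_monotone HA x y t0t.
  rewrite innerDl innerNl ![inner (b t _) (x - y)]innerC -/z => mono.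
  have : c t * (inner z (b t x) - inner z (b t y)) <= 0.
    by rewrite pmulr_rle0// c0 ?(ltW st).
  by rewrite (innerC (b t x)) (innerC (b t y)); lra.
have low := dop_low HA z t0t.
have upx := dop_up HA x t0t; have upy := dop_up HA y t0t.
have exy : e * (inner x x + inner y y) <= Bd.
  have := HBd t x y (ltW st).
  have : 0 <= c t * inner z z by rewrite mulr_ge0 ?inner_ge0// ltW// c0 ?(ltW st).
  have : 0 <= e * (Mc * (t - s)).
    by rewrite mulr_ge0 ?(ltW e0)// mulr_ge0 ?(ltW Mc0)// subr_ge0 ltW.
  by move: Fpos; rewrite /F0 /= -/z; lra.
have st' : s <= t <= t1 by rewrite (ltW st) tt1.
have HCx := HC t x st'; have HCy := HC t y st'.
have s1 : eta0 * c t ^+ 2 * inner z z <= c t ^+ 2 * inner (z *m Q t) z.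
  by rewrite [eta0 * _]mulrC -mulrA ler_wpM2l// sqr_ge0.
have s2 : 28 * e ^+ 2 * (inner (x *m Q t) x + inner (y *m Q t) y) <= e * (28 * Lam * Bd).
  have : 28 * e ^+ 2 * (inner (x *m Q t) x + inner (y *m Q t) y) <=
      28 * e ^+ 2 * (Lam * (inner x x + inner y y)).
    by rewrite ler_wpM2l ?mulr_ge0 ?sqr_ge0//; lra.
  have : (28 * e * Lam) * (e * (inner x x + inner y y)) <= 28 * e * Lam * Bd.
    by rewrite ler_wpM2l// !mulr_ge0// ltW.
  lra.
have s3 : e * (2 * \tr (Q t) + 2 * inner (b t x) x +
    (2 * \tr (Q t) + 2 * inner (b t y) y)) <= e * (2 * `|C|).
  by rewrite ler_wpM2l ?(ltW e0)//; have := ler_norm C; lra.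
have : e * Mc = e * (28 * Lam * Bd) + e * (2 * `|C|) + e by rewrite /Mc; ring.
move: time; rewrite !mulrDl !mulrDr; lra.
Qed.

End harnack.

(** * Coming in from infinity *)

Ltac nonneg := repeat first [ assumption | (apply: ltW; assumption) | exact: ler01 | exact: ler0n
  | exact: sqr_ge0 | exact: inner_ge0 | exact: normr_ge0 | exact: powR_ge0 | exact: expR_ge0
  | apply: addr_ge0 | apply: mulr_ge0 | apply: divr_ge0 | apply: exprn_ge0
  | rewrite invr_ge0 ].

(** A form of Young's inequality: the power [kappa > 2] absorbs the
    square, except where [y] is bounded by a power of the ratio of the constants.
    The exponent is a natural number so that it can be used in a polynomial. *)
Lemma square_absorbed (R : realType) (kappa D G y : R) (p : nat) :
  2 < kappa -> 2 / (kappa - 2) <= p%:R -> 0 <= D -> 0 < G -> 0 <= y ->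
  D * y ^+ 2 <= G * y `^ kappa \/ y ^+ 2 <= (1 + D / G) ^+ p.
Proof.
move=> k2 kp D0 G0 y0.
have X1 : 1 <= 1 + D / G by rewrite lerDl divr_ge0// ltW.
have [|DG] := leP (D * y ^+ 2) (G * y `^ kappa); [by left|right].
have [y1|y1] := leP y 1.
  by apply: le_trans (exprn_ege1 p X1); rewrite expr_le1.
have yk : y `^ (kappa - 2) <= 1 + D / G.
  apply: (@le_trans _ _ (D / G)); last by rewrite lerDr.
  rewrite ler_pdivlMr// mulrC -(@ler_pM2r _ (y ^+ 2)) ?exprn_gt0//; last by lra.
  rewrite -mulrA -powR_mulrn// -powRD; last by rewrite gt_eqF ?orbT//; lra.
  by rewrite subrK powR_mulrn// ltW.
have kp0 : 0 < kappa - 2 by lra.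
have -> : y ^+ 2 = (y `^ (kappa - 2)) `^ (2 / (kappa - 2)).
  by rewrite -powRrM mulrC divfK ?gt_eqF// powR_mulrn.
apply: (@le_trans _ _ ((1 + D / G) `^ (2 / (kappa - 2)))).
  rewrite ge0_ler_powR ?nnegrE ?powR_ge0//; last by lra.
  by rewrite divr_ge0// ltW.
rewrite -powR_mulrn; last by lra.
exact: ler_powR.
Qed.

Section smoothing.
Context {R : realType} {n : nat}.
Variables (t0 : R) (Q : R -> 'M[R]_n) (b : R -> 'rV[R]_n -> 'rV[R]_n).
Variables (eta0 Lam : R) (K3 rho kappa : R).
Hypothesis HA : dissipative_operator t0 Q b eta0 Lam.
Hypothesis K3_gt0 : 0 < K3.
Hypothesis kappa_gt2 : 2 < kappa.
Hypothesis b_superlinear : forall t x, t0 < t -> rho ^+ 2 <= inner x x ->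
  inner (b t x) x <= - K3 * enorm x `^ kappa.

(** A solution with a Gaussian bound becomes bounded at once, because the
    superlinear drift comes in from infinity in finite time: in the
    supersolution [exp (m(t) + a(t) |x|^2)] the coefficient [a] vanishes at the
    final time. The comparison is made outside the ball of radius [rho] only,
    where alone the drift is controlled uniformly in time; inside, the assumed
    Gaussian bound is already better. *)
Lemma smoothing (c : R) : 0 < c -> exists C N, 0 <= C /\
  forall r T u A, t0 < r -> r < T -> bounded_solution Q b r u ->
    (forall t x, r <= t <= T -> u t x <= expR (A + c / (T - r) * inner x x)) ->
    forall x, u T x <= expR (A + C * (1 + (T - r)^-1) ^+ N).
Proof.
move=> c0; have Lam_gt0 := dop_Lam_gt0 HA.
have K30 := K3_gt0; have kappa2 := kappa_gt2.
have [p kp] : exists p : nat, 2 / (kappa - 2) <= p%:R.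
  exists (Num.bound (2 / (kappa - 2))); apply/ltW/archi_boundP.
  by apply: divr_ge0 => //; lra.
(* One factor of [((T - t) / tau) ^+ q] is lost by differentiation in time, and [p]
   are spent on [square_absorbed]. *)
pose q := p.+2.
pose E := 4 * Lam * c + q%:R.
have E0 : 0 <= E by rewrite /E; nonneg.
have K20 : 0 < 2 * K3 by lra.
pose dL := n%:R * Lam.
have dL0 : 0 <= dL by rewrite mulr_ge0// ltW.
exists (c * rho ^+ 2 + 2 * c * dL + c * E * (1 + E / (2 * K3)) ^+ p), p.+1.
have EK0 : 0 <= E / (2 * K3) by rewrite divr_ge0// ltW.
split; first by nonneg.
move=> r T u A tr rT ur uA x0.
pose tau := T - r.
have tau0 : 0 < tau by rewrite subr_gt0.
pose Y := 1 + E / (2 * K3) / tau.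
have Y1 : 1 <= Y by rewrite lerDl divr_ge0// ltW.
pose m0 := c / tau * (2 * dL + E / tau * Y ^+ p).
have Y0 : 0 <= Y by lra.
have m00 : 0 <= m0 by rewrite /m0; nonneg.
pose a (t : R) := c / tau * ((T - t) / tau) ^+ q.
pose Z (t : R) (x : 'rV[R]_n) := A + c / tau * rho ^+ 2 + m0 * (t - r) + a t * inner x x.
have ZT : Z T x0 = A + c / tau * rho ^+ 2 + m0 * tau.
  by rewrite /Z /a subrr mul0r expr0n /= mulr0 mul0r addr0.
have th01 t : r <= t <= T -> 0 <= (T - t) / tau <= 1.
  move=> /andP[rt tT]; apply/andP; split; first by rewrite divr_ge0 ?subr_ge0// ltW.
  by rewrite ler_pdivrMr// mul1r lerD2l lerN2.
have a_ge0 : forall y, r <= y <= T -> 0 <= a y.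
  move=> y /th01 /andP[th0 _]; rewrite mulr_ge0 ?exprn_ge0//.
  by rewrite divr_ge0// ltW.
have Zlow t x : r <= t <= T -> A + c / tau * rho ^+ 2 <= Z t x.
  move=> rt; rewrite /Z -addrA lerDl addr_ge0//.
    by rewrite mulr_ge0// subr_ge0; case/andP: rt.
  by rewrite mulr_ge0 ?a_ge0 ?inner_ge0.
apply: (@le_trans _ _ (expR (Z T x0))); last first.
  rewrite ler_expR ZT -addrA lerD2l.
  set W := 1 + (T - r)^-1.
  have iW : tau^-1 <= W by rewrite lerDr.
  have W1 : 1 <= W by rewrite lerDl invr_ge0 ltW.
  have Wp : 1 <= W ^+ p.+1 by rewrite exprn_ege1.
  have iWp : tau^-1 <= W ^+ p.+1.
    by apply: le_trans iW _; rewrite exprS ler_peMr ?exprn_ege1//; lra.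
  have YW : Y <= (1 + E / (2 * K3)) * W.
    have : 0 <= tau^-1 by rewrite invr_ge0 ltW.
    by rewrite /Y /W -/tau; nra.
  have YWp : Y ^+ p <= (1 + E / (2 * K3)) ^+ p * W ^+ p.
    by rewrite -exprMn lerXn2r// nnegrE; nra.
  have -> : m0 * tau = 2 * c * dL + c * E * (Y ^+ p * tau^-1).
    by rewrite /m0; field; rewrite gt_eqF.
  rewrite [X in _ <= X]mulrDl [(_ + 2 * c * dL) * _]mulrDl -[X in _ <= X]addrA; apply: lerD; last apply: lerD.
  - have -> : c / tau * rho ^+ 2 = c * rho ^+ 2 * tau^-1 by ring.
    by apply: ler_wpM2l => //; nonneg.
  - by rewrite ler_peMr//; nonneg.
  - rewrite -[X in _ <= X]mulrA; apply: ler_wpM2l; first by nonneg.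
    by rewrite exprSr mulrA; apply: ler_pM => //; nonneg.
apply: (@comparison _ _ t0 Q b eta0 Lam HA r T u (fun t x => expR (Z t x))) => //.
- apply: continuous_compose; last exact: continuous_expR.
  rewrite /Z; apply: continuous_add.
    apply: continuous_add; first exact: continuous_const.
    apply: continuous_mul; first exact: continuous_const.
    by apply: continuous_sub; [move=> z; exact: cvg_fst|exact: continuous_const].
  apply: continuous_mul; last by apply: continuous_inner => z; exact: cvg_snd.
  rewrite /a; apply: continuous_mul; first exact: continuous_const.
  apply: (@continuous_compose _ _ _ (fun z : R * 'rV[R]_n => (T - z.1) / tau)
    (fun y => y ^+ q)); last exact: exprn_continuous.
  apply: continuous_mul; last exact: continuous_const.
  by apply: continuous_sub; [exact: continuous_const|move=> z; exact: cvg_fst].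
- by exists 0 => t x _; exact: expR_ge0.
- move=> t x rtT uZ.
  have rtT' : r <= t <= T by case/andP: rtT => /ltW -> ->.
  have tt : t0 < t by case/andP: rtT => rt _; exact: lt_trans rt.
  have far : rho ^+ 2 <= inner x x.
    rewrite leNgt; apply/negP => near_x.
    move: uZ; rewrite ltNge => /negP; apply.
    apply: le_trans (uA t x rtT') _; rewrite ler_expR.
    apply: le_trans (Zlow t x rtT'); rewrite lerD2l ler_wpM2l ?(ltW near_x)//.
    by rewrite divr_ge0// ltW.
  pose P := expR (Z t x).
  pose a' := c / tau * (q%:R * ((T - t) / tau) ^+ q.-1 * (- tau^-1)).
  exists (P * (m0 + a' * inner x x)), (fun e => P * (a t * (2 * inner x e))),
    (fun e => P * (a t * (2 * inner e e) + (a t * (2 * inner x e)) ^+ 2)).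
  split.
  + move=> e.
    have J := jet2_add (jet2_const (A + c / tau * rho ^+ 2 + m0 * (t - r)))
      (jet2_scale (a t) (jet2_inner x e)).
    apply: jet2_eq (jet2_expR J) _ _ _; rewrite ?scale0r ?addr0 ?add0r//.
  + have Dth : is_derive t 1 (fun t : R => (T - t) / tau) (- tau^-1).
      apply: derive_eq (derive_affine t (T / tau) (- tau^-1)) _ _ => // y.
      by ring.
    have Da : is_derive t 1 a a'.
      apply: derive_scale; have := is_deriveX q Dth.
      by move=> /derive_eq; apply => [y|//]; rewrite exprfctE.
    apply: derive_eq (derive_expR (derive_add
       (derive_affine t (A + c / tau * rho ^+ 2 - m0 * r) m0)
       (derive_scale (inner x x) Da))) _ _ => [y|].
      by congr expR; rewrite /Z; ring.
    by rewrite /P /Z; congr (expR _ * _); ring.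
  move=> sq QE.
  rewrite -mulr_sumr -mulrDr ler_pM2l ?expR_gt0// big_split /= -mulr_sumr -mulr_sumr.
  rewrite -(trace_Q QE).
  have -> : \sum_(v <- sq) (a t * (2 * inner x v)) ^+ 2 =
      4 * a t ^+ 2 * inner (x *m Q t) x.
    by rewrite QE form_decomp mulr_sumr; apply: eq_bigr => v _; ring.
  have trQ : \tr (Q t) <= dL.
    rewrite /mxtrace; apply: (@le_trans _ _ (\sum_(i < n) Lam)); last first.
      by rewrite sumr_const card_ord -mulr_natl.
    apply: ler_sum => i _.
    have := dop_up HA (delta_mx 0 i) tt.
    by rewrite !inner_delta -rowE !mxE !eqxx mulr1.
  have Qx := dop_up HA x tt.
  have bx := b_superlinear tt far.
  pose y := enorm x.
  have y2 : inner x x = y ^+ 2 by rewrite enorm_sqr.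
  rewrite (innerC x) y2; rewrite y2 in Qx; rewrite -/y in bx.
  set th := (T - t) / tau in a' *.
  have /andP[th0 th1] : 0 <= th <= 1 by exact: th01.
  have aE : a t = c / tau * th ^+ p.+1 * th by rewrite /a /q [_ ^+ p.+2]exprSr mulrA.
  have ct0 : 0 <= c / tau by rewrite divr_ge0// ltW.
  pose k := c / tau * th ^+ p.+1.
  have k0 : 0 <= k by rewrite mulr_ge0// exprn_ge0.
  have at0 : 0 <= a t by exact: a_ge0.
  have ak : a t = k * th by rewrite aE.
  have akc : a t <= c / tau.
    by rewrite /a ler_piMr// exprn_ile1.
  have kc : k <= c / tau by rewrite /k ler_piMr// exprn_ile1.
  have step1 : a t * (2 * \tr (Q t)) <= c / tau * (2 * dL).
    apply: (@le_trans _ _ (a t * (2 * dL))); first by rewrite ler_wpM2l//; lra.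
    by rewrite ler_wpM2r// mulr_ge0.
  have step2 : 4 * a t ^+ 2 * inner (x *m Q t) x <= k * (4 * Lam * c / tau * y ^+ 2).
    apply: (@le_trans _ _ (4 * a t ^+ 2 * (Lam * y ^+ 2))).
      by rewrite ler_wpM2l// mulr_ge0// sqr_ge0.
    have -> : 4 * a t ^+ 2 * (Lam * y ^+ 2) = (4 * Lam * y ^+ 2) * (a t * a t) by ring.
    have -> : k * (4 * Lam * c / tau * y ^+ 2) = (4 * Lam * y ^+ 2) * (k * (c / tau)) by ring.
    apply: ler_wpM2l; first by nonneg.
    by apply: ler_pM => //; rewrite ak ler_piMr.
  have step3 : a' * y ^+ 2 = - (k * (q%:R / tau * y ^+ 2)).
    by rewrite /a' /k /=; ring.
  have step4 : a t * (2 * inner (b t x) x) <= - (k * (2 * K3 * th * y `^ kappa)).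
    rewrite ak; have : k * th * (2 * inner (b t x) x) <= k * th * (2 * (- K3 * y `^ kappa)).
      by apply: ler_wpM2l; [exact: mulr_ge0|rewrite ler_pM2l].
    lra.
  suff step5 : k * (E / tau * y ^+ 2) - k * (2 * K3 * th * y `^ kappa) <=
      c / tau * (E / tau * Y ^+ p).
    have -> : m0 = c / tau * (2 * dL) + c / tau * (E / tau * Y ^+ p) by rewrite /m0 mulrDr.
    rewrite step3; have -> : k * (q%:R / tau * y ^+ 2) =
      k * (E / tau * y ^+ 2) - k * (4 * Lam * c / tau * y ^+ 2) by rewrite /E; ring.
    lra.
  have rhs0 : 0 <= c / tau * (E / tau * Y ^+ p).
    by nonneg.
  move: th0; rewrite le_eqVlt => /orP[/eqP th0|th0].
    by rewrite /k -th0 expr0n /= mulr0 !mul0r subrr.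
  have Kth0 : 0 < 2 * K3 * th by rewrite mulr_gt0.
  have Et0 : 0 <= E / tau by rewrite divr_ge0// ltW.
  have [absorbed|small] := square_absorbed kappa_gt2 kp Et0 Kth0 (enorm_ge0 x).
    by apply: le_trans rhs0; rewrite -mulrBr mulr_ge0_le0// subr_le0.
  have yY : th ^+ p * y ^+ 2 <= Y ^+ p.
    apply: (@le_trans _ _ (th ^+ p * (1 + E / tau / (2 * K3 * th)) ^+ p)).
      by rewrite ler_wpM2l// exprn_ge0// ltW.
    rewrite -exprMn lerXn2r ?nnegrE//.
      by nonneg.
    have -> : th * (1 + E / tau / (2 * K3 * th)) = th + E / (2 * K3) / tau.
      by field; rewrite !gt_eqF.
    by rewrite /Y lerD2r.
  have : 0 <= k * (2 * K3 * th * y `^ kappa).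
    by rewrite mulr_ge0// mulr_ge0 ?powR_ge0// ltW.
  have : k * (E / tau * y ^+ 2) <= c / tau * (E / tau * Y ^+ p).
    have -> : k * (E / tau * y ^+ 2) = c / tau * (E / tau * (th * (th ^+ p * y ^+ 2))).
      by rewrite /k exprSr; ring.
    rewrite ler_wpM2l// ler_wpM2l//; apply: le_trans yY.
    by rewrite ler_piMl// mulr_ge0 ?sqr_ge0 ?exprn_ge0// ltW.
  lra.
- move=> x; apply: le_trans (uA r x _) _; first by rewrite lexx ltW.
  rewrite ler_expR /Z /a subrr mulr0 addr0 divff ?gt_eqF// expr1n mulr1 lerD2r lerDl.
  by rewrite mulr_ge0 ?sqr_ge0// divr_ge0// ltW.
- by rewrite lexx ltW.
Qed.

End smoothing.

(** * From the mean modulus to a uniform bound *)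

Section borel_integrals.
Context {R : realType} {n : nat}.
Local Notation V := 'rV[R]_n.
Implicit Types (f g : V -> R) (mu : probability V R).

Lemma open_measurable_rV (A : set V) : open A -> measurable A.
Proof. exact: sub_sigma_algebra. Qed.

Lemma continuous_measurable_rV f : continuous f -> measurable_fun setT f.
Proof.
move=> cf; apply: (measurability _ (measurable_realfun.RGenOInfty.measurableE R)) => _ [_ [x ->] <-].
rewrite setTI; apply: open_measurable_rV; apply: open_comp => [y _|]; first exact: cf.
by rewrite set_itvE; exact: open_gt.
Qed.

Lemma Cb_integrable mu f : Cb f -> mu.-integrable setT (EFin \o f).
Proof.
move=> [cf [M HM]]; apply: measurable_bounded_integrable => //.
- by apply: le_lt_trans (probability_le1 mu measurableT) _; rewrite ltry.
- exact: continuous_measurable_rV.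
- by exists M; split; [exact: num_real|move=> y My x _; apply: le_trans (HM x) (ltW My)].
Qed.

Lemma eball_open (r : R) : open (@eball R n r).
Proof.
apply: (@open_comp _ _ (@enorm R n) [set t | t < r]); last exact: open_lt.
by move=> x _; exact: continuous_enorm.
Qed.

(** Tightness is used in this form, for a ball that carries half of the mass of
    every measure of the system. *)
Lemma half_mass_le mu (B : set V) f (m : R) : measurable B -> Cb f -> 0 <= m ->
  (forall x, 0 <= f x) -> (forall x, B x -> m <= f x) ->
  ((1 - 2^-1)%:E <= mu B)%E -> m / 2 <= \int[mu]_x f x.
Proof.
move=> mB cf m0 f0 mf half.
have fi := Cb_integrable mu cf; have mf' := measurable_int _ fi.
rewrite -lee_fin /Rintegral fineK; last exact: integrable_fin_num.
apply: (@le_trans _ _ (\int[mu]_(x in B) (f x)%:E)%E); last first.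
  by apply: ge0_subset_integral => // x _; rewrite lee_fin.
apply: (@le_trans _ _ (\int[mu]_(x in B) m%:E)%E); last first.
  apply: ge0_le_integral => //.
  by apply: (measurable_funS measurableT) => //; exact: mf'.
rewrite integral_cst// EFinM lee_wpmul2l ?lee_fin//.
by apply: le_trans half; rewrite lee_fin; lra.
Qed.

End borel_integrals.

Lemma Cb_sqr {R : realType} {n : nat} (f : 'rV[R]_n -> R) : Cb f -> Cb (fun x => f x ^+ 2).
Proof.
move=> [cf [M HM]]; split.
  exact: (continuous_mul cf cf).
exists (M ^+ 2) => x; rewrite normrX lerXn2r ?nnegrE//.
exact: le_trans (HM x).
Qed.

Lemma Cb_slice {R : realType} {n : nat} Q b s (u : R -> 'rV[R]_n -> R) t :
  bounded_solution Q b s u -> s <= t -> Cb (u t).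
Proof.
move=> su st; split; first exact: bounded_solution_continuous_slice su st.
by have [_ [B HB] _] := su; exists B => x; exact: HB.
Qed.

(** Shrinking the time by a factor close to one costs little; this is what lets
    the self-improving estimate below close. *)
Lemma time_loss (R : realType) (N : nat) : exists q D : R,
  [/\ 0 < q, q < 1, 0 <= D,
      forall tau, 0 < tau -> (1 + (q * tau)^-1) ^+ N <= 4 / 3 * (1 + tau^-1) ^+ N
    & forall tau, 0 < tau -> (1 + ((1 - q) * tau)^-1) ^+ N <= D * (1 + tau^-1) ^+ N].
Proof.
have bernoulli (x : R) k : 0 <= x <= 1 -> 1 - k%:R * x <= (1 - x) ^+ k.
  move=> /andP[x0 x1]; elim: k => [|k IH]; first by rewrite mul0r subr0 expr0.
  have k0 : 0 <= k%:R :> R by exact: ler0n.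
  have : (1 - k%:R * x) * (1 - x) <= (1 - x) ^+ k * (1 - x) by rewrite ler_wpM2r// subr_ge0.
  rewrite -exprSr -natr1 => h; apply: le_trans h.
  by have := mulr_ge0 k0 (mulr_ge0 x0 x0); lra.
have shrink (p tau : R) : 0 < p <= 1 -> 0 < tau ->
    (1 + (p * tau)^-1) ^+ N <= (p ^+ N)^-1 * (1 + tau^-1) ^+ N.
  move=> /andP[p0 p1] tau0; rewrite -exprVn -exprMn; apply: lerXn2r.
  - by rewrite nnegrE; nonneg.
  - by rewrite nnegrE; nonneg.
  - by rewrite mulrDr mulr1 invfM lerD2r invf_ge1.
pose x : R := (4 * N.+1%:R)^-1.
have N0 : 0 < N.+1%:R :> R by rewrite ltr0n.
have x0 : 0 < x by rewrite invr_gt0 mulr_gt0.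
have N1 : 1 <= N.+1%:R :> R by rewrite ler1n.
have x1 : x < 1 by rewrite invf_lt1 ?mulr_gt0//; lra.
have Nx : N%:R * x <= 4^-1.
  rewrite /x invfM mulrCA ler_piMr ?invr_ge0//.
  by rewrite ler_pdivrMr// mul1r ler_nat.
have xb := bernoulli x N; rewrite (ltW x0) (ltW x1) in xb.
have {}xb : 3 / 4 <= (1 - x) ^+ N by have := xb isT; lra.
exists (1 - x), ((x ^+ N)^-1); split; [lra|lra| | |].
- by rewrite invr_ge0 exprn_ge0// ltW.
- move=> tau tau0.
  have hp : 0 < 1 - x <= 1 by apply/andP; split; lra.
  apply: le_trans (shrink _ _ hp tau0) _.
  apply: ler_wpM2r; first by nonneg.
  by rewrite -[4 / 3]invf_div lef_pV2 ?posrE// exprn_gt0//; lra.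
- move=> tau tau0; rewrite subKr.
  by apply: shrink => //; rewrite x0 ltW.
Qed.

Section ultracontractivity_on_Cb.
Context {R : realType} {n : nat}.
Variables (t0 : R) (Q : R -> 'M[R]_n) (b : R -> 'rV[R]_n -> 'rV[R]_n).
Variables (eta0 Lam K3 rho kappa : R).
Hypothesis HA : dissipative_operator t0 Q b eta0 Lam.
Hypothesis K3_gt0 : 0 < K3.
Hypothesis kappa_gt2 : 2 < kappa.
Hypothesis b_superlinear : forall t x, t0 < t -> rho ^+ 2 <= inner x x ->
  inner (b t x) x <= - K3 * enorm x `^ kappa.
Variables (G : R -> R -> ('rV[R]_n -> R) -> 'rV[R]_n -> R) (mu : R -> probability 'rV[R]_n R).
Hypothesis G_solves : forall s f, t0 < s -> Cb f ->
  bounded_solution Q b s (fun t => G t s f) /\ G s s f = f.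
Hypothesis mu_invariant : forall s t f, t0 < s -> s < t -> Cb f ->
  \int[mu t]_x G t s f x = \int[mu s]_x f x.
Variable R1 : R.
Hypothesis mu_tight : forall t, t0 < t -> ((1 - 2^-1)%:E <= mu t (eball R1))%E.

Lemma mean_ge (s c : R) f : Cb f -> (forall x, c <= f x) -> c <= \int[mu s]_x f x.
Proof.
move=> cf fc; have cc : Cb (fun _ : 'rV[R]_n => c).
  by split; [exact: continuous_const|exists `|c|].
apply: le_trans (le_Rintegral measurableT (Cb_integrable (mu s) cc)
  (Cb_integrable (mu s) cf) (fun x _ => fc x)).
by rewrite Rintegral_cst// [fine _](congr1 fine (probability_setT (mu s))) mulr1.
Qed.

(** From [L^2] to [L^infty]: integrating the Harnack inequality over a ball that
    carries half of the mass of every measure of the system gives a Gaussian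
    bound, on the first half of the time; the drift improves it to a uniform
    bound on the second half. *)
Lemma two_to_infty : exists C N, 0 <= C /\
  forall s T u cu, t0 < s -> s < T -> bounded_solution Q b s u ->
    0 < cu -> (forall t x, s <= t -> cu <= u t x) ->
    forall x, 2 * ln (u T x) <=
      C * (1 + (T - s)^-1) ^+ N.+1 + ln (\int[mu s]_y (u s y ^+ 2)).
Proof.
have eta_gt0 := dop_eta_gt0 HA.
pose c := 2 / eta0 / 2.
have c0 : 0 < c by rewrite !divr_gt0.
have [C [N [C0 HC]]] := smoothing HA K3_gt0 kappa_gt2 b_superlinear c0.
exists (ln 2 + 4 * R1 ^+ 2 / eta0 + 2 * C * 2 ^+ N), N.
have ln2 : 0 <= ln 2 :> R by apply: ln_ge0; rewrite ler1n.
split; first by nonneg.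
move=> s T u cu ts sT us cu0 ucu x0.
pose tau := T - s; have tau0 : 0 < tau by rewrite subr_gt0.
pose r := s + tau / 2.
have sr : s < r by rewrite ltrDl divr_gt0.
have Tr : T - r = tau / 2 by rewrite /r /tau; field.
have rT : r < T by rewrite -subr_gt0 Tr divr_gt0.
have cus := Cb_sqr (Cb_slice us (lexx s)).
have [vs vE] := G_solves ts cus.
pose I := \int[mu s]_y (u s y ^+ 2).
have I0 : 0 < I.
  apply: (@lt_le_trans _ _ (cu ^+ 2)); first by rewrite exprn_gt0.
  apply: mean_ge => // y.
  by rewrite lerXn2r ?nnegrE ?(ltW cu0)// ?(le_trans (ltW cu0))// ucu.
have u0 t x : s <= t -> 0 < u t x by move=> st; exact: lt_le_trans cu0 (ucu _ _ st).
pose v t := G t s (fun x => u s x ^+ 2).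
have v0 t x : s <= t -> 0 < v t x.
  move=> st; apply: (@lt_le_trans _ _ (cu ^+ 2)); first by rewrite exprn_gt0.
  apply: (bounded_solution_ge HA ts vs) => // y.
  by rewrite vE lerXn2r ?nnegrE ?(ltW cu0)// ?(le_trans (ltW cu0))// ucu.
have gauss t x : r <= t <= T ->
    u t x <= expR (2^-1 * ln (2 * I) + 2 * R1 ^+ 2 / (eta0 * tau) + c / (T - r) * inner x x).
  move=> /andP[rt tT].
  have st : s < t by exact: lt_le_trans rt.
  pose e := 4 * (inner x x + R1 ^+ 2) / (eta0 * tau).
  have half : u t x ^+ 2 * expR (- e) / 2 <= \int[mu t]_y v t y.
    apply: (half_mass_le (B := @eball R n R1)).
    - by apply: open_measurable_rV; exact: eball_open.
    - exact: Cb_slice vs (ltW st).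
    - by nonneg.
    - by move=> y; exact/ltW/v0/ltW.
    - move=> y yR1.
      have har := harnack HA ts us vs cu0 ucu (fun x => congr1 (@^~ x) vE) x y st.
      have y2 : inner y y <= R1 ^+ 2.
        rewrite -enorm_sqr lerXn2r ?nnegrE ?enorm_ge0 ?(ltW yR1)//.
        exact: le_trans (enorm_ge0 y) (ltW yR1).
      have le_e : inner (x - y) (x - y) / (eta0 * (t - s)) <= e.
        have ts2 : tau / 2 <= t - s by move: rt; rewrite /r; lra.
        apply: (@le_trans _ _ (2 * (inner x x + R1 ^+ 2) / (eta0 * (tau / 2)))).
          apply: ler_pM => //; first exact: inner_ge0.
          - by rewrite invr_ge0 mulr_ge0 ?(ltW eta_gt0)// subr_ge0 ltW.
          - by have := inner_sub_le x y; lra.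
          - rewrite lef_pV2 ?posrE ?mulr_gt0 ?divr_gt0 ?subr_gt0//.
            by rewrite ler_pM2l.
        by rewrite le_eqVlt; apply/orP; left; apply/eqP; rewrite /e; field;
          rewrite !gt_eqF.
      rewrite -[v t y]lnK ?posrE ?v0 ?(ltW st)//.
      rewrite -[u t x]lnK ?posrE ?u0 ?(ltW st)// -expRM_natl -expRD ler_expR.
      by move: har; rewrite -/(v t); lra.
    - exact: mu_tight (lt_trans ts st).
  rewrite mu_invariant// -/I in half.
  rewrite -[u t x]lnK ?posrE ?u0 ?(ltW st)// ler_expR.
  have : u t x ^+ 2 * expR (- e) <= 2 * I by move: half; lra.
  rewrite -ler_ln ?posrE ?mulr_gt0 ?exprn_gt0 ?expR_gt0 ?u0 ?(ltW st)//.
  rewrite lnM ?posrE ?exprn_gt0 ?expR_gt0 ?u0 ?(ltW st)// expRK lnXn ?u0 ?(ltW st)//.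
  rewrite mulr2n Tr /c.
  have -> : e = 2 * (2 * R1 ^+ 2 / (eta0 * tau) + 2 / eta0 / 2 / (tau / 2) * inner x x).
    by rewrite /e; field; rewrite !gt_eqF.
  lra.
have := HC r T u _ (lt_trans ts sr) rT (bounded_solution_later (ltW sr) us) gauss x0.
rewrite -[u T x0]lnK ?posrE ?u0 ?(ltW sT)// ler_expR Tr => bound.
rewrite expRK -/I.
have lnI : ln (2 * I) = ln 2 + ln I by rewrite lnM ?posrE.
set W := 1 + tau^-1.
have it0 : 0 <= tau^-1 by rewrite invr_ge0 ltW.
have W1 : 1 <= W by rewrite lerDl.
have W0 : 0 <= W by lra.
have WN : W <= W ^+ N.+1 by rewrite exprS ler_peMr ?exprn_ege1//; lra.
have e1 : 4 * R1 ^+ 2 / (eta0 * tau) <= 4 * R1 ^+ 2 / eta0 * W ^+ N.+1.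
  have -> : 4 * R1 ^+ 2 / (eta0 * tau) = 4 * R1 ^+ 2 / eta0 * tau^-1.
    by field; rewrite !gt_eqF.
  apply: ler_wpM2l; first by nonneg.
  by apply: le_trans WN; rewrite /W; lra.
have e2 : 2 * (C * (1 + (tau / 2)^-1) ^+ N) <= 2 * C * 2 ^+ N * W ^+ N.+1.
  have : (1 + (tau / 2)^-1) ^+ N <= 2 ^+ N * W ^+ N.
    rewrite -exprMn; apply: lerXn2r; rewrite ?nnegrE ?invf_div.
    - by nonneg.
    - by nonneg.
    - by rewrite /W; lra.
  have : W ^+ N <= W ^+ N.+1 by rewrite exprS ler_peMl ?exprn_ge0//; lra.
  move=> h1 h2.
  rewrite mulrA -[X in _ <= X]mulrA; apply: ler_wpM2l; first by nonneg.
  by apply: le_trans h2 _; apply: ler_wpM2l => //; nonneg.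
have e3 : ln 2 <= ln 2 * W ^+ N.+1 :> R by rewrite ler_peMr// exprn_ege1.
have e4 : 2 * (2 * R1 ^+ 2 / (eta0 * tau)) = 4 * R1 ^+ 2 / (eta0 * tau) by ring.
rewrite lnI in bound; rewrite -/tau -/W.
move: bound e1 e2 e3 e4.
set X := W ^+ N.+1; set Y := (1 + (tau / 2)^-1) ^+ N.
set z1 := 2 * R1 ^+ 2 / (eta0 * tau); set z2 := 4 * R1 ^+ 2 / (eta0 * tau).
set z3 := 4 * R1 ^+ 2 / eta0; set z4 := 2 * C * 2 ^+ N.
set z5 := C * Y; set l2 := ln 2; set lI := ln I; set lu := ln _.
move=> bound e1 e2 e3 e4.
have -> : (l2 + z3 + z4) * X = l2 * X + z3 * X + z4 * X by ring.
lra.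
Qed.

(** From [L^1] to [L^infty] for positive data. Since
    [int u^2 dmu_r <= (sup u(r)) (int u dmu_r)] and the last mean does not depend
    on [r], the previous bound controls [sup u(t)] by the square root of
    [sup u(r)] for [s < r < t]. Any a priori bound [B] on the logarithm is thus
    halved, and taking [r - s] close to [t - s] keeps the constant: after [k]
    steps only [B / 2^k] is left of it. *)
Lemma one_to_infty_positive : exists C N, 0 < C /\
  forall s t f cf, t0 < s -> s < t -> Cb f -> 0 < cf -> (forall x, cf <= f x) ->
    forall x, ln (G t s f x) <= C * (1 + (t - s)^-1) ^+ N + ln (\int[mu s]_y f y).
Proof.
have [C [N [C0 HC]]] := two_to_infty.
have [q [D [q0 q1 D0 Hq HD]]] := @time_loss R N.+1.
pose c2 := 3 / 2 * C * D + 1.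
have c20 : 0 < c2 by apply: ltr_wpDl => //; nonneg.
exists c2, N.+1; split => // s t f cf ts st cbf cf0 fcf x0.
have [us uE] := G_solves ts cbf.
pose u r := G r s f; rewrite -/(u t).
have ucf r x : s <= r -> cf <= u r x.
  by apply: (bounded_solution_ge HA ts us) => y; rewrite uE.
have u0 r x : s <= r -> 0 < u r x by move=> sr; exact: lt_le_trans cf0 (ucf _ _ sr).
have [_ [B HB] _] := us.
pose I := \int[mu s]_y f y.
have I0 : 0 < I by apply: lt_le_trans cf0 _; exact: mean_ge.
pose E (tau : R) := (1 + tau^-1) ^+ N.+1.
have E0 tau : 0 < tau -> 0 <= E tau by move=> tau0; rewrite /E; nonneg.
pose B1 := `|ln B - ln I|.
suff main k : forall t x, s < t -> ln (u t x) <= ln I + c2 * E (t - s) + B1 / 2 ^+ k.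
  rewrite addrC; apply/ler_addgt0Pr => e e0.
  have [k Hk] : exists k : nat, B1 / 2 ^+ k <= e.
    have B1e : 0 <= B1 / e by apply: divr_ge0; [exact: normr_ge0|exact: ltW].
    exists (Num.bound (B1 / e)); rewrite ler_pdivrMr ?exprn_gt0// mulrC -ler_pdivrMr//.
    apply: le_trans (ltW (archi_boundP B1e)) _.
    by rewrite -natrX ler_nat; apply/ltnW/ltn_expl.
  by apply: le_trans (main k t x0 st) _; rewrite lerD2l.
elim: k => [|k IH] {t st x0} t x st.
  rewrite expr0 divr1; apply: (@le_trans _ _ (ln B)).
    have uB : u t x <= B by apply: le_trans (ler_norm _) (HB _ _ (ltW st)).
    by rewrite ler_ln ?posrE ?u0 ?(ltW st)//; apply: lt_le_trans uB; exact/u0/ltW.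
  have : 0 <= c2 * E (t - s) by rewrite mulr_ge0 ?(ltW c20)// E0 ?subr_gt0.
  by have := ler_norm (ln B - ln I); rewrite -/B1; lra.
pose tau := t - s; have tau0 : 0 < tau by rewrite subr_gt0.
pose r := s + q * tau.
have sr : s < r by rewrite ltrDl mulr_gt0.
have rtau : r - s = q * tau by rewrite /r; ring.
have trtau : t - r = (1 - q) * tau by rewrite /r /tau; ring.
have rt : r < t by rewrite -subr_gt0 trtau mulr_gt0// subr_gt0.
have t0r : t0 < r by exact: lt_trans sr.
pose L := ln I + c2 * E (q * tau) + B1 / 2 ^+ k.
have uL y : u r y <= expR L.
  rewrite -[u r y]lnK ?posrE ?u0 ?(ltW sr)// ler_expR.
  by have := IH r y sr; rewrite rtau.
have cur := Cb_slice us (ltW sr).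
have sq_mean : \int[mu r]_y (u r y ^+ 2) <= expR L * I.
  have Ir : \int[mu r]_y u r y = I by exact: mu_invariant.
  rewrite -Ir -RintegralZl//; last exact: Cb_integrable.
  apply: le_Rintegral => //; first by apply: Cb_integrable; exact: Cb_sqr.
    exact: (integrableZl measurableT (expR L) (Cb_integrable (mu r) cur)).
  by move=> y _; rewrite expr2 ler_wpM2r// ltW// u0// ltW.
have sq_pos : 0 < \int[mu r]_y (u r y ^+ 2).
  apply: (@lt_le_trans _ _ (cf ^+ 2)); first by rewrite exprn_gt0.
  apply: mean_ge; first exact: Cb_sqr.
  move=> y; have := ucf r y (ltW sr) => h.
  by rewrite lerXn2r ?nnegrE ?(ltW cf0)// (le_trans (ltW cf0)).
have := HC r t u cf t0r rt (bounded_solution_later (ltW sr) us) cf0 _ x.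
move=> /(_ (fun t' x' rt' => ucf t' x' (le_trans (ltW sr) rt'))); rewrite trtau => step.
have lnsq : ln (\int[mu r]_y (u r y ^+ 2)) <= L + ln I.
  rewrite -[L]expRK -lnM ?posrE ?expR_gt0// ler_ln ?posrE//.
  by rewrite mulr_gt0 ?expR_gt0.
have h1 : C * (1 + ((1 - q) * tau)^-1) ^+ N.+1 <= C * D * E tau.
  by rewrite -mulrA ler_wpM2l// HD.
have h2 : c2 * E (q * tau) <= c2 * (4 / 3 * E tau).
  by rewrite ler_wpM2l ?(ltW c20)// Hq.
have h3 : B1 / 2 ^+ k = 2 * (B1 / 2 ^+ k.+1).
  by rewrite exprS invfM; field; rewrite expf_neq0.
have h4 : c2 * E tau = 3 / 2 * (C * D * E tau) + E tau by rewrite /c2; ring.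
have := E0 tau tau0.
by rewrite /L h3 in lnsq; rewrite -/tau; lra.
Qed.

(** Signed data are compared with the positive datum [|f| + e]. *)
Lemma one_to_infty : exists C N, 0 < C /\
  forall s t f, t0 < s -> s < t -> Cb f ->
    forall x, `|G t s f x| <= expR (C * (1 + (t - s)^-1) ^+ N) * \int[mu s]_y `|f y|.
Proof.
have [C [N [C0 HC]]] := one_to_infty_positive.
exists C, N; split => // s t f ts st cbf x.
have cba : Cb (fun y => `|f y|).
  have [cf [M HM]] := cbf; split.
    by apply: (continuous_compose cf); exact: norm_continuous.
  by exists M => y; rewrite normr_id.
set X := expR _.
have X0 : 0 <= X by exact: expR_ge0.
apply: (le_of_small_slope X0) => e e0 _.
pose g y := `|f y| + e.
have cbg : Cb g.
  have [ca [M HM]] := cba; split; first by apply: continuous_add => //; exact: continuous_const.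
  exists (M + e) => y; apply: le_trans (ler_normD _ _) _.
  by rewrite [`|e|]gtr0_norm// lerD2r HM.
have ge y : e <= g y by rewrite /g lerDr.
have [ug ugE] := G_solves ts cbg; have [uf ufE] := G_solves ts cbf.
have gpos : 0 < G t s g x.
  apply: lt_le_trans e0 _; apply: (bounded_solution_ge HA ts ug) => [y|]; last exact: ltW.
  by rewrite ugE.
have Ipos : 0 < \int[mu s]_y g y by apply: lt_le_trans e0 _; exact: mean_ge.
have Ig : \int[mu s]_y g y = \int[mu s]_y `|f y| + e.
  rewrite RintegralD//; last 2 first.
  - exact: Cb_integrable.
  - by apply: (@Cb_integrable _ _ (mu s) (fun=> e)); split; [exact: continuous_const|exists `|e|].
  by rewrite Rintegral_cst// [fine _](congr1 fine (probability_setT (mu s))) mulr1.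
have bound : G t s g x <= X * (\int[mu s]_y `|f y| + e).
  rewrite -Ig -ler_ln ?posrE// ?mulr_gt0 ?expR_gt0// lnM ?posrE ?expR_gt0// expRK.
  exact: (HC _ _ _ _ ts st cbg e0 ge x).
apply: (@le_trans _ _ (G t s g x)); last by rewrite [e * X]mulrC -mulrDr.
have ub : G t s f x + - G t s g x <= 0.
  apply: (bounded_solution_le HA ts (bounded_solution_add uf (bounded_solution_opp ug))).
    by move=> y; rewrite ufE ugE /g; have := ler_norm (f y); lra.
  exact: ltW.
have lb : - G t s f x + - G t s g x <= 0.
  apply: (bounded_solution_le HA ts (bounded_solution_add (bounded_solution_opp uf)
    (bounded_solution_opp ug))).
    by move=> y; rewrite ufE ugE /g; have := ler_norm (- f y); rewrite normrN; lra.
  exact: ltW.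
by rewrite ler_norml; apply/andP; split; lra.
Qed.

End ultracontractivity_on_Cb.

(** * Gaussian lower bounds *)

(** The numerical heart of the Gaussian subsolution: a relative error [y] in the
    quadratic form and a drift term of the same size are absorbed by the
    corrections [k] and [K]. *)
Lemma gaussian_coefficients (R : realType) (d al eta0 C2 C3 B tau y q T1 W2 bw : R) :
  let K := 2 * C3 + eta0^-1 in
  let k := (2 * K * d + 4 * C2 + 2 * B + 1) / (4 * al) in
  0 < al -> 0 < eta0 -> 0 <= d -> 0 <= C2 -> 0 <= C3 -> 0 <= B ->
  0 < tau -> 0 < y -> K * y <= 1 -> 0 <= q ->
  T1 <= d + C2 * y -> q * (1 - C3 * y) <= W2 ->
  2 * bw <= q * y / (eta0 * tau) + B * y ->
  - d / (2 * tau) - k * al * y / tau - K * al * y * q / (4 * tau ^+ 2)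
    + (1 + K * y) * q / (4 * tau ^+ 2) <
  - ((1 + K * y) * T1 / (2 * tau)) + (1 + K * y) ^+ 2 * W2 / (4 * tau ^+ 2)
    - (1 + K * y) * bw / (2 * tau).
Proof.
move=> K k al0 eta0_gt0 d0 C20 C30 B0 tau0 y0 Ky q0 HT HW Hb.
have ie0 : 0 < eta0^-1 by rewrite invr_gt0.
have K0 : 0 <= K by rewrite /K; nonneg.
have Ky0 : 0 <= K * y by rewrite mulr_ge0// ltW.
set be := 1 + K * y.
have be1 : 1 <= be by rewrite /be; lra.
have be2 : be <= 2 by rewrite /be; lra.
have be0 : 0 <= be by lra.
pose X := - (2 * be * tau * T1) + be ^+ 2 * W2 - 2 * be * tau * bw + 2 * d * tau
   + 4 * k * al * y * tau + K * al * y * q - be * q.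
suff X0 : 0 < X.
  have t4 : 0 < 4 * tau ^+ 2 by rewrite mulr_gt0// exprn_gt0.
  rewrite -subr_gt0.
  have -> : - (be * T1 / (2 * tau)) + be ^+ 2 * W2 / (4 * tau ^+ 2) - be * bw / (2 * tau)
    - (- d / (2 * tau) - k * al * y / tau - K * al * y * q / (4 * tau ^+ 2)
    + be * q / (4 * tau ^+ 2)) = X / (4 * tau ^+ 2).
    by rewrite /X; field; rewrite gt_eqF.
  by rewrite divr_gt0.
have hT : 2 * be * tau * T1 <= 2 * be * tau * (d + C2 * y).
  by apply: ler_wpM2l => //; nonneg.
have hW : be ^+ 2 * (q * (1 - C3 * y)) <= be ^+ 2 * W2.
  by apply: ler_wpM2l => //; nonneg.
have hb : be * tau * (2 * bw) <= be * (q * y * eta0^-1) + be * tau * (B * y).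
  have -> : be * (q * y * eta0^-1) + be * tau * (B * y) =
      be * tau * (q * y / (eta0 * tau) + B * y) by field; rewrite !gt_eqF.
  by apply: ler_wpM2l => //; nonneg.
have kal : 4 * k * al = 2 * K * d + 4 * C2 + 2 * B + 1 by rewrite /k; field; rewrite gt_eqF.
pose X1 := tau * y * (4 * k * al - 2 * K * d - 2 * be * C2 - be * B).
pose X2 := q * y * (be * K - be ^+ 2 * C3 - be * eta0^-1 + K * al).
have XE : X1 + X2 <= X.
  have -> : X1 + X2 = - (2 * be * tau * (d + C2 * y)) + be ^+ 2 * (q * (1 - C3 * y))
     - (be * (q * y * eta0^-1) + be * tau * (B * y)) + 2 * d * tau
     + 4 * k * al * y * tau + K * al * y * q - be * q.
    by rewrite /X1 /X2 /be; ring.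
  rewrite /X; lra.
apply: lt_le_trans XE; apply: ltr_wpDr.
  apply: mulr_ge0; first by nonneg.
  have : be * (be * C3) <= be * (2 * C3).
    by apply: ler_wpM2l => //; apply: ler_wpM2r.
  have : 0 <= K * al by nonneg.
  by rewrite expr2 /K; lra.
rewrite mulr_gt0 ?mulr_gt0// kal.
have : be * C2 <= 2 * C2 by apply: ler_wpM2r.
have : be * B <= 2 * B by apply: ler_wpM2r.
lra.
Qed.

Lemma enorm_le_sqr {R : realType} {n : nat} (x : 'rV[R]_n) (c : R) :
  0 <= c -> inner x x <= c * enorm x -> inner x x <= c ^+ 2.
Proof.
move=> c0; rewrite -enorm_sqr => h.
have := enorm_ge0 x; rewrite le_eqVlt => /orP[/eqP <-|x0].
  by rewrite expr0n /= exprn_ge0.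
by rewrite lerXn2r ?nnegrE ?enorm_ge0//; move: h; rewrite expr2 ler_pM2r.
Qed.

Lemma trace_mx_le {R : realType} {n : nat} (A B : 'M[R]_n) :
  \tr (A *m B) <= mxsum A * mxsum B.
Proof.
rewrite /mxtrace /mxsum mulr_suml; apply: ler_sum => i _.
rewrite mxE mulr_suml; apply: ler_sum => j _.
apply: le_trans (ler_norm _) _; rewrite normrM ler_wpM2l//.
rewrite (bigD1 j)//= (bigD1 i)//= -addrA lerDl addr_ge0 ?sumr_ge0// => k _.
by rewrite sumr_ge0.
Qed.

Section gaussian_lower_bound.
Context {R : realType} {n : nat}.
Variables (t0 : R) (Q : R -> 'M[R]_n) (b : R -> 'rV[R]_n -> 'rV[R]_n).
Variables (eta0 Lam al : R).
Hypothesis HA : dissipative_operator t0 Q b eta0 Lam.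
Hypothesis al_gt0 : 0 < al.
Hypothesis al_le : al <= 2^-1.
Variable s : R.
Hypothesis ts : t0 < s.
Variables CQ r1 B : R.
Hypothesis CQ_ge0 : 0 <= CQ.
Hypothesis Q_near : forall t, s < t <= s + 1 ->
  mxsum (Q t - Q s) <= CQ * expR (al * ln (t - s)).
Hypothesis b_near : forall t x, s <= t <= s + 1 -> inner x x <= r1 ->
  inner (b t x) (b t x) <= B.

Let M := invmx (Q s).
Let q (z : 'rV[R]_n) := inner (z *m M) z.

Lemma Q_unit : Q s \in unitmx.
Proof.
rewrite -row_free_unit -kermx_eq0; apply/eqP/row_matrixP => i; rewrite row0.
have : row i (kermx (Q s)) *m Q s = 0 by rewrite -row_mul mulmx_ker row0.
move=> E; apply: inner_eq0; apply/eqP; rewrite eq_le inner_ge0 andbT.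
have := dop_low HA (row i (kermx (Q s))) ts.
by rewrite E inner0l pmulr_rle0// (dop_eta_gt0 HA).
Qed.

Let Msym : M^T = M.
Proof. by rewrite /M trmx_inv (dop_sym HA ts). Qed.

Let MQ (z : 'rV[R]_n) : z *m M *m Q s = z.
Proof. by rewrite /M mulmxKV// Q_unit. Qed.

Lemma qM_low z : eta0 * inner (z *m M) (z *m M) <= q z.
Proof.
have := dop_low HA (z *m M) ts.
by rewrite MQ /q innerC.
Qed.

Lemma q_ge0 z : 0 <= q z.
Proof.
by apply: le_trans (qM_low z); rewrite mulr_ge0 ?inner_ge0// ltW// (dop_eta_gt0 HA).
Qed.

Lemma q_up z : q z <= mxsum M * inner z z.
Proof. by apply: le_trans (ler_norm _) _; exact: inner_mx_le_sqr. Qed.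

Lemma q_coercive z : eta0 * inner z z <= mxsum (Q s) ^+ 2 * q z.
Proof.
have e0 := dop_eta_gt0 HA.
have h1 : inner z z <= mxsum (Q s) * enorm (z *m M) * enorm z.
  rewrite -{1}(MQ z) -mulrA; apply: le_trans (ler_norm _) _; exact: inner_mx_le.
have c0 : 0 <= mxsum (Q s) * enorm (z *m M) by rewrite mulr_ge0 ?mxsum_ge0 ?enorm_ge0.
have := enorm_le_sqr c0 h1; rewrite exprMn enorm_sqr => h2.
apply: (@le_trans _ _ (eta0 * (mxsum (Q s) ^+ 2 * inner (z *m M) (z *m M)))).
  by apply: ler_wpM2l => //; exact: ltW.
by rewrite mulrCA; apply: ler_wpM2l; [exact: sqr_ge0|exact: qM_low].
Qed.

Lemma jet2_q z e : jet2 (fun h : R => q (z + h *: e)) (2 * inner (z *m M) e) (2 * q e).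
Proof.
apply: jet2_eq (jet2_quadratic (q z) (2 * inner (z *m M) e) (q e)) _ _ _ => // h.
rewrite /q mulmxDl -scalemxAl !innerE.
have -> : inner (e *m M) z = inner (z *m M) e by rewrite inner_mulmxl Msym innerC.
by ring.
Qed.

Lemma continuous_q : continuous q.
Proof.
by apply: continuous_inner => [z|z]; [exact: continuous_mulmxr|exact: cvg_id].
Qed.

Let d : R := n%:R.
Let C2 := CQ * mxsum M.
Let C3 := CQ / eta0.
Let K := 2 * C3 + eta0^-1.
Let k := (2 * K * d + 4 * C2 + 2 * B + 1) / (4 * al).

(** A local heat kernel bound with the exact power of time. The frozen
    coefficient [Q s] gives an exact solution; Hoelder continuity of [Q] and
    boundedness of the drift near [s] make errors of relative size [tau ^ al],
    integrable against [d tau / tau] and hence absorbed by a correction of that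
    size in the exponent. Subtracting the boundary value [kap] localizes the
    comparison to an ellipsoid. *)
Lemma gaussian_lower_bound tau1 L x0 h u :
  0 < h -> h ^+ 2 < tau1 -> tau1 <= 1 -> K * expR (al * ln tau1) <= 1 ->
  2 * d * tau1 <= L -> 8 * k * tau1 <= L -> 0 < L -> 0 <= B ->
  (forall x, q (x - x0) <= L -> inner x x <= r1) ->
  bounded_solution Q b s u -> (forall t x, s <= t -> 0 <= u t x) ->
  (forall x, expR (- (d / 2) * ln (h ^+ 2) - q (x - x0) / (4 * h ^+ 2)) <= u s x) ->
  forall x, q (x - x0) <= L / 16 ->
    expR (- (d / 2) * ln tau1 - (k + L / (32 * tau1)))
      - expR (- (d / 2) * ln tau1 - L / (4 * tau1)) <= u (s + tau1 - h ^+ 2) x.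
Proof.
move=> h0 htau tau11 Ktau dL kL L0 B0 region us u_ge0 uini x1 qx1.
have e0 := dop_eta_gt0 HA; have [cu _ su] := us.
have hh0 : 0 < h ^+ 2 by rewrite exprn_gt0.
have tau10 : 0 < tau1 by exact: lt_trans htau.
have C20 : 0 <= C2 by rewrite mulr_ge0 ?mxsum_ge0.
have C30 : 0 <= C3 by rewrite divr_ge0// ltW.
have ie0 : 0 < eta0^-1 by rewrite invr_gt0.
have K0 : 0 <= K by rewrite /K; nonneg.
have d0 : 0 <= d by exact: ler0n.
have al0 := al_gt0.
have k0 : 0 <= k by rewrite /k; nonneg.
pose T := s + tau1 - h ^+ 2.
have sT : s < T by rewrite /T; lra.
pose tau t := t - s + h ^+ 2.
have tau_gt0 t : s <= t -> 0 < tau t by move=> st; rewrite /tau; lra.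
have tau_le t : t <= T -> tau t <= tau1 by rewrite /tau /T; lra.
pose y t := expR (al * ln (tau t)).
have y0 t : 0 < y t by exact: expR_gt0.
have Ky t : s <= t <= T -> K * y t <= 1.
  move=> /andP[st tT]; apply: le_trans Ktau; apply: ler_wpM2l => //.
  by rewrite ler_expR ler_pM2l// ler_ln ?posrE ?tau_gt0// tau_le.
pose S t x := - (d / 2) * ln (tau t) - k * y t - (1 + K * y t) * q (x - x0) / (4 * tau t).
pose kap := expR (- (d / 2) * ln tau1 - L / (4 * tau1)).
have y1 t : s <= t <= T -> y t <= 1.
  move=> /andP[st tT]; rewrite -[leRHS]expR0 ler_expR.
  rewrite pmulr_rle0// ln_le0//; exact: le_trans (tau_le t tT) tau11.
have tauT : tau T = tau1 by rewrite /tau /T; ring.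
have sTT : s <= T <= T by rewrite (ltW sT) lexx.
rewrite -/T -/kap.
apply: (@le_trans _ _ (expR (S T x1) - kap)).
  rewrite lerD2r ler_expR /S tauT.
  have q0 := q_ge0 (x1 - x0).
  have h1 : k * y T <= k by rewrite ler_piMr// y1.
  have h2 : (1 + K * y T) * q (x1 - x0) / (4 * tau1) <= L / (32 * tau1).
    have -> : L / (32 * tau1) = 2 * (L / 16) / (4 * tau1) by field; rewrite gt_eqF.
    apply: ler_wpM2r; first by rewrite invr_ge0 mulr_ge0// ltW.
    by apply: ler_pM => //; [rewrite addr_ge0// mulr_ge0// ltW|have := Ky T sTT; lra].
  lra.
rewrite leNgt; apply/negP => contra.
pose E1 := [set x : 'rV[R]_n | q (x - x0) <= L].
pose U1 := [set x : 'rV[R]_n | q (x - x0) < L].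
have cqx : continuous (fun x : 'rV[R]_n => q (x - x0)).
  have csub : continuous (fun x : 'rV[R]_n => x - x0).
    by move=> x; apply: continuousB; [exact: cvg_id|exact: cst_continuous].
  exact: (continuous_compose csub continuous_q).
have cE : compact E1.
  apply: (@subclosed_compact _ _ [set x : 'rV[R]_n | inner x x <= r1]).
  - apply: (@preimage_closed _ _ (fun x : 'rV[R]_n => q (x - x0)) [set t | t <= L]).
      by move=> x _; exact: cqx.
    exact: closed_le.
  - exact: compact_inner_le.
  - by move=> x /= xL; exact: region.
pose F0 t x := expR (S t x) - kap - u t x.
pose F t := F0 (Num.max s t).
have [||||||| t [x [stT Ex Ux Fpos [Fr Fx]]]] :=
  @parabolic_max R _ E1 U1 F s T T x1.
- exact: cE.
- move=> x /= xL nxL t stT.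
  have st : s <= t by case/andP: stT.
  have tT : t <= T by case/andP: stT.
  have qL : q (x - x0) = L by apply/eqP; rewrite eq_le xL leNgt; apply/negP.
  rewrite /F /F0 max_r//; have := u_ge0 t x st.
  suff : expR (S t x) <= kap by lra.
  rewrite ler_expR /S qL.
  have ta := tau_gt0 t st; have tl := tau_le t tT.
  have h1 : 0 <= k * y t by rewrite mulr_ge0// ltW.
  have h2 : L / (4 * tau t) <= (1 + K * y t) * L / (4 * tau t).
    apply: ler_wpM2r; first by rewrite invr_ge0 mulr_ge0// ltW.
    by rewrite ler_peMl ?(ltW L0)// lerDl mulr_ge0// ltW.
  have h3 : d / 2 * (ln tau1 - ln (tau t)) <= L / (4 * tau t) - L / (4 * tau1).
    rewrite -ln_div ?posrE//.
    have r1' : 1 <= tau1 / tau t by rewrite ler_pdivlMr// mul1r.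
    have lnr : ln (tau1 / tau t) <= tau1 / tau t - 1.
      by have := @le_ln1Dx R (tau1 / tau t - 1); rewrite addrCA subrr addr0; apply; lra.
    apply: (@le_trans _ _ (d / 2 * (tau1 / tau t - 1))).
      by apply: ler_wpM2l => //; nonneg.
    have -> : L / (4 * tau t) - L / (4 * tau1) = L / (4 * tau1) * (tau1 / tau t - 1).
      by field; rewrite !gt_eqF.
    apply: ler_wpM2r; first by lra.
    by rewrite ler_pdivlMr ?mulr_gt0//; lra.
  lra.
- have cm : continuous (fun z : R * 'rV[R]_n => Num.max s z.1).
    move=> z; apply: (@continuous_max _ _ (fun _ => s) (fun z => z.1)).
      exact: cvg_cst.
    exact: cvg_fst.
  have ctau : continuous (fun z : R * 'rV[R]_n => tau (Num.max s z.1)).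
    apply: continuous_add; last exact: continuous_const.
    by apply: continuous_sub => //; exact: continuous_const.
  have ta z : 0 < tau (Num.max s (z : R * 'rV[R]_n).1).
    by apply: tau_gt0; rewrite le_max lexx.
  have cln := continuous_ln_pos ta ctau.
  have cy : continuous (fun z : R * 'rV[R]_n => y (Num.max s z.1)).
    apply: (@continuous_compose _ _ _ _ expR); last exact: continuous_expR.
    by apply: continuous_mul => //; exact: continuous_const.
  have cqz : continuous (fun z : R * 'rV[R]_n => q (z.2 - x0)).
    have csnd : continuous (fun z : R * 'rV[R]_n => z.2) by move=> z; exact: cvg_snd.
    exact: (continuous_compose csnd cqx).
  rewrite /F /F0; apply: continuous_sub; last exact: cu.
  apply: continuous_sub; last exact: continuous_const.
  apply: (@continuous_compose _ _ _ _ expR); last exact: continuous_expR.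
  apply: continuous_sub; first apply: continuous_sub.
  + by apply: continuous_mul => //; exact: continuous_const.
  + by apply: continuous_mul => //; exact: continuous_const.
  apply: continuous_mul.
    apply: continuous_mul => //; apply: continuous_add; first exact: continuous_const.
    by apply: continuous_mul => //; exact: continuous_const.
  move=> z; apply: (@continuousV _ _ (fun z => 4 * tau (Num.max s z.1))).
    by rewrite gt_eqF// mulr_gt0.
  by apply: continuous_mul => //; exact: continuous_const.
- move=> x _; rewrite /F /F0 maxxx.
  have kap0 : 0 < kap by exact: expR_gt0.
  suff : expR (S s x) <= u s x by lra.
  apply: le_trans (uini x); rewrite ler_expR /S /tau subrr add0r.
  have q0 := q_ge0 (x - x0).
  have h1 : 0 <= k * y s by rewrite mulr_ge0// ltW.
  have : q (x - x0) / (4 * h ^+ 2) <= (1 + K * y s) * q (x - x0) / (4 * h ^+ 2).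
    apply: ler_wpM2r; first by rewrite invr_ge0 mulr_ge0// ltW.
    by rewrite ler_peMl// lerDl mulr_ge0// ltW.
  lra.
- by rewrite lexx (ltW sT).
- by rewrite /E1 /=; lra.
- by rewrite /F /F0 max_r ?(ltW sT)//; lra.
have /andP[st tT] := stT.
have t0t : t0 < t by exact: lt_trans st.
have ta := tau_gt0 t (ltW st).
have stT' : s <= t <= T by rewrite (ltW st).
have [sq QE] := Q_decomp HA t0t.
pose z := x - x0; pose w := z *m M; pose P := expR (S t x).
pose be := 1 + K * y t.
pose a1 e := - (be / (4 * tau t)) * (2 * inner w e).
pose a2 e := - (be / (4 * tau t)) * (2 * q e).
pose St := - d / (2 * tau t) - k * al * y t / tau t - K * al * y t * q z / (4 * tau t ^+ 2)
    + be * q z / (4 * tau t ^+ 2).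
have JP e : jet2 (fun h : R => - (expR (S t (x + h *: e)) - kap)) (- (P * a1 e))
    (- (P * (a2 e + a1 e ^+ 2))).
  have J := jet2_add (jet2_const (- (d / 2) * ln (tau t) - k * y t))
     (jet2_scale (- (be / (4 * tau t))) (jet2_q z e)).
  apply: jet2_eq (jet2_opp (jet2_add (jet2_expR J) (jet2_const (- kap)))) _ _ _.
  - move=> r; congr (- (expR _ - _)); rewrite /S -/be.
    have -> : x + r *: e - x0 = z + r *: e by rewrite /z addrAC.
    by field; rewrite gt_eqF.
  - rewrite scale0r !addr0 add0r /P /S -/be -/z /a1 -/w.
    by congr (- (expR _ * _)); field; rewrite gt_eqF.
  - rewrite scale0r !addr0 !add0r /P /S -/be -/z /a1 -/w /a2.
    by congr (- (expR _ * _)); field; rewrite gt_eqF.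
have Dtau : is_derive t 1 tau 1.
  by apply: derive_eq (derive_affine t (h ^+ 2 - s) 1) _ _ => // r; rewrite /tau; ring.
have Dln := derive_ln ta Dtau.
have Dy : is_derive t 1 y (y t * (al * (1 / tau t))).
  exact: derive_expR (derive_scale al Dln).
have tan0 : tau t != 0 by rewrite gt_eqF.
have DS : is_derive t 1 (S ^~ x) St.
  apply: derive_eq (derive_add (derive_add (derive_scale (- (d / 2)) Dln)
    (derive_scale (- k) Dy)) (derive_scale (- (q z / 4))
      (derive_mul (derive_add (derive_const 1 t) (derive_scale K Dy))
        (derive_inv tan0 Dtau)))) _ _ => [r|].
    by rewrite /S -/z invfM; ring.
  by rewrite /St /be; field; rewrite gt_eqF.
have DP : is_derive t 1 (fun r => - (expR (S r x) - kap)) (- (P * St)).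
  apply: derive_eq (derive_scale (-1) (derive_add (derive_expR DS) (derive_const (- kap) t))) _ _.
    by move=> r; rewrite mulN1r.
  by rewrite addr0 mulN1r.
have := @touching_from_above _ _ Q b s (fun r x => - u r x)
  (fun r x => - (expR (S r x) - kap)) t x _ _ _ sq (solves_opp su) st QE JP DP.
have nearU e : \forall h \near (0 : R), q (x + h *: e - x0) < L.
  have := jet2_continuous (jet2_q z e).
  move=> /(near_continuous_lt (f := fun h : R => q (z + h *: e)) (x := 0) (c := L)).
  rewrite scale0r addr0 => /(_ Ux); apply: filterS => r.
  by rewrite /z addrAC.
have tmax r : s <= r <= t -> - u r x - - (expR (S r x) - kap) <= - u t x - - (expR (S t x) - kap).
  move=> /andP[sr rt]; have := Fr r; rewrite sr rt /F /F0 !max_r ?(ltW st)// => /(_ isT).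
  lra.
have xmax e : \forall h \near (0 : R), - u t (x + h *: e) - - (expR (S t (x + h *: e)) - kap) <=
    - u t x - - (expR (S t x) - kap).
  have := nearU e; apply: filterS => r rL.
  by have := Fx (x + r *: e) (ltW rL); rewrite /F /F0 !max_r ?(ltW st)//; lra.
move=> /(_ tmax xmax).
rewrite sumrN -mulr_sumr -opprD -mulrDr lerN2 ler_pM2l ?expR_gt0// big_split /=.
have -> : \sum_(v <- sq) a2 v = - (be * \tr (Q t *m M) / (2 * tau t)).
  rewrite /a2 -mulr_sumr -mulr_sumr.
  have -> : \sum_(v <- sq) q v = \tr (Q t *m M) by rewrite {1}QE trace_decomp.
  by field; rewrite gt_eqF.
have -> : \sum_(v <- sq) a1 v ^+ 2 = be ^+ 2 * inner (w *m Q t) w / (4 * tau t ^+ 2).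
  rewrite QE form_decomp mulr_sumr mulr_suml; apply: eq_bigr => v _.
  by rewrite /a1; field; rewrite gt_eqF.
have -> : a1 (b t x) = - (be * inner w (b t x) / (2 * tau t)).
  by rewrite /a1; field; rewrite gt_eqF.
apply/negP; rewrite -ltNge /St /be.
have st1 : s < t <= s + 1.
  rewrite st /=; apply: le_trans tT _; rewrite /T.
  by have := ltW hh0; lra.
have Dy_le : mxsum (Q t - Q s) <= CQ * y t.
  apply: le_trans (Q_near st1) _; apply: ler_wpM2l => //.
  rewrite ler_expR ler_pM2l// ler_ln ?posrE ?subr_gt0//; last by rewrite /tau; lra.
have w2 : inner w w <= q z / eta0 by rewrite ler_pdivlMr// mulrC; exact: qM_low.
apply: gaussian_coefficients => //.
- exact: Ky.
- exact: q_ge0.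
- have -> : Q t = Q s + (Q t - Q s) by rewrite addrC subrK.
  rewrite mulmxDl linearD /= mulmxV ?Q_unit// mxtrace1 -/d lerD2l.
  apply: le_trans (trace_mx_le _ _) _; rewrite /C2 mulrAC.
  by apply: ler_wpM2r => //; exact: mxsum_ge0.
- have -> : Q t = Q s + (Q t - Q s) by rewrite addrC subrK.
  rewrite mulmxDr innerDl {1 2}/w MQ (_ : inner z (z *m M) = q z); last by rewrite innerC.
  have := inner_mx_le_sqr (Q t - Q s) w; rewrite ler_norml => /andP[h1 _].
  have h2 : mxsum (Q t - Q s) * inner w w <= CQ * y t * (q z / eta0).
    by apply: ler_pM => //; [exact: mxsum_ge0|exact: inner_ge0].
  have -> : q z * (1 - C3 * y t) = q z - CQ * y t * (q z / eta0) by rewrite /C3; ring.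
  lra.
have qL : q z <= L by apply: ltW.
have bB : inner (b t x) (b t x) <= B.
  by apply: b_near; [case/andP: st1 => /ltW -> ->|exact: region].
pose la := y t / tau t.
have la0 : 0 < la by rewrite divr_gt0.
have young : 2 * inner w (b t x) <= la * inner w w + la^-1 * inner (b t x) (b t x).
  have := inner_ge0 (la *: w - b t x); rewrite !innerE (innerC (b t x) w) => h1.
  rewrite -(ler_pM2l la0) mulrDr [la * (la^-1 * _)]mulrA divff ?gt_eqF// mul1r.
  by lra.
apply: le_trans young _; apply: lerD.
  have -> : q z * y t / (eta0 * tau t) = la * (q z / eta0) by rewrite /la; field; rewrite !gt_eqF.
  by apply: ler_wpM2l => //; exact: ltW.
(* Here the exponent at most one half is used: [tau / y <= y]. *)
have lay : la^-1 <= y t.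
  rewrite invf_div ler_pdivrMr// /y -expRD -[leLHS]lnK ?posrE// ler_expR -mulrDl.
  have lt0 : ln (tau t) <= 0 by apply: ln_le0; apply: le_trans (tau_le t tT) tau11.
  have a2le : al + al <= 1 by have := al_le; lra.
  by rewrite -[leLHS]mul1r; apply: ler_wnM2r.
rewrite [B * _]mulrC; apply: ler_pM => //; first by rewrite invr_ge0 ltW.
exact: inner_ge0.
Qed.

End gaussian_lower_bound.

Section gaussian_mass.
Context {R : realType} {n : nat}.
Variables (t0 : R) (Q : R -> 'M[R]_n) (b : R -> 'rV[R]_n -> 'rV[R]_n).
Variables (eta0 Lam al : R).
Hypothesis HA : dissipative_operator t0 Q b eta0 Lam.
Hypothesis al_gt0 : 0 < al.
Hypothesis al_le : al <= 2^-1.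
Hypothesis Q_near : forall s, t0 < s -> exists2 C, 0 <= C & forall t, s < t <= s + 1 ->
  mxsum (Q t - Q s) <= C * expR (al * ln (t - s)).
Hypothesis b_near : forall s r, t0 < s -> exists2 B, 0 <= B &
  forall t x, s <= t <= s + 1 -> inner x x <= r -> inner (b t x) (b t x) <= B.
Variables (G : R -> R -> ('rV[R]_n -> R) -> 'rV[R]_n -> R) (mu : R -> probability 'rV[R]_n R).
Hypothesis G_solves : forall s f, t0 < s -> Cb f ->
  bounded_solution Q b s (fun t => G t s f) /\ G s s f = f.
Hypothesis mu_invariant : forall s t f, t0 < s -> s < t -> Cb f ->
  \int[mu t]_x G t s f x = \int[mu s]_x f x.
Variable R1 : R.
Hypothesis mu_tight : forall t, t0 < t -> ((1 - 2^-1)%:E <= mu t (eball R1))%E.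

Lemma Cb_expR_opp (g : 'rV[R]_n -> R) : continuous g -> (forall x, 0 <= g x) ->
  Cb (fun x => expR (- g x)).
Proof.
move=> cg g0; split.
  apply: (@continuous_compose _ _ _ (fun x => - g x) expR); last exact: continuous_expR.
  exact: continuous_opp.
by exists 1 => x; rewrite ger0_norm ?expR_ge0// -expR0 ler_expR oppr_le0.
Qed.

(** The lower bound for the solution issued from a Gaussian of width [h] and height
    [h^-n] is independent of [h] and holds on a ball that carries half of the mass
    of a later measure; by invariance the mean of the Gaussian itself is bounded
    below. *)
Lemma gaussian_mass s r0 : t0 < s -> exists a c tau1 : R,
  [/\ 0 < a, 0 < c, 0 < tau1 &
    forall x0 h, inner x0 x0 <= r0 -> 0 < h -> h ^+ 2 < tau1 ->
      c * h ^+ n <= \int[mu s]_x expR (- (a * inner (x - x0) (x - x0) / h ^+ 2))].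
Proof.
move=> ts; have e0 := dop_eta_gt0 HA.
have [CQ CQ0 HCQ] := Q_near ts.
pose M := invmx (Q s); pose mM := mxsum M; pose mQ := mxsum (Q s).
have mM0 : 0 <= mM by exact: mxsum_ge0.
pose L := 16 * (mM * (2 * (R1 ^+ 2 + `|r0|)) + 1).
have L0 : 0 < L.
  have : 0 <= mM * (2 * (R1 ^+ 2 + `|r0|)) by nonneg.
  by rewrite /L; lra.
pose r1 := 2 * (mQ ^+ 2 * L / eta0) + 2 * `|r0|.
have [B B0 HB] := b_near r1 ts.
pose d : R := n%:R; pose C2 := CQ * mM; pose C3 := CQ / eta0.
pose K := 2 * C3 + eta0^-1.
pose k := (2 * K * d + 4 * C2 + 2 * B + 1) / (4 * al).
have al0 := al_gt0.
have C20 : 0 <= C2 by rewrite /C2; nonneg.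
have C30 : 0 <= C3 by rewrite /C3; nonneg.
have K0 : 0 <= K by rewrite /K; nonneg.
have d0 : 0 <= d by exact: ler0n.
have k0 : 0 <= k by rewrite /k; nonneg.
pose tauK := expR (- (ln (K + 1) / al)).
have tauK0 : 0 < tauK by exact: expR_gt0.
pose tauL := L / (2 * d + 8 * k + 1).
have den0 : 0 < 2 * d + 8 * k + 1 by lra.
have tauL0 : 0 < tauL by rewrite divr_gt0.
pose tau1 := Num.min 1 (Num.min tauK tauL).
have tau10 : 0 < tau1 by rewrite !lt_min ltr01 tauK0.
have tau11 : tau1 <= 1 by rewrite ge_min lexx.
have tau1K : tau1 <= tauK by rewrite !ge_min lexx !orbT.
have tau1L : tau1 <= tauL by rewrite !ge_min lexx !orbT.
have dkL : (2 * d + 8 * k + 1) * tau1 <= L.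
  by rewrite mulrC -ler_pdivlMr.
have dt0 : 0 <= d * tau1 by rewrite mulr_ge0// ltW.
have kt0 : 0 <= k * tau1 by rewrite mulr_ge0// ltW.
have dL : 2 * d * tau1 <= L by lra.
have kL : 8 * k * tau1 <= L by lra.
have Ktau : K * expR (al * ln tau1) <= 1.
  apply: (@le_trans _ _ (K * (K + 1)^-1)); last first.
    by rewrite ler_pdivrMr ?mul1r; lra.
  apply: ler_wpM2l => //; rewrite -[leRHS]lnK ?posrE ?invr_gt0; last by lra.
  rewrite ler_expR lnV ?posrE; last by lra.
  apply: (@le_trans _ _ (al * ln tauK)).
    by rewrite ler_pM2l// ler_ln ?posrE.
  by rewrite /tauK expRK mulrN lerN2 mulrC divfK// gt_eqF.
pose c0 := expR (- (d / 2) * ln tau1 - (k + L / (32 * tau1)))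
      - expR (- (d / 2) * ln tau1 - L / (4 * tau1)).
have c00 : 0 < c0.
  rewrite subr_gt0 ltr_expR ltrD2l ltrN2.
  have -> : L / (4 * tau1) = 8 * (L / (32 * tau1)) by field; rewrite gt_eqF.
  have : k <= 4 * (L / (32 * tau1)).
    have -> : 4 * (L / (32 * tau1)) = L / (8 * tau1) by field; rewrite gt_eqF.
    by rewrite ler_pdivlMr ?mulr_gt0//; lra.
  have : 0 < L / (32 * tau1) by rewrite divr_gt0// mulr_gt0.
  lra.
pose a := eta0 / (4 * (mQ ^+ 2 + 1)).
have mQ1 : 0 < mQ ^+ 2 + 1 by have := sqr_ge0 mQ; lra.
have a0 : 0 < a by rewrite divr_gt0// mulr_gt0.
exists a, (c0 / 2), tau1; split => // [|x0 h x0r h0 hh].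
  by rewrite divr_gt0.
have hh0 : 0 < h ^+ 2 by rewrite exprn_gt0.
have x0r' : inner x0 x0 <= `|r0| by apply: le_trans x0r (ler_norm _).
pose q (z : 'rV[R]_n) := inner (z *m M) z.
have q0 z : 0 <= q z by exact: (q_ge0 HA ts).
have qup z : q z <= mM * inner z z by exact: q_up.
have qco z : eta0 * inner z z <= mQ ^+ 2 * q z by exact: (q_coercive HA ts).
have csub : continuous (fun x : 'rV[R]_n => x - x0).
  by move=> x; apply: continuousB; [exact: cvg_id|exact: cst_continuous].
have cq : continuous (fun x : 'rV[R]_n => q (x - x0)).
  exact: (continuous_compose csub (@continuous_q _ _ Q s)).
pose H := expR (- (d / 2) * ln (h ^+ 2)).
pose g (x : 'rV[R]_n) := H * expR (- (q (x - x0) / (4 * h ^+ 2))).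
have ceq : Cb (fun x : 'rV[R]_n => expR (- (q (x - x0) / (4 * h ^+ 2)))).
  apply: Cb_expR_opp => [|x]; last by apply: divr_ge0; [exact: q0|nonneg].
  by apply: continuous_mul => //; exact: continuous_const.
have cg : Cb g.
  have [ce [Mb HMb]] := ceq; split; first by apply: continuous_mul => //; exact: continuous_const.
  exists (H * Mb) => x; rewrite normrM [`|H|]ger0_norm ?expR_ge0//.
  by apply: ler_wpM2l; [exact: expR_ge0|exact: HMb].
have [ug ugE] := G_solves ts cg.
pose T := s + tau1 - h ^+ 2.
have sT : s < T by rewrite /T; lra.
have region x : q (x - x0) <= L -> inner x x <= r1.
  move=> qL; have := inner_sub_le (x - x0) (- x0).
  rewrite opprK subrK innerNl innerNr opprK => h1.
  have : inner (x - x0) (x - x0) <= mQ ^+ 2 * L / eta0.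
    rewrite ler_pdivlMr// mulrC; apply: le_trans (qco _) _.
    by apply: ler_wpM2l => //; exact: sqr_ge0.
  by rewrite /r1; lra.
have u_ge0 t x : s <= t -> 0 <= G t s g x.
  apply: (bounded_solution_ge HA ts ug) => y.
  by rewrite ugE /g mulr_ge0 ?expR_ge0.
have lower x : q (x - x0) <= L / 16 -> c0 <= G T s g x.
  apply: (@gaussian_lower_bound _ _ t0 Q b eta0 Lam al HA al_gt0 al_le s ts CQ r1 B CQ0
     HCQ HB tau1 L x0 h (fun t => G t s g)) => // y.
  by rewrite ugE /g /H -expRD.
have : c0 / 2 <= \int[mu T]_x G T s g x.
  apply: (half_mass_le (B := @eball R n R1)).
  - by apply: open_measurable_rV; exact: eball_open.
  - exact: Cb_slice ug (ltW sT).
  - exact: ltW.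
  - by move=> x; apply: u_ge0; exact: ltW.
  - move=> x xR; apply: lower; apply: le_trans (qup _) _.
    have x2 : inner x x <= R1 ^+ 2.
      rewrite -enorm_sqr lerXn2r ?nnegrE ?enorm_ge0 ?(ltW xR)//.
      exact: le_trans (enorm_ge0 x) (ltW xR).
    have := inner_sub_le x x0 => h1.
    apply: (@le_trans _ _ (mM * (2 * (R1 ^+ 2 + `|r0|)))).
      by apply: ler_wpM2l => //; lra.
    by rewrite /L; lra.
  - exact: mu_tight (lt_trans ts sT).
rewrite mu_invariant// RintegralZl//; last exact: Cb_integrable.
have Hh : H * h ^+ n = 1.
  rewrite /H lnXn// -[h ^+ n]lnK ?posrE ?exprn_gt0// -expRD lnXn//.
  rewrite -[RHS]expR0; congr (expR _).
  rewrite -[ln h *+ 2]mulr_natl -[ln h *+ n]mulr_natl mulrA mulNr divfK//.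
  by rewrite mulNr addNr.
have hn0 : 0 < h ^+ n by rewrite exprn_gt0.
move=> mass; apply: (@le_trans _ _
    (\int[mu s]_x expR (- (q (x - x0) / (4 * h ^+ 2))))).
  set I := (X in _ <= X); have -> : I = h ^+ n * (H * I) by rewrite mulrA [h ^+ n * H]mulrC Hh mul1r.
  by rewrite mulrC ler_pM2l.
apply: le_Rintegral => //; first exact: Cb_integrable.
  apply: Cb_integrable; apply: Cb_expR_opp => [|x].
    apply: continuous_mul; last exact: continuous_const.
    by apply: continuous_mul; [exact: continuous_const|exact: continuous_inner].
  by nonneg.
move=> x _; rewrite ler_expR lerN2.
have -> : q (x - x0) / (4 * h ^+ 2) = q (x - x0) / 4 / h ^+ 2 by rewrite invfM mulrA.
apply: ler_wpM2r; first by rewrite invr_ge0 ltW.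
rewrite ler_pdivlMr// /a.
have -> : eta0 / (4 * (mQ ^+ 2 + 1)) * inner (x - x0) (x - x0) * 4 =
    eta0 * inner (x - x0) (x - x0) / (mQ ^+ 2 + 1) by field; rewrite gt_eqF.
rewrite ler_pdivrMr//; apply: le_trans (qco _) _.
by rewrite mulrC; apply: ler_wpM2l; [exact: q0|lra].
Qed.

End gaussian_mass.

(** * Dyadic cells *)

Lemma Rintegral_sum_Cb {R : realType} {n : nat} (mu : probability 'rV[R]_n R) {I : Type}
    (r : seq I) (f : I -> 'rV[R]_n -> R) : (forall i, Cb (f i)) ->
  Cb (fun x => \sum_(i <- r) f i x) /\
  \int[mu]_x (\sum_(i <- r) f i x) = \sum_(i <- r) \int[mu]_x f i x.
Proof.
move=> cf; elim: r => [|i r [[cr [Mr HMr]] IH]].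
  have -> : (fun x : 'rV[R]_n => \sum_(i <- [::]) f i x) = (fun=> 0).
    by apply/funext => x; rewrite big_nil.
  split; first by split; [exact: continuous_const|exists 0 => x; rewrite normr0].
  by rewrite big_nil Rintegral_cst// mul0r.
have -> : (fun x : 'rV[R]_n => \sum_(i <- i :: r) f i x) =
    (fun x => f i x + \sum_(i <- r) f i x).
  by apply/funext => x; rewrite big_cons.
have [ci [Mi HMi]] := cf i.
split.
  split; first exact: continuous_add.
  exists (Mi + Mr) => x; apply: le_trans (ler_normD _ _) _; exact: lerD.
rewrite big_cons RintegralD// ?IH//; first exact: Cb_integrable.
by apply: (@Cb_integrable _ _ mu (fun x => \sum_(i <- r) f i x)); split => //; exists Mr.
Qed.

(** Comparison with a geometric series on each side of the center. *)
Lemma gaussian_sum (R : realType) (a : R) : 0 < a -> exists2 C, 0 < C &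
  forall N Y, \sum_(j < N) expR (- (a * (Y - j%:R) ^+ 2)) <= C.
Proof.
move=> a0; pose r := expR (- a).
have r0 : 0 < r by exact: expR_gt0.
have r1 : r < 1 by rewrite -expR0 ltr_expR oppr_lt0.
pose g := (1 - r)^-1.
have g0 : 0 < g by rewrite invr_gt0; lra.
have gE : g = 1 + r * g by rewrite /g; field; rewrite subr_eq0 gt_eqF.
have g1 : 1 <= g by have : 0 < r * g by [rewrite mulr_gt0]; lra.
have rg : r * g <= g by lra.
pose S N Y := \sum_(j < N) expR (- (a * `|Y - j%:R|)).
have Srec N Y : S N.+1 Y = expR (- (a * `|Y|)) + S N (Y - 1).
  rewrite /S big_ord_recl subr0; congr (_ + _); apply: eq_bigr => j _.
  by rewrite lift0 -natr1 opprD addrA addrAC.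
have Sneg N : forall Y, Y <= 0 -> S N Y <= g * expR (a * Y).
  elim: N => [|N IH] Y Y0; first by rewrite /S big_ord0 mulr_ge0 ?expR_ge0 ?(ltW g0).
  have Y10 : Y - 1 <= 0 by lra.
  rewrite Srec (ler0_norm Y0) mulrN opprK; apply: le_trans (lerD (lexx _) (IH _ Y10)) _.
  have -> : expR (a * (Y - 1)) = expR (a * Y) * r by rewrite mulrBr mulr1 expRD.
  by rewrite [X in _ <= X * _]gE mulrDl mul1r lerD2l
    (_ : g * _ = r * g * expR (a * Y)) //; ring.
have Spos N : forall Y, 0 <= Y -> S N Y <= 3 * g - r * g * expR (- (a * Y)).
  have e1 Y : 0 <= Y -> expR (- (a * Y)) <= 1.
    by move=> Y0; rewrite -expR0 ler_expR oppr_le0 mulr_ge0// ltW.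
  have e2 Y : 0 <= Y -> r * g * expR (- (a * Y)) <= g.
    move=> Y0; apply: le_trans rg; rewrite ler_piMr ?e1// mulr_ge0 ?ltW//.
  elim: N => [|N IH] Y Y0; first by rewrite /S big_ord0; have := e2 Y Y0; lra.
  rewrite Srec (ger0_norm Y0); have [Y1|Y1] := ltP Y 1.
    have Y10 : Y - 1 <= 0 by lra.
    have := Sneg N _ Y10; have := e1 Y Y0; have := e2 Y Y0.
    have : g * expR (a * (Y - 1)) <= g.
      by rewrite ler_piMr ?(ltW g0)// -[leRHS]expR0 ler_expR pmulr_rle0.
    lra.
  have Y10 : 0 <= Y - 1 by lra.
  have := IH _ Y10.
  have -> : r * g * expR (- (a * (Y - 1))) = g * expR (- (a * Y)).
    have -> : - (a * (Y - 1)) = a + - (a * Y) by ring.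
    by rewrite expRD /r mulrACA expRN mulVf ?mul1r// gt_eqF// expR_gt0.
  have : expR (- (a * Y)) + r * g * expR (- (a * Y)) = g * expR (- (a * Y)).
    by rewrite {2}gE mulrDl mul1r.
  lra.
exists (expR a * (3 * g)) => [|N Y]; first by rewrite mulr_gt0 ?expR_gt0// mulr_gt0.
apply: (@le_trans _ _ (expR a * S N Y)).
  rewrite /S mulr_sumr; apply: ler_sum => j _; rewrite -expRD ler_expR.
  set v := Y - _; rewrite -[v ^+ 2]real_normK ?num_real//.
  have := mulr_ge0 (ltW a0) (sqr_ge0 (`|v| - 2^-1)).
  have : 0 < a by [].
  by lra.
rewrite ler_pM2l ?expR_gt0//; have [Y0|Y0] := leP 0 Y.
  have := Spos N Y Y0.
  have : 0 <= r * g * expR (- (a * Y)) by rewrite !mulr_ge0 ?expR_ge0 ?ltW.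
  lra.
have := Sneg N Y (ltW Y0).
have : g * expR (a * Y) <= g.
  by rewrite ler_piMr ?(ltW g0)// -expR0 ler_expR pmulr_rle0// ltW.
lra.
Qed.

Section dyadic_cells.
Context {R : realType} {n : nat}.
Local Notation V := 'rV[R]_n.

Definition cell_index (m : nat) (x : V) : {ffun 'I_n -> int} :=
  [ffun i => Num.floor (2 ^+ m * x 0 i)].

Definition cell (m : nat) (k : {ffun 'I_n -> int}) : set V :=
  [set y | cell_index m y = k].

Lemma cellP m k y : cell m k y <->
  forall i, (k i)%:~R <= 2 ^+ m * y 0 i < (k i + 1)%:~R.
Proof.
split=> [<- i|H]; first by rewrite ffunE floor_itv.
by apply/ffunP => i; rewrite ffunE; apply/eqP; rewrite floor_eq.
Qed.

Lemma cell_index_coarser m j x y : (j <= m)%N ->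
  cell_index m x = cell_index m y -> cell_index j x = cell_index j y.
Proof.
move=> jm; rewrite -(subnK jm); elim: (m - j)%N => [//|p IH] E; apply: IH.
apply/ffunP => i; move/ffunP: E => /(_ i); rewrite !ffunE => E.
apply/eqP; rewrite floor_eq; apply/andP.
set f := Num.floor (2 ^+ (p + j) * y 0 i).
have dbl (t : R) : 2 ^+ (p.+1 + j) * t = 2 * (2 ^+ (p + j) * t) by rewrite addSn exprS mulrA.
rewrite !dbl in E.
have /andP[h1 h2] := floor_itv (2 ^+ (p + j) * y 0 i).
rewrite -/f in h1 h2.
have l1 : (2 * f <= Num.floor (2 * (2 ^+ (p + j) * y 0 i)))%R.
  by rewrite floor_ge_int intrM; lra.
have l2 : (Num.floor (2 * (2 ^+ (p + j) * y 0 i)) < 2 * (f + 1))%R.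
  by rewrite floor_lt_int intrM; lra.
rewrite -E floor_ge_int intrM in l1; rewrite -E floor_lt_int intrM in l2.
by split; lra.
Qed.

Lemma cell_measurable m k : measurable (cell m k).
Proof.
have -> : cell m k = \bigcap_(i : 'I_n)
   ((fun y : V => y 0 i) @^-1` [set t | (k i)%:~R <= 2 ^+ m * t < (k i + 1)%:~R]).
  by apply/seteqP; split=> y; [move/cellP => H i _ /=; exact: H|move=> H; apply/cellP => i; exact: (H i I)].
apply: fin_bigcap_measurable; first exact: finite_finset.
move=> i _; rewrite -[X in measurable X]setTI.
apply: (continuous_measurable_rV (f := fun y : V => y 0 i)) => //.
  by move=> y; exact: coord_continuous.
have m0 : 0 < 2 ^+ m :> R by rewrite exprn_gt0.
have -> : [set t : R | (k i)%:~R <= 2 ^+ m * t < (k i + 1)%:~R] =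
    `[(k i)%:~R / 2 ^+ m, (k i + 1)%:~R / 2 ^+ m[%classic.
  apply/seteqP; split=> t /=; rewrite in_itv /= ler_pdivrMr// ltr_pdivlMr// [t * _]mulrC//.
exact: measurable_itv.
Qed.

Lemma cell_in_open (O : set V) x : open O -> O x -> exists m, cell m (cell_index m x) `<=` O.
Proof.
move=> oO Ox; have /nbhs_ballP [e /= e0 xeO] := open_nbhs_nbhs (conj oO Ox).
have [m me] : exists m : nat, e^-1 <= 2 ^+ m.
  exists (Num.bound e^-1); apply: le_trans (ltW (archi_boundP _)) _.
    by rewrite invr_ge0 ltW.
  by rewrite -natrX ler_nat; apply/ltnW/ltn_expl.
exists m => y yx; apply: xeO; split => // i j; rewrite (ord1 i) /ball /=.
have m0 : 0 < 2 ^+ m :> R by rewrite exprn_gt0.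
have := (cellP m _ y).1 yx j; have := (cellP m _ x).1 erefl j.
set f := cell_index m x j; rewrite intrD => /andP[h1 h2] /andP[h3 h4].
rewrite -(ltr_pM2l m0) -{1}[2 ^+ m]gtr0_norm// -normrM mulrBr.
apply: (@lt_le_trans _ _ 1); first by rewrite ltr_norml; apply/andP; split; lra.
by move: me; rewrite -(ler_pM2r e0) mulVf ?gt_eqF.
Qed.

(** Gaussians centered on a fine grid inside the cell add up to a bounded function
    that is negligible off the cell, so that the sum of their means bounds the
    mass of the cell from below; the number of grid points compensates the power
    of the width. *)
Lemma cell_mass (mu : probability V R) (r0 a c tau1 : R) :
  0 < a -> 0 < c -> 0 < tau1 ->
  (forall x0 h, inner x0 x0 <= r0 -> 0 < h -> h ^+ 2 < tau1 ->
    c * h ^+ n <= \int[mu]_x expR (- (a * inner (x - x0) (x - x0) / h ^+ 2))) ->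
  exists2 c', 0 < c' & forall m k, cell m k `<=` [set x | inner x x <= r0] ->
    c' * (2 ^- m) ^+ n <= fine (mu (cell m k)).
Proof.
move=> a0 c0 t10 Hmass.
have a20 : 0 < a / 2 by rewrite divr_gt0.
have [Cs Cs0 HCs] := gaussian_sum a20.
have Csn0 : 0 < Cs ^+ n by rewrite exprn_gt0.
exists (c / (2 ^+ n * Cs ^+ n)); first by rewrite divr_gt0// mulr_gt0// exprn_gt0.
move=> m k kr.
pose l : R := 2 ^- m.
have l0 : 0 < l by rewrite invr_gt0 exprn_gt0.
have lE : l^-1 = 2 ^+ m by rewrite invrK.
rewrite -/l.
suff main : c * (l / 2) ^+ n <= Cs ^+ n * fine (mu (cell m k)).
  have -> : c / (2 ^+ n * Cs ^+ n) * l ^+ n = c * (l / 2) ^+ n / Cs ^+ n.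
    by rewrite expr_div_n; field; rewrite !expf_neq0// gt_eqF.
  by rewrite ler_pdivrMr// [_ * Cs ^+ n]mulrC.
apply: (le_of_small_slope (ltW Csn0)) => e e0 _.
pose N := maxn (Num.bound (8 / (a * e))) (Num.bound (l ^+ 2 / tau1)) .+1.
have N1 : (0 < N)%N by rewrite /N leq_max orbT.
have NR : 0 < N%:R :> R by rewrite ltr0n.
have N1R : 1 <= N%:R :> R by rewrite ler1n.
have Ne : 8 / (a * e) < N%:R.
  apply: lt_le_trans (archi_boundP _) _; first by rewrite divr_ge0// ltW// mulr_gt0.
  by rewrite ler_nat /N leq_maxl.
have Nt : l ^+ 2 / tau1 < N%:R.
  apply: lt_le_trans (archi_boundP _) _; first by rewrite divr_ge0 ?sqr_ge0// ltW.
  by rewrite ler_nat /N; apply: leq_trans (leqnSn _) (leq_maxr _ _).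
pose h := l / (2 * N%:R).
have h0 : 0 < h by rewrite divr_gt0// mulr_gt0.
have ht : h ^+ 2 < tau1.
  have N2 : N%:R <= (2 * N%:R) ^+ 2 :> R by rewrite expr2; nra.
  rewrite /h expr_div_n ltr_pdivrMr ?exprn_gt0 ?mulr_gt0//.
  move: Nt; rewrite ltr_pdivrMr// => Nt; apply: lt_le_trans Nt _.
  by rewrite mulrC ler_pM2l.
(* The grid fills the middle half of the cell in each coordinate, a quarter of the
   side away from its boundary. *)
pose pt (j : {ffun 'I_n -> 'I_N}) : V :=
  \row_i (l * ((k i)%:~R + 4^-1 + (j i)%:R / (2 * N%:R))).
pose Y (y : V) i := (2 ^+ m * y 0 i - (k i)%:~R - 4^-1) * (2 * N%:R).
have ptE j y : inner (y - pt j) (y - pt j) / h ^+ 2 = \sum_i (Y y i - (j i)%:R) ^+ 2.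
  rewrite /inner mulr_suml; apply: eq_bigr => i _; rewrite !mxE /Y /h -lE.
  by field; rewrite !gt_eqF.
have jN (j : {ffun 'I_n -> 'I_N}) i :
    0 <= (j i)%:R / (2 * N%:R) :> R /\ (j i)%:R / (2 * N%:R) < 2^-1 :> R.
  split; first by nonneg.
  rewrite ltr_pdivrMr ?mulr_gt0// mulrA mulVf// mul1r.
  by rewrite ltr_nat.
have pt_in j : cell m k (pt j).
  apply/cellP => i; rewrite mxE mulrA /l mulfV ?mul1r ?gt_eqF ?exprn_gt0//.
  by have [j1 j2] := jN j i; rewrite intrD; apply/andP; split; lra.
have pt_r j : inner (pt j) (pt j) <= r0 by exact: (kr _ (pt_in j)).
pose f (j : {ffun 'I_n -> 'I_N}) (y : V) :=
  expR (- (a * inner (y - pt j) (y - pt j) / h ^+ 2)).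
have cf j : Cb (f j).
  apply: Cb_expR_opp => [|y]; last by nonneg.
  have csub : continuous (fun x : V => x - pt j).
    by move=> x; apply: continuousB; [exact: cvg_id|exact: cst_continuous].
  apply: continuous_mul; last exact: continuous_const.
  by apply: continuous_mul; [exact: continuous_const|exact: continuous_inner].
have prodE al' y (j : {ffun 'I_n -> 'I_N}) :
    expR (- (al' * \sum_i (Y y i - (j i)%:R) ^+ 2)) =
    \prod_i expR (- (al' * (Y y i - (j i)%:R) ^+ 2)).
  by rewrite mulr_sumr -sumrN expR_sum.
have sum_le y : \sum_(j : {ffun 'I_n -> 'I_N})
    expR (- (a / 2 * \sum_i (Y y i - (j i)%:R) ^+ 2)) <= Cs ^+ n.
  under eq_bigr do rewrite prodE.
  rewrite -(bigA_distr_bigA (fun i (p : 'I_N) => expR (- (a / 2 * (Y y i - p%:R) ^+ 2)))).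
  rewrite -[X in _ <= _ ^+ X]card_ord -prodr_const; apply: ler_prod => i _.
  by rewrite HCs andbT; apply: sumr_ge0 => p _; exact: expR_ge0.
have upper y : \sum_(j : {ffun 'I_n -> 'I_N}) f j y <= Cs ^+ n * \1_(cell m k) y + e * Cs ^+ n.
  have ecs : 0 <= e * Cs ^+ n by nonneg.
  have [yk|yk] := pselect (cell m k y).
    rewrite indicE mem_set// mulr1; apply: (@le_trans _ _ (Cs ^+ n)); last by lra.
    apply: le_trans (sum_le y); apply: ler_sum => j _; rewrite /f -mulrA ptE ler_expR lerN2.
    apply: ler_wpM2r; last by lra.
    by apply: sumr_ge0 => i _; exact: sqr_ge0.
  rewrite indicE memNset// mulr0 add0r.
  have far (j : {ffun 'I_n -> 'I_N}) : N%:R ^+ 2 / 4 <= \sum_i (Y y i - (j i)%:R) ^+ 2.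
    have [i Hi] : exists i, ~ ((k i)%:~R <= 2 ^+ m * y 0 i < (k i + 1)%:~R).
      by apply/existsNP => H; apply: yk; apply/cellP.
    rewrite (bigD1 i)//=; apply: ler_wpDr; first by apply: sumr_ge0 => p _; exact: sqr_ge0.
    have jiN : (j i)%:R <= N%:R :> R by rewrite ler_nat ltnW.
    have ji0 : 0 <= (j i)%:R :> R by exact: ler0n.
    have -> : N%:R ^+ 2 / 4 = (N%:R / 2) ^+ 2 :> R by field.
    have [yl|yl] := ltP (2 ^+ m * y 0 i) (k i)%:~R.
      have : Y y i <= - (N%:R / 2) by rewrite /Y; nra.
      by move=> h1; rewrite -[X in _ <= X]sqrrN; apply: lerXn2r; rewrite ?nnegrE; lra.
    have yu : (k i + 1)%:~R <= 2 ^+ m * y 0 i by rewrite leNgt; apply/negP => h1; apply: Hi; rewrite yl.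
    rewrite intrD in yu.
    have : 3 * (N%:R / 2) <= Y y i by rewrite /Y; nra.
    by move=> h1; apply: lerXn2r; rewrite ?nnegrE; lra.
  apply: (@le_trans _ _ (\sum_(j : {ffun 'I_n -> 'I_N})
     (e * expR (- (a / 2 * \sum_i (Y y i - (j i)%:R) ^+ 2))))).
    apply: ler_sum => j _; rewrite /f -mulrA ptE.
    have -> : - (a * \sum_i (Y y i - (j i)%:R) ^+ 2) = - (a / 2 * \sum_i (Y y i - (j i)%:R) ^+ 2)
       + - (a / 2 * \sum_i (Y y i - (j i)%:R) ^+ 2) by field.
    rewrite expRD ler_wpM2r ?expR_ge0//.
    apply: (@le_trans _ _ (expR (- (a * N%:R / 8)))).
      rewrite ler_expR lerN2; apply: (@le_trans _ _ (a / 2 * (N%:R ^+ 2 / 4))); last first.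
        by apply: ler_wpM2l; [exact: ltW|exact: far].
      have : N%:R <= N%:R ^+ 2 :> R by rewrite expr2 ler_peMl.
      by nra.
    have aN0 : 0 < a * N%:R / 8 by rewrite divr_gt0// mulr_gt0.
    rewrite expRN invf_ple ?posrE ?expR_gt0//.
    apply: (@le_trans _ _ (1 + a * N%:R / 8)); last exact: expR_ge1Dx.
    move: Ne; rewrite ltr_pdivrMr ?mulr_gt0// => Ne.
    rewrite -(ler_pM2r e0) mulVf ?gt_eqF//; nra.
  by rewrite -mulr_sumr ler_pM2l.
have [csum intsum] := Rintegral_sum_Cb mu (index_enum {ffun 'I_n -> 'I_N}) cf.
have lower : c * (l / 2) ^+ n <= \int[mu]_y (\sum_(j : {ffun 'I_n -> 'I_N}) f j y).
  rewrite intsum; apply: (@le_trans _ _ (\sum_(j : {ffun 'I_n -> 'I_N}) c * h ^+ n)).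
    rewrite sumr_const card_ffun !card_ord -[X in _ <= X]mulr_natl natrX mulrCA -exprMn /h.
    by rewrite le_eqVlt; apply/orP; left; apply/eqP; congr (_ * _ ^+ _); field; rewrite gt_eqF.
  by apply: ler_sum => j _; exact: Hmass.
have mk := cell_measurable m k.
have int1 : mu.-integrable setT (EFin \o (\1_(cell m k) : V -> R)).
  by apply: integrable_indic => //; rewrite setTI (le_lt_trans (probability_le1 mu mk))// ltry.
have int2 : mu.-integrable setT (EFin \o (fun _ : V => e * Cs ^+ n)).
  by apply: Cb_integrable; split; [exact: continuous_const|exists `|e * Cs ^+ n|].
have int3 : mu.-integrable setT (EFin \o (fun y => Cs ^+ n * \1_(cell m k) y)).
  exact: (integrableZl measurableT (Cs ^+ n) int1).
have intU : \int[mu]_y (Cs ^+ n * \1_(cell m k) y + e * Cs ^+ n) =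
    Cs ^+ n * fine (mu (cell m k)) + e * Cs ^+ n.
  rewrite RintegralD// RintegralZl// Rintegral_cst//.
  rewrite [fine (mu setT)](congr1 fine (probability_setT mu)) mulr1.
  by rewrite /Rintegral integral_indic// setIT.
rewrite -intU; apply: le_trans lower _; apply: le_Rintegral => //.
- exact: Cb_integrable.
- exact: (integrableD measurableT int3 int2).
Qed.

End dyadic_cells.

(** * Regularity of Borel probabilities *)

Section regularity.
Context {R : realType} {n : nat}.
Local Notation V := 'rV[R]_n.
Variable mu : probability V R.

Lemma decreasing_small (D : nat -> set V) (e : R) : 0 < e ->
  (forall k, measurable (D k)) -> (forall k, D k.+1 `<=` D k) ->
  (mu (\bigcap_k D k) < e%:E)%E -> exists k, (mu (D k) < e%:E)%E.
Proof.
move=> e0 mD decD small.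
have mI : measurable (\bigcap_k D k) by exact: bigcapT_measurable.
have : mu (D k) @[k --> \oo] --> mu (\bigcap_k D k).
  apply: nonincreasing_cvg_mu => //.
  - by apply: le_lt_trans (probability_le1 mu (mD 0%N)) _; rewrite ltry.
  - by apply/nonincreasing_seqP => k; apply/subsetPset; exact: decD.
rewrite -[mu (\bigcap_k D k)]fineK ?fin_num_measure// in small *.
rewrite lte_fin in small.
move=> /fine_cvgP [_ /cvgr_lt /(_ _ small)] [k _ Hk].
exists k; rewrite -[mu (D k)]fineK ?fin_num_measure// lte_fin.
exact: (Hk k (leqnn k)).
Qed.

Definition regular_set (A : set V) := forall e : R, 0 < e -> exists F O,
  [/\ closed F, open O, F `<=` A, A `<=` O & (mu (O `\` F) < e%:E)%E].

Lemma closed_measurable_rV (F : set V) : closed F -> measurable F.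
Proof.
by move=> cF; rewrite -[F]setCK; apply: measurableC; apply: open_measurable_rV; exact: closed_openC.
Qed.

(** The inner approximants are the complements of the neighbourhoods of radius
    [1 / k] of the complement. *)
Lemma open_regular (O : set V) : open O -> regular_set O.
Proof.
move=> oO e e0.
pose U (k : nat) : set V := \bigcup_(y in ~` O) ball y (k.+1%:R^-1 : R).
have oU k : open (U k).
  by apply: bigcup_open => y _; exact: ball_open.
have UO k : ~` O `<=` U k by move=> y Oy; exists y => //; exact: ballxx.
have mOU k : measurable (O `&` U k).
  by apply: measurableI; apply: open_measurable_rV.
have [k Hk] : exists k, (mu (O `&` U k) < e%:E)%E.
  apply: decreasing_small => //.
    move=> k x [Ox [y Oy xy]]; split => //; exists y => //.
    by apply: le_ball xy; rewrite lef_pV2 ?posrE// ler_nat.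
  rewrite (_ : \bigcap_k _ = set0) ?measure0//; apply/seteqP; split=> // x Hx.
  have Ox := (Hx 0%N I).1.
  have /nbhs_ballP [d /= d0 xO] := open_nbhs_nbhs (conj oO Ox).
  have [k Hk] : exists k : nat, k.+1%:R^-1 <= d.
    exists (Num.bound d^-1); rewrite invf_ple ?posrE//.
    apply: le_trans (ltW (archi_boundP _)) _; first by rewrite invr_ge0 ltW.
    by rewrite ler_nat.
  have [_ [y Oy yx]] := Hx k I.
  by apply: Oy; apply: xO; apply: (le_ball Hk); exact: ball_sym.
exists (~` U k), O; split => //; first exact: open_closedC.
  by move=> x Ux; apply: contrapT => Ox; exact: Ux (UO k x Ox).
by rewrite setDE setCK.
Qed.

(** The regular sets form a sigma-algebra. For a countable union the open
    approximants are united, but only finitely many of the closed ones. *)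
Lemma measurable_regular (A : set V) : measurable A -> regular_set A.
Proof.
apply: smallest_sub; last exact: open_regular.
split.
- by apply: open_regular; exact: open0.
- move=> B rB e e0; have [F [U [cF oO FB BO OF]]] := rB e e0.
  exists (~` U), (~` F); split.
  + exact: open_closedC.
  + exact: closed_openC.
  + by move=> x Ox; split => // Bx; exact: Ox (BO x Bx).
  + by move=> x [_ Bx] Fx; exact: Bx (FB x Fx).
  + by rewrite setDE setCK setIC -setDE.
- move=> B rB e e0.
  have e20 : 0 < e / 2 by rewrite divr_gt0.
  have /choice[FO HFO] : forall k, exists FO : set V * set V,
    [/\ closed FO.1, open FO.2, FO.1 `<=` B k, B k `<=` FO.2
      & (mu (FO.2 `\` FO.1) <= (e / 2 / (2 ^ k.+1)%:R)%:E)%E].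
    move=> k; have [|F [U [cF oO FB BO OF]]] := rB k (e / 2 / (2 ^ k.+1)%:R).
      by rewrite divr_gt0// ltr0n expn_gt0.
    by exists (F, U); split => //; exact: ltW.
  pose F k := (FO k).1; pose O k := (FO k).2.
  have mF k : measurable (F k) by apply: closed_measurable_rV; have [] := HFO k.
  have mO k : measurable (O k) by apply: open_measurable_rV; have [] := HFO k.
  pose D k := \bigcup_i O i `\` \big[setU/set0]_(i < k) F i.
  have cbig k : closed (\big[setU/set0]_(i < k) F i).
    by apply: closed_bigsetU => i _; have [] := HFO i.
  have mUO : measurable (\bigcup_i O i) by exact: bigcupT_measurable.
  have mD k : measurable (D k).
    by apply: measurableD => //; exact: closed_measurable_rV.
  have [k Hk] : exists k, (mu (D k) < e%:E)%E.
    apply: decreasing_small => // [k x [Ox nF]|].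
      by split => // Fx; apply: nF; rewrite big_ord_recr /=; left.
    have sub : \bigcap_k D k `<=` \bigcup_i (O i `\` F i).
      move=> x Dx; have [[i _ Oi] _] := Dx 0%N I; exists i => //; split => // Fi.
      have [_] := Dx i.+1 I; apply; rewrite big_ord_recr /=; by right.
    apply: (@le_lt_trans _ _ (e / 2)%:E); last by rewrite lte_fin ltr_pdivrMr// ltr_pMr// ltr1n.
    apply: le_trans (le_measure _ _ _ sub) _; rewrite ?inE//.
      exact: bigcapT_measurable.
      by apply: bigcupT_measurable => i; exact: measurableD.
    have mOF i : measurable (O i `\` F i) by exact: measurableD.
    apply: le_trans (measure_sigma_subadditive mu mOF _ (@subset_refl _ _)) _.
      exact: bigcupT_measurable.
    have := @epsilon_trick0 R (e / 2) xpredT (ltW e20); apply: le_trans.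
    by apply: lee_nneseries => // i _; have [_ _ _ _] := HFO i.
  exists (\big[setU/set0]_(i < k) F i), (\bigcup_i O i); split => //.
  + by apply: bigcup_open => i _; have [] := HFO i.
  + rewrite -bigcup_mkord => x [i /= _ Fi]; exists i => //.
    by have [_ _ FB _ _] := HFO i; exact: FB.
  + move=> x [i _ Bi]; exists i => //; by have [_ _ _ BO _] := HFO i; exact: BO.
Qed.

End regularity.

(** * Absolute continuity of Lebesgue measure *)

Section absolute_continuity.
Context {R : realType} {n : nat}.
Local Notation V := 'rV[R]_n.+1.
Variable mu : probability V R.

(** Every open set is the disjoint union of its maximal dyadic cells, which reduces
    the comparison of two measures on open sets to their comparison on cells. *)
Lemma lebesgue_outer_open_le (c r0 : R) (O : set V) : 0 < c ->
  (forall m k, cell m k `<=` [set x | inner x x <= r0] ->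
    c * (2 ^- m) ^+ n.+1 <= fine (mu (cell m k))) ->
  open O -> O `<=` [set x | inner x x <= r0] ->
  (c%:E * lebesgue_outer O <= mu O)%E.
Proof.
move=> c0 Hc oO Or.
pose maximal m (y : V) := cell m (cell_index m y) `<=` O /\
  forall j, (j < m)%N -> ~ cell j (cell_index j y) `<=` O.
(* The pairs of a scale and a cell index are enumerated; [D i] is the maximal cell
   with code [i], or empty if there is none. *)
pose D i : set V := [set y | exists m,
  pickle_inv i = Some (m, cell_index m y) /\ maximal m y].
have DE i y : D i y -> exists m, D i = cell m (cell_index m y) /\
    cell m (cell_index m y) `<=` O.
  move=> [m [iE [mO mj]]]; exists m; split => //; apply/seteqP; split=> z.
    by move=> [m' [iE' _]]; move: iE'; rewrite iE => -[<-].
  move=> zy; exists m; rewrite iE zy; split => //; split=> [|j jm]; first by rewrite zy.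
  by rewrite (cell_index_coarser (ltnW jm) zy); exact: mj.
have DO i : D i `<=` O.
  by move=> y Dy; have [m [_]] := DE i y Dy; apply.
have HD i : exists box_i : V * V, [/\ measurable (D i), D i `<=` box box_i
    & (c%:E * (box_volume box_i)%:E <= mu (D i))%E].
  have [[y Dy]|D0] := pselect (exists y, D i y).
    have [m [-> mO]] := DE i y Dy; set k := cell_index m y in mO *.
    have m0 : 0 < 2 ^+ m :> R by rewrite exprn_gt0.
    exists (\row_j ((k j)%:~R / 2 ^+ m), \row_j ((k j + 1)%:~R / 2 ^+ m)); split.
    - exact: cell_measurable.
    - move=> z /cellP zk j; rewrite !mxE ler_pdivrMr// ler_pdivlMr// [z 0 j * _]mulrC.
      by have /andP[-> /ltW->] := zk j.
    - rewrite -[mu _]fineK ?fin_num_measure//; last exact: cell_measurable.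
      rewrite -EFinM lee_fin; apply: le_trans (Hc m k _); last exact: subset_trans Or.
      rewrite ler_pM2l// /box_volume.
      rewrite -[X in _ <= _ ^+ X]card_ord -prodr_const; apply: ler_prod => j _.
      rewrite !mxE le_max lexx /= -mulrBl intrD addrC addKr mul1r ge_max lexx andbT.
      by rewrite invr_ge0 ltW.
  have -> : D i = set0 by apply/seteqP; split=> // y Dy; apply: D0; exists y.
  (* A degenerate box, of volume zero since the dimension is positive. *)
  exists (0, 0); split; [exact: measurable0|by []|].
  by rewrite /box_volume big_ord_recl/= mxE subr0 maxxx mul0r mule0 measure0.
have {HD}[cb Hcb] := choice HD.
have cover : O = \bigcup_i D i.
  apply/seteqP; split=> [y Oy|y [i _]]; last exact: DO.
  have [m Hm Hmin] : exists2 m, cell m (cell_index m y) `<=` O &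
      forall j, (j < m)%N -> ~ cell j (cell_index j y) `<=` O.
    have [m Hm] := cell_in_open oO Oy.
    have ex : exists m, `[< cell m (cell_index m y) `<=` O >] by exists m; apply/asboolP.
    case: (ex_minnP ex) => p /asboolP pO pmin; exists p => // j jp /asboolP/pmin.
    by rewrite leqNgt jp.
  exists (pickle (m, cell_index m y)) => //; exists m; split => //; exact: pickleK_inv.
have tD : trivIset setT D.
  apply/trivIsetP => i j _ _; apply: contra_neq_eq => /set0P [y [[m [iE [mO mmin]]]]].
  move=> [m' [jE [mO' mmin']]].
  have mm : m = m'.
    apply/eqP; case: ltngtP => // [/mmin'|/mmin]; exact.
  have invK := @pickle_invK (nat * {ffun 'I_n.+1 -> int})%type.
  by rewrite -[LHS]invK -[RHS]invK iE jE mm.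
rewrite [X in (_ <= mu X)%E]cover measure_semi_bigcup//; last 2 first.
- by move=> i; have [] := Hcb i.
- by rewrite -cover; exact: open_measurable_rV.
apply: (@le_trans _ _ (\sum_(i <oo) (c%:E * (box_volume (cb i))%:E))%E).
  rewrite nneseriesZl; last first.
    by move=> i _; rewrite lee_fin; apply: prodr_ge0 => j _; rewrite le_max lexx.
  apply: lee_wpmul2l; first by rewrite lee_fin ltW.
  apply: ereal_inf_lbound; exists cb => //= y; rewrite cover => -[i _ Di]; exists i => //.
  by have [_ Db _] := Hcb i; exact: Db.
apply: lee_nneseries => [i _ _|i _]; last by have [] := Hcb i.
rewrite -EFinM lee_fin mulr_ge0 ?(ltW c0)//; apply: prodr_ge0 => j _; by rewrite le_max lexx.
Qed.

(** Outer regularity of [mu], applied inside balls, passes the bound for open sets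
    to null sets. *)
Lemma lebesgue_absolutely_continuous :
  (forall r0, exists2 c, 0 < c & forall m k,
    cell m k `<=` [set x : V | inner x x <= r0] ->
    c * (2 ^- m) ^+ n.+1 <= fine (mu (cell m k))) ->
  forall A : set V, measurable A -> mu A = 0 -> lebesgue_outer A = 0.
Proof.
move=> Hr A mA A0.
pose B (j : nat) : set V := [set x | inner x x < j%:R].
have oB j : open (B j).
  exact: open_inner_lt.
have null j : lebesgue_outer (A `&` B j) = 0.
  apply/eqP; rewrite eq_le outer_measure_ge0 andbT; apply/lee_addgt0Pr => e e0; rewrite add0e.
  have [c c0 Hc] := Hr j%:R.
  have ce0 : 0 < c * e by rewrite mulr_gt0.
  have [F [U [cF oU FA AU UF]]] := measurable_regular mu mA ce0.
  have oUB : open (U `&` B j) by exact: openI.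
  have UBj : U `&` B j `<=` [set x | inner x x <= j%:R] by move=> x [_ /ltW].
  apply: (@le_trans _ _ (lebesgue_outer (U `&` B j))).
    by apply: le_outer_measure; exact: setSI.
  rewrite -(@lee_pmul2l _ c%:E)// -[X in (_ <= X)%E]EFinM.
  apply: le_trans (lebesgue_outer_open_le c0 Hc oUB UBj) _.
  have mU : measurable U by exact: open_measurable_rV.
  have mF : measurable F by exact: closed_measurable_rV.
  apply: (@le_trans _ _ (mu (F `|` U `\` F))).
    apply: le_measure; rewrite ?inE; [exact: open_measurable_rV| |].
      by apply: measurableU => //; exact: measurableD.
    by move=> x [Ux _]; have [Fx|Fx] := pselect (F x); [left|right].
  apply: le_trans (measureU2 _ _ _) _ => //; first exact: measurableD.
  apply: le_trans (leeD (_ : _ <= 0)%E (lexx _)) _; last by rewrite add0e EFinM ltW.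
  by rewrite -A0; apply: le_measure; rewrite ?inE.
have -> : A = \bigcup_j (A `&` B j).
  rewrite -setI_bigcupr; apply/seteqP; split=> [x Ax|x []//]; split => //.
  exists (Num.bound (inner x x)) => //; exact: archi_boundP (inner_ge0 x).
apply/eqP; rewrite eq_le outer_measure_ge0 andbT.
apply: le_trans (outer_measure_sigma_subadditive (@lebesgue_outer R n) _) _.
by rewrite eseries0// => i _ _; exact: null.
Qed.

End absolute_continuity.

(** * Density of the bounded continuous functions in L^1 *)

Import HBSimple.

Section density.
Context {R : realType} {n : nat}.
Local Notation V := 'rV[R]_n.
Variable mu : probability V R.
Implicit Types (f g h : V -> R).

Definition L1_norm f : \bar R := (\int[mu]_x `|f x|%:E)%E.

Lemma L1_norm_ge0 f : (0 <= L1_norm f)%E.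
Proof. by apply: integral_ge0 => x _; rewrite lee_fin. Qed.

Lemma measurable_abs f : measurable_fun setT f ->
  measurable_fun setT (fun x => (`|f x| : R)%:E).
Proof. by move=> mf; apply/measurable_EFinP; exact: measurableT_comp. Qed.

Lemma measurable_lin (c : R) f g : measurable_fun setT f -> measurable_fun setT g ->
  measurable_fun setT (fun x => c * f x + g x).
Proof.
move=> mf mg; apply: measurable_funD => //.
by apply: measurable_funM => //; exact: measurable_cst.
Qed.

Lemma L1_norm_lin (c : R) f g : measurable_fun setT f -> measurable_fun setT g ->
  (L1_norm (fun x => c * f x + g x)%R
    <= `|c|%:E * L1_norm f + L1_norm g)%E.
Proof.
move=> mf mg; have mf' := measurable_abs mf; have mg' := measurable_abs mg.
rewrite /L1_norm -ge0_integralZl_EFin// -ge0_integralD//; last first.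
  by apply/measurable_EFinP; apply: measurable_funM;
    [exact: measurable_cst|exact: measurableT_comp].
apply: ge0_le_integral => //.
- by apply: measurable_abs; exact: measurable_lin.
- by apply: emeasurable_funD => //; apply/measurable_EFinP; apply: measurable_funM;
    [exact: measurable_cst|exact: measurableT_comp].
- move=> x _; rewrite -EFinM -EFinD lee_fin -normrM; exact: ler_normD.
Qed.

Definition Cb_approximable f := forall e : R, 0 < e ->
  exists2 g, Cb g & (L1_norm (f \- g)%R < e%:E)%E.

Lemma Cb_approximable_lin (c : R) f g :
  measurable_fun setT f -> measurable_fun setT g ->
  Cb_approximable f -> Cb_approximable g ->
  Cb_approximable (fun x => c * f x + g x).
Proof.
move=> mf mg af ag e e0.
have c0 : 0 < `|c| + 1 by rewrite ltr_wpDl.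
have e1 : 0 < e / 2 / (`|c| + 1) by rewrite !divr_gt0.
have e2 : 0 < e / 2 by rewrite divr_gt0.
have [f' [cf' [Mf HMf]] Hf] := af _ e1; have [g' [cg' [Mg HMg]] Hg] := ag _ e2.
exists (fun x => c * f' x + g' x).
  split; first by apply: continuous_add => //; apply: continuous_mul => //; exact: continuous_const.
  exists (`|c| * Mf + Mg) => x; apply: le_trans (ler_normD _ _) _.
  by apply: lerD => //; rewrite normrM ler_wpM2l.
have -> : (fun x => c * f x + g x) \- (fun x => c * f' x + g' x) =
    (fun x => c * (f \- f') x + (g \- g') x).
  by apply/funext => x /=; ring.
have mf' := continuous_measurable_rV cf'; have mg' := continuous_measurable_rV cg'.
apply: le_lt_trans (L1_norm_lin c (measurable_funB mf mf') (measurable_funB mg mg')) _.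
rewrite (splitr e) EFinD; apply: lee_ltD => //.
  by rewrite ge0_fin_numE ?mule_ge0 ?L1_norm_ge0 ?lee_fin//; apply: lte_mul_pinfty;
    rewrite ?lee_fin//; apply: lt_trans Hf _; rewrite ltry.
apply: (@le_trans _ _ (`|c|%:E * (e / 2 / (`|c| + 1))%:E)%E).
  by rewrite lee_wpmul2l ?lee_fin// ltW.
rewrite -EFinM lee_fin mulrCA -[leRHS]mulr1 ler_pM2l// ler_pdivrMr// mul1r.
by rewrite lerDl.
Qed.

(** A Urysohn function between a closed and an open approximant of [A] differs from
    the indicator of [A] only on their difference, by at most one. *)
Lemma Cb_approximable_indic (A : set V) : measurable A -> Cb_approximable (\1_A).
Proof.
move=> mA e e0; have [F [U [cF oU FA AU UF]]] := measurable_regular mu mA e0.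
have sep : uniform_separator (~` U) F.
  apply: ((@normal_separatorP R V).1 (@pseudometric_normal R V)) => //.
    exact: open_closedC.
  by apply/seteqP; split=> // x [Ux Fx]; exact: Ux (AU _ (FA _ Fx)).
pose g : V -> R := Urysohn (~` U) F.
have cg : continuous g by exact: Urysohn_continuous.
have g01 x : 0 <= g x <= 1.
  have : g x \in `[0, 1] by apply: (@Urysohn_range _ R (~` U) F); exists x.
  by rewrite in_itv.
have g0 x : ~ U x -> g x = 0.
  by move=> Ux; apply: (Urysohn_sub0 sep); exists x.
have g1 x : F x -> g x = 1.
  by move=> Fx; apply: (Urysohn_sub1 sep); exists x.
have mF : measurable F by exact: closed_measurable_rV.
have mU : measurable U by exact: open_measurable_rV.
exists g.
  by split => //; exists 1 => x; have /andP[h1 h2] := g01 x; rewrite ger0_norm.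
apply: le_lt_trans UF; rewrite -[U `\` F]setIT -integral_indic//; last exact: measurableD.
apply: ge0_le_integral => //.
- apply: measurable_abs; apply: measurable_funB; last exact: continuous_measurable_rV.
  exact: measurable_indic.
- by apply/measurable_EFinP; apply: measurable_indic; exact: measurableD.
move=> x _ /=; rewrite lee_fin.
have /andP[h1 h2] := g01 x.
have [Fx|Fx] := pselect (F x).
  by rewrite g1// indicE mem_set ?subrr ?normr0//; exact: FA.
have [Ux|Ux] := pselect (U x).
  rewrite [X in _ <= X]indicE mem_set//= indicE; case: (_ \in A) => /=.
    by rewrite ler_norml; apply/andP; split; lra.
  by rewrite ler_norml; apply/andP; split; lra.
by rewrite g0// !indicE !memNset ?subrr ?normr0// => [[]//|/AU].
Qed.

Lemma Cb_approximable_sum {I : Type} (r : seq I) (c : I -> R) (A : I -> set V) :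
  (forall i, measurable (A i)) ->
  measurable_fun setT (fun x => \sum_(i <- r) c i * \1_(A i) x) /\
  Cb_approximable (fun x => \sum_(i <- r) c i * \1_(A i) x).
Proof.
move=> mA; elim: r => [|i r [mr ar]].
  have -> : (fun x : V => \sum_(i <- [::]) c i * \1_(A i) x) = (fun=> 0).
    by apply/funext => x; rewrite big_nil.
  split; first exact: measurable_cst.
  move=> e e0; exists (fun=> 0).
    by split; [exact: continuous_const|exists 0 => x; rewrite normr0].
  by rewrite /L1_norm integral0_eq ?lte_fin// => x _ /=; rewrite subrr normr0.
have -> : (fun x : V => \sum_(i <- i :: r) c i * \1_(A i) x) =
    (fun x => c i * \1_(A i) x + \sum_(i <- r) c i * \1_(A i) x).
  by apply/funext => x; rewrite big_cons.
have mi : measurable_fun setT (\1_(A i) : V -> R) by exact: measurable_indic.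
split; first exact: measurable_lin.
by apply: Cb_approximable_lin => //; exact: Cb_approximable_indic.
Qed.

Lemma Cb_dense_L1 f : mu.-integrable setT (EFin \o f) -> Cb_approximable f.
Proof.
move=> fi e e0; have e2 : 0 < e / 2 by rewrite divr_gt0.
have mf : measurable_fun setT f by apply/measurable_EFinP; exact: measurable_int fi.
have [g [gi _ lim]] := approximation_sfun_integrable measurableT fi.
have [k Hk] : exists k, (L1_norm (f \- g k)%R < (e / 2)%:E)%E.
  move/fine_cvgP : lim => [fin /cvgr_lt /(_ _ e2)] lt2.
  have [k _ Hk] : \forall k \near \oo, (L1_norm (f \- g k)%R < (e / 2)%:E)%E.
    near=> k; rewrite /L1_norm -[X in (X < _)%E]fineK; last by near: k.
    by rewrite lte_fin; near: k.
  by exists k; exact: (Hk k (leqnn k)).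
have [N [c gE]] : exists N (c : 'I_N -> R),
    (g k : V -> R) = (fun x => \sum_(i < N) c i * \1_(g k @^-1` [set c i]) x).
  eexists; exists (fun i => (finmap.enum_fset (fset_set (range (g k))))`_i).
  by apply/funext => x; exact: fimfunEord.
have [mg ag] := Cb_approximable_sum (index_enum 'I_N) c
  (fun i => measurable_funPTI (g k) (measurable_set1 (c i))).
rewrite -gE in mg ag.
have [h ch Hh] := ag _ e2; exists h => //.
have mh : measurable_fun setT h by apply: continuous_measurable_rV; exact: ch.1.
have -> : f \- h = (fun x => 1 * (f \- g k) x + (g k \- h) x).
  by apply/funext => x /=; ring.
apply: le_lt_trans (L1_norm_lin 1 (measurable_funB mf mg) (measurable_funB mg mh)) _.
by rewrite normr1 mul1e (splitr e) EFinD; exact: lteD.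
Unshelve. all: by end_near. Qed.

End density.

(** * Extension to L^p *)

Section extension.
Context {R : realType} {n : nat}.
Local Notation V := 'rV[R]_n.+1.
Implicit Types (f g h : V -> R).

(** A set of outer measure zero is measurable in the sense of Caratheodory. *)
Lemma null_bounded_Linfty f (y : R) : 0 <= y ->
  lebesgue_outer [set x | y < `|f x|] = 0 -> (Linfty_norm f <= y%:E)%E.
Proof.
move=> y0 null; rewrite /Linfty_norm unlock; case: ifP => _; last by rewrite lee_fin.
apply/ess_supP; exists [set x | y < `|f x|]; split.
- apply: le_caratheodory_measurable => X.
  apply: (@le_trans _ _ (0 + lebesgue_outer X)%E); last by rewrite add0e.
  apply: leeD; last by apply: le_outer_measure => x [].
  by rewrite -null; apply: le_outer_measure => x [].
- exact: null.
- by move=> x /=; rewrite lee_fin => /negP; rewrite -ltNge.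
Qed.

Lemma Lfun1_measurable (mu : probability V R) f : f \in Lfun mu 1%:E ->
  measurable_fun setT f.
Proof. by move=> /Lfun1_integrable fi; apply/measurable_EFinP; exact: measurable_int fi. Qed.

(** The images of an approximating sequence converge in L^1 and hence, by Markov's
    inequality, in measure; a bound of their values by the mean modulus passes to
    the limit. *)
Lemma bound_extends (mus mut : probability V R) (T : (V -> R) -> V -> R) (E : R) f :
  0 < E ->
  (forall g, g \in Lfun mus 1%:E -> T g \in Lfun mut 1%:E) ->
  (forall g, g \in Lfun mus 1%:E -> (L1_norm mut (T g) <= L1_norm mus g)%E) ->
  (forall (c : R) g h, g \in Lfun mus 1%:E -> h \in Lfun mus 1%:E ->
     {ae mut, forall x, T (fun y => c * g y + h y) x = c * T g x + T h x}) ->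
  (forall g, Cb g -> forall x, `|T g x| <= E * \int[mus]_y `|g y|) ->
  f \in Lfun mus 1%:E ->
  mut [set x | E * fine (L1_norm mus f) < `|T f x|] = 0.
Proof.
move=> E0 TL Tcontr Tlin Tb fL.
have mT g : g \in Lfun mus 1%:E -> measurable_fun setT (T g).
  by move=> gL; apply: Lfun1_measurable; exact: TL.
pose A (e : R) := [set x | E * fine (L1_norm mus f) + e < `|T f x|].
have mA e : measurable (A e).
  rewrite -[A e]setTI.
  apply: (@measurable_fun_ltr _ _ _ _ (fun=> E * fine (L1_norm mus f) + e) (fun x => `|T f x|)) => //.
  by apply: measurableT_comp => //; exact: mT.
have fi : mus.-integrable setT (EFin \o f) by exact/Lfun1_integrable.
have finN g : mus.-integrable setT (EFin \o g) -> L1_norm mus g \is a fin_num.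
  move=> gi; rewrite ge0_fin_numE ?L1_norm_ge0//.
  by have /integrableP[_] := gi.
have null e : 0 < e -> mut (A e) = 0.
  move=> e0; apply/eqP; rewrite eq_le measure_ge0 andbT.
  apply/lee_addgt0Pr => d d0; rewrite add0e.
  have e2 : 0 < e / 2 by rewrite divr_gt0.
  pose dl := Num.min (e / 2 / E) (d * (e / 2)).
  have dl0 : 0 < dl by rewrite lt_min divr_gt0//= mulr_gt0.
  have dlE : E * dl <= e / 2 by rewrite mulrC -ler_pdivlMr// ge_min lexx.
  have dld : dl <= d * (e / 2) by rewrite ge_min lexx orbT.
  have [h ch Hh] := Cb_dense_L1 fi dl0.
  have hi := Cb_integrable mus ch.
  have hL : h \in Lfun mus 1%:E by exact/Lfun1_integrable.
  have mf := Lfun1_measurable fL; have mh := Lfun1_measurable hL.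
  have Nh : fine (L1_norm mus h) <= fine (L1_norm mus f) + dl.
    rewrite -lee_fin EFinD !fineK ?finN//.
    have -> : h = (fun x => -1 * (f \- h) x + f x) by apply/funext => x /=; ring.
    apply: le_trans (L1_norm_lin mus (-1) (measurable_funB mf mh) mf) _.
    by rewrite normrN1 mul1e addeC; apply: leeD => //; exact: ltW.
  have dL : (fun y => -1 * h y + f y) \in Lfun mus 1%:E.
    apply/Lfun1_integrable; exact: (integrableD measurableT (integrableZl measurableT (-1) hi) fi).
  have [Z [mZ Z0 HZ]] := Tlin (-1) h f hL fL.
  pose D := T (fun y => -1 * h y + f y).
  have mD : measurable_fun setT D by exact: mT.
  pose B := [set x | ((e / 2)%:E <= `|(EFin \o D) x|)%E].
  have mB : measurable B.
    rewrite -[B]setTI; apply: emeasurable_fun_c_infty => //.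
    by apply: measurableT_comp => //; exact/measurable_EFinP.
  have markov : ((e / 2)%:E * mut B <= dl%:E)%E.
    have := le_integral_abse mut measurableT ((measurable_EFinP _ _).2 mD) e2.
    rewrite setTI => H; apply: le_trans H _.
    apply: le_trans (Tcontr _ dL) _.
    rewrite (_ : (fun y => -1 * h y + f y) = f \- h) ?ltW//.
    by apply/funext => x /=; ring.
  apply: (@le_trans _ _ (mut B)); last first.
    rewrite -[mut B]fineK ?fin_num_measure// lee_fin.
    move: markov; rewrite -[mut B]fineK ?fin_num_measure// -EFinM lee_fin => markov.
    by rewrite -(ler_pM2l e2); apply: le_trans markov _; rewrite [_ * d]mulrC.
  apply: (@le_trans _ _ (mut (B `|` Z))).
    apply: le_measure; rewrite ?inE//; first exact: measurableU.
    move=> x Ax; have [Zx|Zx] := pselect (Z x); [by right|left].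
    have Dx : D x = -1 * T h x + T f x by apply: contrapT => /HZ.
    rewrite /B /= lee_fin Dx mulN1r addrC.
    have := Tb h ch x.
    have -> : \int[mus]_y `|h y| = fine (L1_norm mus h) by [].
    have : E * fine (L1_norm mus h) <= E * fine (L1_norm mus f) + e / 2.
      apply: le_trans (ler_wpM2l (ltW E0) Nh) _; rewrite mulrDr; exact: lerD.
    have := Ax; rewrite /A /=; have := ler_distD (T h x) (T f x) 0; rewrite !subr0.
    lra.
  by apply: le_trans (measureU2 mut mB mZ) _; rewrite [X in (_ + X)%E]Z0 adde0.
have -> : [set x | E * fine (L1_norm mus f) < `|T f x|] = \bigcup_k A k.+1%:R^-1.
  apply/seteqP; split=> [x /= Hx|x [k _]]; last first.
    by apply: lt_trans; rewrite ltrDl invr_gt0.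
  have d0 : 0 < `|T f x| - E * fine (L1_norm mus f) by rewrite subr_gt0.
  exists (Num.bound (`|T f x| - E * fine (L1_norm mus f))^-1) => //; rewrite /A /=.
  rewrite addrC -ltrBrDr invf_plt ?posrE//.
  apply: lt_le_trans (archi_boundP _) _; first by rewrite invr_ge0 ltW.
  by rewrite ler_nat.
apply/eqP; rewrite eq_le measure_ge0 andbT.
apply: le_trans (measure_sigma_subadditive mut (fun k => mA k.+1%:R^-1) _ (@subset_refl _ _)) _.
  by apply: bigcupT_measurable => k; exact: mA.
by rewrite eseries0// => k _ _; apply: null; rewrite invr_gt0.
Qed.

Lemma L1_norm_le_Lnorm (mu : probability V R) (p : R) f : 1 <= p ->
  f \in Lfun mu p%:E ->
  f \in Lfun mu 1%:E /\ (L1_norm mu f <= 'N[mu]_p%:E[EFin \o f])%E.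
Proof.
move=> p1 fp.
have f1 : f \in Lfun mu 1%:E.
  by apply: (Lfun_subset _ _ _ _ fp); rewrite ?lee_fin// fin_num_measure.
split => //; have -> : L1_norm mu f = ('N[mu]_1%:E[EFin \o f])%E by rewrite Lnorm1.
move: p1; rewrite le_eqVlt => /predU1P[<-//|p1].
have p0 : 0 < p by apply: lt_trans p1.
pose q := (1 - p^-1)^-1.
have pV1 : p^-1 < 1 by rewrite invf_lt1.
have q0 : 0 < q by rewrite invr_gt0 subr_gt0.
have := hoelder mu (Lfun1_measurable f1) (measurable_cst (1 : R)) p0 q0.
rewrite invrK addrC subrK => /(_ erefl).
have -> : (f \* (fun=> 1))%R = f by apply/funext => x /=; rewrite mulr1.
have -> : (EFin \o (fun=> 1 : R)) = cst 1%:E by [].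
rewrite (_ : 'N[mu]_q%:E[_] = 1)%E ?mule1//.
by rewrite Lnorm_cst1 [X in poweR X _](probability_setT mu) poweR1r.
Qed.

End extension.

(** * Consequences of the standing assumptions *)

Section consequences_of_the_assumptions.
Context {R : realType} {n : nat}.
Variables (t0 : R) (Q : R -> 'M[R]_n) (b : R -> 'rV[R]_n -> 'rV[R]_n).
Variables (theta eta0 Lambda a gamma r0 : R) (phi : 'rV[R]_n -> R).
Hypothesis SA : standing_assumptions `]t0, +oo[ Q b theta eta0 Lambda a gamma r0 phi.

Lemma itv_after s T : t0 < s -> `[s, T] `<=` `]t0, +oo[.
Proof. by move=> ts t /=; rewrite !in_itv /= andbT => /andP[st _]; exact: lt_le_trans st. Qed.

Lemma itv_after_in t : t0 < t -> `]t0, +oo[%classic t.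
Proof. by rewrite /= in_itv /= andbT. Qed.

Lemma qformE t xi : t0 < t -> qform (Q t) xi = inner (xi *m Q t) xi.
Proof. by move=> /itv_after_in tJ; rewrite /qform (Q_sym SA tJ). Qed.

Lemma b_C1 t i : t0 < t -> C1 (fun x => b t x 0 i).
Proof.
move=> /itv_after_in tJ; split=> [j x|j]; first exact: (b_derivable SA).
have -> : pder j (fun x => b t x 0 i) = (fun x => Dmx (b t) x i j).
  by apply/funext => x; rewrite mxE.
exact: hoelder_continuous (theta_gt0 SA) (Db_hoelder SA i j) tJ.
Qed.

(** The derivative of [<b(t, y + h v), v>] in [h] is the quadratic form of the
    Jacobian matrix at [v = x - y]. *)
Lemma b_monotone t x y : t0 < t -> inner (b t x - b t y) (x - y) <= 0.
Proof.
move=> ts; pose v := x - y.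
pose f (i : 'I_n) (h : R) : R := b t (y + h *: v) 0 i.
have df i (h : R) : is_derive h 1 (f i) (inner (grad (fun x => b t x 0 i) (y + h *: v)) v).
  exact: C1_line (b_C1 i ts).
pose F (h : R) : R := inner (b t (y + h *: v)) v.
have dF (h : R) : is_derive h 1 F (qform (Dmx (b t) (y + h *: v)) v).
  have -> : F = \sum_i (fun h => v 0 i * f i h).
    by apply/funext => k; rewrite fct_sumE; apply: eq_bigr => i _; rewrite mulrC.
  have -> : qform (Dmx (b t) (y + h *: v)) v =
      \sum_i v 0 i * inner (grad (fun x => b t x 0 i) (y + h *: v)) v.
    apply: eq_bigr => i _; rewrite mulrC; congr (_ * _); rewrite mxE.
    by apply: eq_bigr => j _; rewrite !mxE mulrC.
  apply: is_derive_sum => i; exact: is_deriveZ.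
have cF : {within `[0, 1], continuous F}.
  by apply: continuous_subspaceT => h; exact: derive_continuous (dF h).
have [c _] := MVT_segment ler01 (fun h _ => dF h) cF.
have -> : inner (b t x - b t y) (x - y) = F 1 - F 0.
  by rewrite /F scale1r scale0r addr0 [y + _]addrC subrK innerDl innerNl.
rewrite subr0 mulr1 => ->.
apply: le_trans (b_dissipative SA _ _ (itv_after_in ts)) _.
by rewrite nmulr_rle0 ?(r0_lt0 SA)// sqr_ge0.
Qed.

Lemma b_bounded s T r : t0 < s -> exists2 B, 0 <= B &
  forall t x, s <= t <= T -> inner x x <= r -> inner (b t x) (b t x) <= B.
Proof.
move=> ts; have [C HC] := choice (fun i => b_hoelder SA i (Num.sqrt r) (itv_after (T := T) ts)).
pose M i := `|b s 0 0 i| + `|C i| * (`|T - s| `^ (theta / 2) + Num.sqrt r `^ theta).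
have th := theta_gt0 SA.
exists (\sum_i M i ^+ 2) => [|t x /andP[st tT] xr]; first by apply: sumr_ge0 => i _; exact: sqr_ge0.
apply: ler_sum => i _; rewrite -expr2 -[X in X <= _]real_normK ?num_real//.
have M0 : 0 <= M i by rewrite /M; nonneg.
rewrite lerXn2r ?nnegrE//.
have xR : enorm x <= Num.sqrt r by exact: ler_wsqrtr.
have sT : s <= T by exact: le_trans tT.
have e0 : enorm (0 : 'rV[R]_n) = 0.
  by rewrite /enorm /inner big1 ?sqrtr0// => j _; rewrite mxE mul0r.
have := HC i t s x 0; rewrite e0 !in_itv /= st tT lexx sT sqrtr_ge0 subr0.
move=> /(_ erefl erefl xR erefl) H.
have := ler_normD (b t x 0 i - b s 0 0 i) (b s 0 0 i); rewrite subrK => H2.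
apply: le_trans H2 _; rewrite addrC lerD2l; apply: le_trans H _.
apply: (@le_trans _ _ (`|C i| * (`|t - s| `^ (theta / 2) + enorm x `^ theta))).
  by rewrite ler_wpM2r ?ler_norm//; nonneg.
apply: ler_wpM2l => //; apply: lerD; apply: ge0_ler_powR; rewrite ?nnegrE ?enorm_ge0 ?sqrtr_ge0//.
- by rewrite divr_ge0// ltW.
- by rewrite !ger0_norm ?subr_ge0//; exact: lerB.
- exact: ltW.
Qed.

Lemma Q_bounded_increment s : t0 < s -> exists2 C, 0 <= C & forall t, s < t <= s + 1 ->
  mxsum (Q t - Q s) <= C * expR (theta / 2 * ln (t - s)).
Proof.
move=> ts.
have [C HC] := choice (fun ij : 'I_n * 'I_n => Q_hoelder SA ij.1 ij.2 (itv_after (T := s + 1) ts)).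
exists (\sum_i \sum_j `|C (i, j)|) => [|t /andP[st tT]].
  by apply: sumr_ge0 => i _; apply: sumr_ge0.
rewrite /mxsum mulr_suml; apply: ler_sum => i _; rewrite mulr_suml; apply: ler_sum => j _.
rewrite !mxE; have := HC (i, j) t s; rewrite !in_itv /= (ltW st) tT lexx lerDl ler01.
move=> /(_ erefl erefl) H; apply: le_trans H _.
have ts0 : 0 < t - s by rewrite subr_gt0.
rewrite gtr0_norm// /powR gt_eqF// ler_wpM2r ?expR_ge0//; exact: ler_norm.
Qed.

Lemma trace_le t : t0 < t -> \tr (Q t) <= Lambda * n%:R.
Proof.
move=> ts; rewrite -[n in n%:R]card_ord mulr_natr -sumr_const; apply: ler_sum => i _.
have := Q_bounded SA (delta_mx 0 i) (itv_after_in ts).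
rewrite qformE// enorm_sqr !inner_delta -rowE !mxE !eqxx mulr1.
by [].
Qed.

Variables (K3 rho kappa : R).
Hypothesis K3_gt0 : 0 < K3.
Hypothesis rho_gt0 : 0 < rho.
Hypothesis b_inward : forall t x, t0 < t -> ~ eball rho x ->
  inner (b t x) x <= - K3 * enorm x `^ kappa.

Lemma b_inward_sqr t x : t0 < t -> rho ^+ 2 <= inner x x ->
  inner (b t x) x <= - K3 * enorm x `^ kappa.
Proof.
move=> ts rx; apply: b_inward => // /=; apply/negP; rewrite -leNgt.
by rewrite -(@ler_pXn2r _ 2)// ?nnegrE ?enorm_ge0 ?(ltW rho_gt0)// enorm_sqr.
Qed.

Lemma operator_dissipative : dissipative_operator t0 Q b eta0 Lambda.
Proof.
have Lam0 : 0 < Lambda by exact: lt_trans (eta0_gt0 SA) (eta0_lt_Lambda SA).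
split.
- exact: eta0_gt0 SA.
- exact: Lam0.
- by move=> t /itv_after_in; exact: (Q_sym SA).
- by move=> t xi ts; rewrite -qformE// -enorm_sqr; exact: (Q_elliptic SA _ (itv_after_in ts)).
- by move=> t xi ts; rewrite -qformE// -enorm_sqr; exact: (Q_bounded SA _ (itv_after_in ts)).
- exact: b_monotone.
move=> s T ts; have [B B0 HB] := b_bounded T (rho ^+ 2) ts.
exists (2 * (Lambda * n%:R) + (B + rho ^+ 2)) => t x /[dup] stT /andP[st tT].
have tJ : t0 < t by exact: lt_le_trans st.
apply: lerD; first by rewrite ler_pM2l// trace_le.
have [rx|rx] := leP (rho ^+ 2) (inner x x).
  apply: (@le_trans _ _ 0); last by nonneg.
  rewrite pmulr_rle0//; apply: le_trans (b_inward_sqr tJ rx) _.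
  by rewrite mulNr oppr_le0; nonneg.
have := HB t x stT (ltW rx).
by have := inner_ge0 (b t x - x); rewrite !innerE (innerC x); lra.
Qed.

End consequences_of_the_assumptions.

(** * Ultracontractivity *)

Section rate.
Context {R : realType}.
Variables (C : R) (N : nat).
Hypothesis C_gt0 : 0 < C.

(** The successor keeps the rate strictly decreasing when [N = 0]. *)
Definition rate (r : R) : R := expR (C * (1 + r^-1) ^+ N.+1).

Lemma rate_decreasing (r1 r2 : R) : 0 < r1 -> r1 < r2 -> rate r2 < rate r1.
Proof.
move=> r10 r12; have r20 : 0 < r2 by exact: lt_trans r12.
have i10 : 0 < r1^-1 by rewrite invr_gt0.
have i20 : 0 < r2^-1 by rewrite invr_gt0.
rewrite ltr_expR ltr_pM2l// ltrXn2r ?nnegrE//; first by rewrite addr_ge0// ltW.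
by rewrite ltrD2l ltf_pV2.
Qed.

Lemma rate_cvg_pinfty : rate r @[r --> 0^'+] --> +oo.
Proof.
apply/cvgryPge => A; near=> r.
have r0 : 0 < r by near: r; exact: nbhs_right_gt.
have A0 : 0 < `|A| + 1 by rewrite ltr_wpDl.
have rC : r < C / (`|A| + 1) by near: r; apply: nbhs_right_lt; rewrite divr_gt0.
have i0 : 0 < r^-1 by rewrite invr_gt0.
apply: (@le_trans _ _ (1 + C * (1 + r^-1) ^+ N.+1)); last exact: expR_ge1Dx.
apply: (@le_trans _ _ (C * r^-1)).
  rewrite ler_pdivlMr//; move: rC; rewrite ltr_pdivlMr// mulrC => /ltW; apply: le_trans.
  by rewrite ler_pM2r//; have := ler_norm A; lra.
apply: (@le_trans _ _ (C * (1 + r^-1) ^+ N.+1)); last by rewrite lerDr.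
rewrite ler_pM2l//; apply: (@le_trans _ _ (1 + r^-1)); first by rewrite lerDr.
have i1 : 1 <= 1 + r^-1 by rewrite lerDl ltW.
by rewrite exprS ler_peMr ?exprn_ege1//; exact: le_trans i1.
Unshelve. all: by end_near. Qed.

End rate.

Theorem theorem5p4 (R : realType) (n : nat) (t0 : R)
    (Q : R -> 'M[R]_n.+1) (b : R -> 'rV[R]_n.+1 -> 'rV[R]_n.+1)
    (theta eta0 Lambda a gamma r0 : R) (phi : 'rV[R]_n.+1 -> R)
    (G : R -> R -> ('rV[R]_n.+1 -> R) -> 'rV[R]_n.+1 -> R)
    (mu : R -> probability 'rV[R]_n.+1 R)
    (K3 rho kappa : R) :
  standing_assumptions `]t0, +oo[ Q b theta eta0 Lambda a gamma r0 phi ->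
  evolution_operator `]t0, +oo[ Q b theta G ->
  tight `]t0, +oo[ mu ->
  evolution_system_of_measures `]t0, +oo[ G mu ->
  Lp_contraction_extension `]t0, +oo[ G mu ->
  0 < K3 -> 0 < rho -> 2 < kappa ->
  (forall (t : R) (x : 'rV[R]_n.+1), t0 < t -> ~ eball rho x ->
     inner (b t x) x <= - K3 * enorm x `^ kappa) ->
  ultracontractive `]t0, +oo[ G mu.
Proof.
move=> SA EG TI EV LP K30 rho0 kap Hb.
have HA := operator_dissipative SA K30 rho0 Hb.
have th0 := theta_gt0 SA; have th1 := theta_lt1 SA.
have al0 : 0 < theta / 2 by rewrite divr_gt0.
have al1 : theta / 2 <= 2^-1 by lra.
have inJ t : `]t0, +oo[%classic t -> t0 < t by rewrite /= in_itv /= andbT.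
have G_solves s f : t0 < s -> Cb f ->
    bounded_solution Q b s (fun t => G t s f) /\ G s s f = f.
  move=> ts cf; exact: (bounded_classical_solutionP th0 (EG s f (itv_after_in ts) cf)).
have mu_invariant s t f : t0 < s -> s < t -> Cb f ->
    \int[mu t]_x G t s f x = \int[mu s]_x f x.
  move=> ts st cf; rewrite /Rintegral EV//; first exact: itv_after_in.
  exact: itv_after_in (lt_trans ts st).
have [R1 _ tight1] := TI 2^-1 ltac:(by []).
have mu_tight t : t0 < t -> ((1 - 2^-1)%:E <= mu t (eball R1))%E.
  by move=> /itv_after_in; exact: tight1.
have null t A : t0 < t -> measurable A -> mu t A = 0 -> lebesgue_outer A = 0.
  move=> tt; apply: lebesgue_absolutely_continuous => r.
  have [al [c [tau1 [alpha0 c0 tau10 Hmass]]]] := gaussian_mass HA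
    al0 al1 (Q_bounded_increment SA)
    (fun s r ts => b_bounded SA (s + 1) r ts) G_solves mu_invariant mu_tight r tt.
  exact: cell_mass alpha0 c0 tau10 Hmass.
have [C [N [C0 HC]]] := one_to_infty HA K30 kap (b_inward_sqr rho0 Hb) G_solves
  mu_invariant mu_tight.
have rate_bound s t f : t0 < s -> s < t -> Cb f ->
    forall x, `|G t s f x| <= rate C N (t - s) * \int[mu s]_y `|f y|.
  move=> ts st cf x; apply: le_trans (HC s t f ts st cf x) _.
  apply: ler_wpM2r; first by apply: Rintegral_ge0 => y _.
  have i0 : 0 < (t - s)^-1 by rewrite invr_gt0 subr_gt0.
  by rewrite ler_expR ler_pM2l// ler_eXn2l//; lra.
have L1E s f : L1_norm (mu s) f = ('N[mu s]_1%:E[EFin \o f])%E by rewrite Lnorm1.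
have key p s t f : 1 <= p -> t0 < s -> s < t -> f \in Lfun (mu s) p%:E ->
    (Linfty_norm (G t s f) <= (rate C N (t - s) * fine (L1_norm (mu s) f))%:E)%E.
  move=> p1 ts st fp; have tt := lt_trans ts st.
  have [f1 _] := L1_norm_le_Lnorm p1 fp.
  have [TL Tc Tlin] := LP 1 s t (lexx _) (itv_after_in ts) (itv_after_in tt) st.
  have E0 : 0 < rate C N (t - s) by exact: expR_gt0.
  apply: null_bounded_Linfty.
    by rewrite mulr_ge0 ?(ltW E0)// fine_ge0// L1_norm_ge0.
  apply: (null t) => //.
    rewrite -[X in measurable X]setTI.
    apply: (@measurable_fun_ltr _ _ _ _ (fun=> rate C N (t - s) * fine (L1_norm (mu s) f))
      (fun x => `|G t s f x|)) => //.
    by apply: measurableT_comp => //; apply: Lfun1_measurable; exact: TL.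
  apply: bound_extends => // [g gL|g cg]; first by rewrite !L1E; exact: Tc.
  exact: rate_bound.
move=> p p1; split=> [s t /inJ ts _ st f fp|].
  by apply: le_lt_trans (key p s t f p1 ts st fp) _; rewrite ltry.
exists (rate C N); split.
- by move=> r _; exact: expR_gt0.
- exact: rate_decreasing.
- exact: rate_cvg_pinfty.
move=> s t /inJ ts _ st; apply: ge_ereal_sup => _ [f [fp f1] <-].
apply: le_trans (key p s t f p1 ts st fp) _.
have [fL Hle] := L1_norm_le_Lnorm p1 fp.
rewrite lee_fin ler_piMr//; first exact: expR_ge0.
have h1 := le_trans Hle f1.
rewrite -lee_fin fineK// ge0_fin_numE ?L1_norm_ge0//.
by apply: le_lt_trans h1 _; rewrite ltry.
Qed.
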